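(* Let $n\ge3$, let $A=(1\ a_2\ \cdots\ a_n)$ be an integer row matrix with $1<a_2<\cdots<a_n$ (put $a_1=1$), $X=\mathbb{C}^n$, $Y=(x_n=0)\subset X$, $Z=(x_{n-1}=0)\subset X$. Then: (i) For all $\beta\in\mathbb{C}$, $p\in Y\setminus Z$ and $s\ge a_n/a_{n-1}$, $$\mathcal{E}xt^0_{\mathcal{D}_X}(\mathcal{M}_A(\beta),\mathcal{O}_{\widehat{X|Y}}(s))_p=\bigoplus_{j=0}^{a_{n-1}-1}\mathbb{C}\,\phi_{v^j,p}.$$ (ii) For all $p\in Y\setminus Z$ and $1\le s<a_n/a_{n-1}$, $$\mathcal{E}xt^0_{\mathcal{D}_X}(\mathcal{M}_A(\beta),\mathcal{O}_{\widehat{X|Y}}(s))_p=\begin{cases}0&\text{if }\beta\notin\mathbb{N},\\ \mathbb{C}\,\phi_{v^q}&\text{if }\beta\in\mathbb{N},\end{cases}$$ where (for $\beta\in\mathbb{N}$) $q$ is the unique element of $\{0,1,\dots,a_{n-1}-1\}$ satisfying $\frac{\beta-q}{a_{n-1}}\in\mathbb{N}$, and $\phi_{v^q}$ is a polynomial.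
   Context: $\mathbb{N}=\{0,1,2,\dots\}$. Hypergeometric system: $X=\mathbb{C}^n$ with coordinates $x_1,\dots,x_n$; $\mathcal{O}_X$ is the sheaf of holomorphic functions and $\mathcal{D}_X$ the sheaf of linear differential operators with holomorphic coefficients; $\partial_i=\partial/\partial x_i$. For a row matrix $A=(a_1\ \cdots\ a_n)$ of positive integers and $\beta\in\mathbb{C}$, $I_A\subset\mathbb{C}[\partial_1,\dots,\partial_n]$ is the toric ideal generated by all $\partial^{u_+}-\partial^{u_-}$, where $u\in\mathbb{Z}^n$, $Au=0$, $u=u_+-u_-$ with $u_\pm\in\mathbb{N}^n$ of disjoint support. $H_A(\beta)$ is the left ideal of the Weyl algebra $A_n(\mathbb{C})$ generated by $I_A$ and $E(\beta)=\sum_{j=1}^n a_jx_j\partial_j-\beta$, and $\mathcal{M}_A(\beta)=\mathcal{D}_X/\mathcal{D}_XH_A(\beta)$. Gevrey sheaves: $\mathcal{O}_{\widehat{X|Y}}=\varprojlim_k\mathcal{O}_X/(x_n^k)$ is the formal completion along $Y=(x_n=0)$. For real $s\ge1$, $\mathcal{O}_{\widehat{X|Y}}(s)$ is the subsheaf of Gevrey series of order $s$: a germ $f=\sum_{i\ge0}f_i(x_1,\dots,x_{n-1})x_n^i$ at $p\in Y$ lies in it iff $\sum_{i\ge0}\frac{1}{(i!)^{s-1}}f_i x_n^i$ converges at $p$. Put $\mathcal{O}_{\widehat{X|Y}}(\infty)=\mathcal{O}_{\widehat{X|Y}}$. $\mathcal{E}xt^0_{\mathcal{D}_X}(\mathcal{M}_A(\beta),\mathcal{O}_{\widehat{X|Y}}(s))_p$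 is identified with the space of $f\in\mathcal{O}_{\widehat{X|Y}}(s)_p$ annihilated by $H_A(\beta)$. $\Gamma$-series: for $0\le j\le a_{n-1}-1$ set $v^j=(j,0,\dots,0,\frac{\beta-j}{a_{n-1}},0)\in\mathbb{C}^n$ (nonzero entries allowed only in positions $1$ and $n-1$) and, the sum being over $(m_2,\dots,m_n)\in\mathbb{N}^{n-1}$ with $e_j:=j-\sum_{2\le i\le n,\,i\ne n-1}a_im_i+a_{n-1}m_{n-1}\ge0$, $$\phi_{v^j}=\sum\frac{\big(\frac{\beta-j}{a_{n-1}}\big)_{m_{n-1}}\,j!}{m_2!\cdots m_{n-2}!\,m_n!\,e_j!}\;x_1^{e_j}x_2^{m_2}\cdots x_{n-2}^{m_{n-2}}x_{n-1}^{\frac{\beta-j}{a_{n-1}}-m_{n-1}}x_n^{m_n},$$ where $(z)_m=z(z-1)\cdots(z-m+1)$. For $p\in Y\setminus Z$, $\phi_{v^j,p}$ denotes its germ at $p$, viewed as a series in $x_n$ with coefficients holomorphic near $p$ (for a chosen branch of $x_{n-1}^{(\beta-j)/a_{n-1}}$ near $p$). *)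

(* Defs.v *)
From HB Require Import structures.
From mathcomp Require Import all_boot all_order all_algebra finmap.
From mathcomp Require Import complex.
From mathcomp Require Import all_classical all_reals all_analysis.
(* The notations of [mpoly] clash with those of the analysis library. *)
From mathcomp Require Import -(notations) mpoly.

Set Implicit Arguments.
Unset Strict Implicit.
Unset Printing Implicit Defensive.

Import Order.TTheory GRing.Theory Num.Theory.
Import numFieldNormedType.Exports.

Local Open Scope classical_set_scope.
Local Open Scope ring_scope.
Local Open Scope complex_scope.

(* The field of complex numbers over [R].  Going through [numFieldType] gives it
   the topology and the normed structures of the analysis library, which
   [R[i]] does not carry by itself. *)
Definition cplx (R : realType) : numFieldType := R[i].

Section ComplexAnalysis.
Variable R : realType.
Local Notation C := (cplx R).

Definition of_real (r : R) : C := r%:C.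

Definition cexp (z : C) : C :=
  let: x +i* y := z : R[i] in (expR x * cos y) +i* (expR x * sin y).

Definition log_branch (c : C) (ell : C -> C) : Prop :=
  \forall x \near c, {for x, continuous ell} /\ cexp (ell x) = x.

(* Unconditional (equivalently, absolute) summation of a family of complex
   numbers. *)
Definition has_sum (I : choiceType) (u : I -> C) (l : C) : Prop :=
  forall e : R, 0 < e -> exists A : {fset I},
    forall B : {fset I}, (A `<=` B)%fset -> `|\sum_(i <- B) u i - l| < of_real e.

Definition famsum (I : choiceType) (u : I -> C) : C := xget 0 (has_sum u).

(* Holomorphy in several variables in the sense of Weierstrass: [f] is
   holomorphic on an open set [U] when [analytic_at f w] for every [w] in [U]. *)
Definition analytic_at (n : nat) (f : 'rV[C]_n -> C) (w : 'rV[C]_n) : Prop :=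
  exists c : {ffun 'I_n -> nat} -> C, nbhs w (fun z : 'rV[C]_n =>
    has_sum (fun m => c m * \prod_(i < n) (z 0 i - w 0 i) ^+ m i) (f z)).

Definition ffact_C (z : C) (m : nat) : C := \prod_(l < m) (z - l%:R).

End ComplexAnalysis.

Section Formal.
Variables (R : realType) (n : nat).
Local Notation C := (cplx R).

(* X = C^(n+1), with last coordinate [ord_max], and Y = (x_(n+1) = 0) is
   identified with C^n by forgetting that coordinate (on points, by
   [col' ord_max]).  A germ at p of the formal completion of O_X along Y is
   represented by the coefficients f_i of the powers of the last coordinate;
   they are total functions, only relevant near p. *)
Definition fseries := nat -> 'rV[C]_n -> C.

Definition germ_eq (p : 'rV[C]_n.+1) (f g : fseries) : Prop :=
  \forall y \near (col' ord_max p : 'rV[C]_n), forall i, f i y = g i y.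

(* All the coefficients are holomorphic on one common neighbourhood of p. *)
Definition formal_germ (p : 'rV[C]_n.+1) (f : fseries) : Prop :=
  \forall y \near (col' ord_max p : 'rV[C]_n), forall i, analytic_at (f i) y.

Definition convergent_at (p : 'rV[C]_n.+1) (f : fseries) : Prop :=
  exists F : 'rV[C]_n.+1 -> C, \forall x \near p, analytic_at F x /\
    (fun N : nat => \sum_(i < N) f i (col' ord_max x) * x 0 ord_max ^+ i)
      @ \oo --> F x.

Definition gevrey (s : \bar R) (p : 'rV[C]_n.+1) (f : fseries) : Prop :=
  formal_germ p f /\
  match s with
  | r%:E => convergent_at p
      (fun i y => f i y / of_real ((i`!)%:R `^ (r - 1)))
  | +oo%E => True
  | -oo%E => False
  end.

(* The Weyl algebra A_(n+1)(C): terms over the generators, modulo the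
   congruence [weyl_eq]. *)
Inductive weyl : Type :=
| WC of C
| WX of 'I_n.+1
| WD of 'I_n.+1
| WAdd of weyl & weyl
| WMul of weyl & weyl.

Inductive weyl_eq : weyl -> weyl -> Prop :=
| weyl_refl P : weyl_eq P P
| weyl_sym P Q : weyl_eq P Q -> weyl_eq Q P
| weyl_trans P Q S : weyl_eq P Q -> weyl_eq Q S -> weyl_eq P S
| weyl_congA P P' Q Q' :
    weyl_eq P P' -> weyl_eq Q Q' -> weyl_eq (WAdd P Q) (WAdd P' Q')
| weyl_congM P P' Q Q' :
    weyl_eq P P' -> weyl_eq Q Q' -> weyl_eq (WMul P Q) (WMul P' Q')
| weyl_addA P Q S : weyl_eq (WAdd P (WAdd Q S)) (WAdd (WAdd P Q) S)
| weyl_addC P Q : weyl_eq (WAdd P Q) (WAdd Q P)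
| weyl_add0 P : weyl_eq (WAdd (WC 0) P) P
| weyl_mulA P Q S : weyl_eq (WMul P (WMul Q S)) (WMul (WMul P Q) S)
| weyl_mulDl P Q S :
    weyl_eq (WMul (WAdd P Q) S) (WAdd (WMul P S) (WMul Q S))
| weyl_mulDr P Q S :
    weyl_eq (WMul P (WAdd Q S)) (WAdd (WMul P Q) (WMul P S))
| weyl_mul0 P : weyl_eq (WMul (WC 0) P) (WC 0)
| weyl_mul1 P : weyl_eq (WMul (WC 1) P) P
| weyl_constD c d : weyl_eq (WC (c + d)) (WAdd (WC c) (WC d))
| weyl_constM c d : weyl_eq (WC (c * d)) (WMul (WC c) (WC d))
| weyl_constC c P : weyl_eq (WMul (WC c) P) (WMul P (WC c))
| weyl_XX i j : weyl_eq (WMul (WX i) (WX j)) (WMul (WX j) (WX i))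
| weyl_DD i j : weyl_eq (WMul (WD i) (WD j)) (WMul (WD j) (WD i))
| weyl_DX i j : weyl_eq (WMul (WD i) (WX j))
    (WAdd (WMul (WX j) (WD i)) (WC (i == j)%:R)).

Definition weyl_sum (s : seq weyl) : weyl := foldr WAdd (WC 0) s.
Definition weyl_prod (s : seq weyl) : weyl := foldr WMul (WC 1) s.

Definition fmulX (j : 'I_n.+1) (f : fseries) : fseries := fun i y =>
  match unlift ord_max j with
  | Some j' => y 0 j' * f i y
  | None => if i is i'.+1 then f i' y else 0
  end.

Definition fderiv (j : 'I_n.+1) (f : fseries) : fseries := fun i y =>
  match unlift ord_max j with
  | Some j' => 'D_(delta_mx 0 j') (f i) y
  | None => i.+1%:R * f i.+1 y
  end.

Fixpoint weyl_act (P : weyl) (f : fseries) : fseries :=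
  match P with
  | WC c => fun i y => c * f i y
  | WX j => fmulX j f
  | WD j => fderiv j f
  | WAdd P1 P2 => fun i y => weyl_act P1 f i y + weyl_act P2 f i y
  | WMul P1 P2 => weyl_act P1 (weyl_act P2 f)
  end.

(* C[d_1, .., d_(n+1)]; the order of the factors below is irrelevant since the
   d_j commute. *)
Local Notation dpoly := (mpoly n.+1 C).

Definition weyl_of_dpoly (P : dpoly) : weyl :=
  weyl_sum [seq WMul (WC (mcoeff m P))
      (weyl_prod [seq weyl_prod (nseq (m j) (WD j)) | j : 'I_n.+1])
    | m : multinom n.+1 <- msupp P].

Variable a : 'I_n.+1 -> nat.

Definition pos_part (u : 'I_n.+1 -> int) : multinom n.+1 :=
  Multinom [tuple (if 0 <= u i then `|u i|%N else 0%N) | i < n.+1].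

Definition neg_part (u : 'I_n.+1 -> int) : multinom n.+1 :=
  Multinom [tuple (if u i <= 0 then `|u i|%N else 0%N) | i < n.+1].

Inductive toric_ideal : dpoly -> Prop :=
| toric_gen (u : 'I_n.+1 -> int) : \sum_i (a i)%:Z * u i = 0 ->
    toric_ideal (mpolyX C (pos_part u) - mpolyX C (neg_part u))
| toric_add P Q : toric_ideal P -> toric_ideal Q -> toric_ideal (P + Q)
| toric_mul P Q : toric_ideal Q -> toric_ideal (P * Q).

Definition euler_op (beta : C) : weyl :=
  WAdd (weyl_sum [seq WMul (WC (a j)%:R) (WMul (WX j) (WD j)) | j : 'I_n.+1])
    (WC (- beta)).

Inductive hyp_ideal (beta : C) : weyl -> Prop :=
| hyp_toric P : toric_ideal P -> hyp_ideal beta (weyl_of_dpoly P)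
| hyp_euler : hyp_ideal beta (euler_op beta)
| hyp_add P Q :
    hyp_ideal beta P -> hyp_ideal beta Q -> hyp_ideal beta (WAdd P Q)
| hyp_mul P Q : hyp_ideal beta Q -> hyp_ideal beta (WMul P Q)
| hyp_eq P Q : weyl_eq P Q -> hyp_ideal beta P -> hyp_ideal beta Q.

(* The stalk at p of Ext^0(M_A(beta), O_(X|Y)^(s)), M_A(beta) = D_X/D_X H_A(beta),
   as the space of solutions in O_(X|Y)^(s)_p. *)
Definition ext0 (beta : C) (s : \bar R) (p : 'rV[C]_n.+1) (f : fseries) :
    Prop :=
  gevrey s p f /\
  forall P, hyp_ideal beta P -> germ_eq p (weyl_act P f) (fun _ _ => 0).

Definition lincomb (r : nat) (c : 'I_r -> C) (phi : 'I_r -> fseries) :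
    fseries := fun i y => \sum_(j < r) c j * phi j i y.

Definition is_direct_sum (p : 'rV[C]_n.+1) (S : fseries -> Prop)
    (r : nat) (phi : 'I_r -> fseries) : Prop :=
  (forall f, S f <-> exists c, germ_eq p f (lincomb c phi)) /\
  (forall c, germ_eq p (lincomb c phi) (fun _ _ => 0) -> forall j, c j = 0).

(* The expansion of a polynomial in powers of the last variable. *)
Definition fseries_of_mpoly (P : mpoly n.+1 C) : fseries := fun i y =>
  \sum_(m <- msupp P | m ord_max == i)
    mcoeff m P * \prod_(j < n) y 0 j ^+ m (lift ord_max j).

Definition is_polynomial (p : 'rV[C]_n.+1) (f : fseries) : Prop :=
  exists P : mpoly n.+1 C, germ_eq p f (fseries_of_mpoly P).

End Formal.

Section GammaSeries.
Variables (R : realType) (d : nat) (a : 'I_d.+3 -> nat).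
Local Notation C := (cplx R).

(* Here n = d + 3.  The indices n and n-1 are [ord_max] and [penult]; the
   coordinates x_1, x_2, .., x_(n-2), x_(n-1) on Y = C^(d+2) are those of index
   [ord0], [mid 0], .., [mid (d-1)], [ord_max]. *)
Definition penult : 'I_d.+3 := lift ord_max ord_max.
Definition mid (r : 'I_d) : 'I_d.+2 := lift ord_max (lift ord0 r).

Definition gamma_exp (beta : C) (j : nat) : C :=
  (beta - j%:R) / (a penult)%:R.

(* [m] is (m_2, .., m_(n-2)), [l] is m_(n-1) and [i] is m_n; the term is 0 when
   e_j < 0.  The branch of x_(n-1)^z is exp (z * ell x_(n-1)). *)
Definition gamma_term (beta : C) (ell : C -> C) (j i : nat)
    (y : 'rV[C]_d.+2) (ml : {ffun 'I_d -> nat} * nat) : C :=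
  let: (m, l) := ml in
  let pos := (j + a penult * l)%N in
  let neg := (\sum_(r < d) a (lift ord_max (mid r)) * m r + a ord_max * i)%N in
  if (neg <= pos)%N then
    ffact_C (gamma_exp beta j) l * (j`!)%:R
      / ((\prod_(r < d) (m r)`! * i`! * (pos - neg)`!)%N)%:R
    * y 0 ord0 ^+ (pos - neg)
    * (\prod_(r < d) y 0 (mid r) ^+ m r)
    * cexp ((gamma_exp beta j - l%:R) * ell (y 0 ord_max))
  else 0.

Definition gamma_series (beta : C) (ell : C -> C) (j : nat) :
    fseries R d.+2 :=
  fun i y => famsum (gamma_term beta ell j i y).

End GammaSeries.

(* Main.v *)
Require Import Defs.
From HB Require Import structures.
From mathcomp Require Import all_boot all_order all_algebra finmap.
From mathcomp Require Import complex ring lra.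
From mathcomp Require Import all_classical all_reals all_analysis.
From mathcomp Require Import -(notations) mpoly.

(* On a small neighbourhood of p in Y the equations say that d_v f = d_1^(a_v) f
   and that the Euler operator kills f.  Hence the germ f is determined by the
   numbers D_k = (d_1^k f)(p), and the Euler equation becomes the recurrence
     sum_v a_v p_v D_(k + a_v) = (beta - k) D_k   (v < n).
   As p_(n-1) <> 0, it determines D from its first N = a_(n-1) terms, so that there
   are at most N independent solutions.  The N series phi_(v^j) are solutions; they
   are independent because their Taylor expansions converge up to the axis
   x_1 = .. = x_(n-2) = 0, where d_1^k phi_(v^j) vanishes for k < N, k <> j, but not
   for k = j.  They are Gevrey of order a_n / N since l! is bounded by the N-th
   root of a product of factorials of the other exponents.
     If f has Gevrey order s < a_n / N, then |D_k| <= K A^k k!^sigma with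
   sigma N < 1, and (beta - k) D_k is a combination of later terms: a contraction
   argument gives D_k = 0 for large k, and then for all k by descent, except that
   for beta in NN the value of D_beta is free.  In that case phi_(v^q) is a
   polynomial, with D_beta <> 0. *)

Set Implicit Arguments.
Unset Strict Implicit.
Unset Printing Implicit Defensive.

Import Order.TTheory GRing.Theory Num.Theory.
Import numFieldNormedType.Exports.

Local Open Scope classical_set_scope.
Local Open Scope ring_scope.

(** * Summable families of complex numbers *)

(** The threshold [a_n / N] comes from one identity: [d_n^i f = d_1^(a_n i) f] gives
    [i! f_i = d_1^(a_n i) f_0], so that Gevrey growth [i!^(s-1)] of the coefficients becomes growth
    [k!^(s / a_n)] of [D_k]. Hence sigma is [s / a_n], and [sigma N < 1] means [s < a_n / N]. The
    same number governs the Gamma-series. In the bound on the [N]-th power of a term each variable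
    competes with [N] through its weight. Weights below [N] leave a factorial gain, so
    [x_1, .., x_(n-2)] may move arbitrarily far; this is what makes the axis reachable from every
    [p]. Weight [N] costs only a small increment of [x_(n-1)]. The weight of [x_n] gives a factorial
    loss, which the Gevrey factor repairs when [N s >= a_n]. Spanning needs no existence theorem:
    independence together with the recurrence makes the [N] by [N] matrix of the first Taylor
    numbers of the Gamma-series invertible. A branch of the logarithm is only a continuous right
    inverse of the exponential, so its power series is obtained from a differential equation. All
    series are sums of unordered families, and every rearrangement is an instance of Fubini. *)

Section CplxNorm.
Variable R : realType.
Local Notation C := (cplx R).

(** The norm [|z|] lies in [C], where the order is only partial; real values give access to suprema,
    maxima and real linear arithmetic. *)
Definition cnorm (z : C) : R := ComplexField.Normc.normc (z : R[i]).

Lemma cnormE (z : C) : `|z| = of_real (cnorm z).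
Proof. by []. Qed.

Lemma of_real_le (x y : R) : (of_real x <= of_real y) = (x <= y).
Proof. by rewrite /of_real lecR. Qed.

Lemma of_real_lt (x y : R) : (of_real x < of_real y) = (x < y).
Proof. by rewrite /of_real ltcR. Qed.

Lemma of_realD (x y : R) : of_real (x + y) = of_real x + of_real y.
Proof. exact: (rmorphD (real_complex R)). Qed.

Lemma of_realM (x y : R) : of_real (x * y) = of_real x * of_real y.
Proof. exact: (rmorphM (real_complex R)). Qed.

Lemma of_real_nat n : of_real (n%:R) = n%:R :> C.
Proof. exact: (rmorph_nat (real_complex R)). Qed.

Lemma of_real_inj : injective (@of_real R).
Proof. exact: complexI. Qed.

Lemma cnorm_ge0 (z : C) : 0 <= cnorm z.
Proof. by rewrite -of_real_le -cnormE; exact: normr_ge0. Qed.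

Lemma cnorm0 : cnorm 0 = 0.
Proof. exact: ComplexField.Normc.normc0. Qed.

Lemma cnorm1 : cnorm 1 = 1.
Proof. exact: ComplexField.Normc.normc1. Qed.

Lemma cnorm0_eq0 (z : C) : cnorm z = 0 -> z = 0.
Proof. exact: ComplexField.Normc.eq0_normc. Qed.

Lemma cnorm_eq0 (z : C) : (cnorm z == 0) = (z == 0).
Proof. by apply/eqP/eqP => [/cnorm0_eq0//|->]; exact: cnorm0. Qed.

Lemma cnorm_gt0 (z : C) : (0 < cnorm z) = (z != 0).
Proof. by rewrite lt_neqAle eq_sym cnorm_eq0 cnorm_ge0 andbT. Qed.

Lemma cnormM (z w : C) : cnorm (z * w) = cnorm z * cnorm w.
Proof. exact: ComplexField.Normc.normcM. Qed.

Lemma cnormV (z : C) : cnorm z^-1 = (cnorm z)^-1.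
Proof. exact: ComplexField.Normc.normcV. Qed.

Lemma cnormN (z : C) : cnorm (- z) = cnorm z.
Proof. by apply: of_real_inj; rewrite -!cnormE normrN. Qed.

Lemma cnormX (z : C) n : cnorm (z ^+ n) = cnorm z ^+ n.
Proof.
by elim: n => [|n IH]; [rewrite !expr0 cnorm1|rewrite !exprS cnormM IH].
Qed.

Lemma cnormD (z w : C) : cnorm (z + w) <= cnorm z + cnorm w.
Proof. by rewrite -of_real_le of_realD -!cnormE ler_normD. Qed.

Lemma cnormB (z w : C) : cnorm (z - w) <= cnorm z + cnorm w.
Proof. by rewrite -(cnormN w) cnormD. Qed.

Lemma cnorm_distC (z w : C) : cnorm (z - w) = cnorm (w - z).
Proof. by rewrite -cnormN opprB. Qed.

Lemma cnorm_real (x : R) : cnorm (of_real x) = `|x|.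
Proof. by rewrite /cnorm /of_real /= expr0n /= addr0 sqrtr_sqr. Qed.

Lemma cnorm_nat n : cnorm n%:R = n%:R.
Proof. by rewrite -of_real_nat cnorm_real normr_nat. Qed.

Lemma cnorm_sum (I : Type) (r : seq I) (P : pred I) (F : I -> C) :
  cnorm (\sum_(i <- r | P i) F i) <= \sum_(i <- r | P i) cnorm (F i).
Proof.
elim/big_ind2: _ => [|x a y b h1 h2|//]; first by rewrite cnorm0.
by apply: le_trans (cnormD _ _) _; exact: lerD.
Qed.

Lemma cnorm_prod (I : Type) (r : seq I) (P : pred I) (F : I -> C) :
  cnorm (\prod_(i <- r | P i) F i) = \prod_(i <- r | P i) cnorm (F i).
Proof. by elim/big_ind2: _ => [|x a y b <- <-|//]; rewrite ?cnorm1 ?cnormM. Qed.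

Lemma cnorm_lt_eps0 (z : C) : (forall e : R, 0 < e -> cnorm z < e) -> z = 0.
Proof.
move=> h; apply: cnorm0_eq0; apply/eqP; rewrite eq_le cnorm_ge0 andbT.
by apply/ler_addgt0Pl => e e0; rewrite addr0; apply/ltW/h.
Qed.

Lemma Re_le_cnorm (z : C) : `|complex.Re (z : R[i])| <= cnorm z.
Proof. by rewrite -of_real_le -cnormE; exact: normc_ge_Re. Qed.

Lemma Im_le_cnorm (z : C) : `|complex.Im (z : R[i])| <= cnorm z.
Proof.
case: z => a b; rewrite /cnorm /= -sqrtr_sqr ler_sqrt ?lerDr ?sqr_ge0//.
by rewrite addr_ge0 ?sqr_ge0.
Qed.

Lemma cnorm_le_ReIm (z : C) : cnorm z <= `|complex.Re (z : R[i])| + `|complex.Im (z : R[i])|.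
Proof.
have E : z = of_real (complex.Re (z : R[i])) + of_real (complex.Im (z : R[i])) * 'i%C.
  case: z => a b; rewrite /of_real; apply/eqP.
  by rewrite eq_complex /=; rewrite !mulr0 !mul0r mulr1 subr0 !addr0 add0r !eqxx.
rewrite {1}E.
apply: le_trans (cnormD _ _) _; rewrite cnormM !cnorm_real.
have -> : cnorm 'i%C = 1 by rewrite /cnorm /= expr0n expr1n /= add0r sqrtr1.
by rewrite mulr1.
Qed.

End CplxNorm.

Section FsetSums.
Variables (R : realType).

Lemma fset_sum_le (I : choiceType) (F : I -> R) (A B : {fset I}) :
  (forall i, 0 <= F i) -> (A `<=` B)%fset ->
  \sum_(i <- A) F i <= \sum_(i <- B) F i.
Proof.
move=> F0 AB; rewrite [leRHS](big_fsetID _ (mem A)) /=.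
have -> : [fset x in B | x \in A]%fset = A.
  by apply/fsetP => x; rewrite !inE/= andb_idl//; apply/fsubsetP.
by rewrite lerDl sumr_ge0.
Qed.

Lemma sum_fsetM (V : nmodType) (I J : choiceType) (u : I * J -> V)
    (A : {fset I}) (B : {fset J}) :
  \sum_(x <- (A `*` B)%fset) u x = \sum_(i <- A) \sum_(j <- B) u (i, j).
Proof.
transitivity (\sum_(x <- [seq (i, j) | i <- (A : seq I), j <- (B : seq J)]) u x); last first.
  by rewrite big_allpairs_dep.
apply: perm_big; apply: uniq_perm; first exact: fset_uniq.
  by apply: allpairs_uniq; rewrite ?fset_uniq// => -[a b] [c e].
move=> [i j]; rewrite in_fsetM/=; apply/andP/allpairsP => /= [[iA jB]|].
  by exists (i, j).
by case=> -[i' j'] /= [? ? [-> ->]].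
Qed.

(** [f] inverts [g] on the support of [w], so [g] is injective there; indices with [w j = 0]
    contribute nothing and need no image. *)
Lemma fset_sum_transfer (V : nmodType) (I J : choiceType)
    (u : I -> V) (w : J -> V) (f : I -> J) (g : J -> I) (B : {fset J}) :
  (forall j, w j != 0 -> f (g j) = j /\ u (g j) = w j) ->
  \sum_(j <- B) w j = \sum_(i <- (g @` [fset j in B | w j != 0])%fset) u i.
Proof.
move=> gP; rewrite big_imfset /=; last first.
  move=> x y; rewrite !inE/= => /andP[_ x0] /andP[_ y0] gxy.
  by have [<- _] := gP _ x0; have [<- _] := gP _ y0; rewrite gxy.
rewrite (big_fsetID _ (fun j => w j != 0))/= [X in _ + X]big1_fset ?addr0.
  rewrite big_seq [RHS]big_seq; apply: eq_bigr => j.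
  by rewrite !inE /= => /andP[_ /gP[]].
by move=> j; rewrite !inE/= negbK => /andP[_ /eqP].
Qed.

End FsetSums.

Section HasSum.
Variable R : realType.
Local Notation C := (cplx R).

Lemma has_sumP (I : choiceType) (u : I -> C) (l : C) :
  has_sum u l <-> forall e : R, 0 < e -> exists A : {fset I},
    forall B : {fset I}, (A `<=` B)%fset -> cnorm (\sum_(i <- B) u i - l) < e.
Proof.
split=> h e /h[A AP]; exists A => B AB; have := AP B AB;
  by rewrite cnormE of_real_lt.
Qed.

Definition abs_bounded (I : choiceType) (u : I -> C) (M : R) : Prop :=
  forall A : {fset I}, \sum_(i <- A) cnorm (u i) <= M.

Definition abs_summable (I : choiceType) (u : I -> C) : Prop :=
  exists M, abs_bounded u M.

Lemma abs_bounded_ge0 (I : choiceType) (u : I -> C) M :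
  abs_bounded u M -> 0 <= M.
Proof. by move=> /(_ fset0); rewrite big_seq_fset0. Qed.

Lemma abs_bounded_term (I : choiceType) (u : I -> C) M i :
  abs_bounded u M -> cnorm (u i) <= M.
Proof. by move=> /(_ [fset i]%fset); rewrite big_seq_fset1. Qed.

Lemma has_sum_unique (I : choiceType) (u : I -> C) (l l' : C) :
  has_sum u l -> has_sum u l' -> l = l'.
Proof.
move=> /has_sumP h /has_sumP h'; apply/eqP; rewrite -subr_eq0; apply/eqP.
apply: cnorm_lt_eps0 => e e0; have e20 : 0 < e / 2 by rewrite divr_gt0.
have [A /(_ (A `|` _)%fset)AP] := h _ e20.
have [B /(_ (_ `|` B)%fset)BP] := h' _ e20.
have := AP B (fsubsetUl _ _); have := BP A (fsubsetUr _ _).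
set S := \sum_(i <- _) _ => h1 h2.
have -> : l - l' = (S - l') - (S - l) by ring.
apply: le_lt_trans (cnormB _ _) _; lra.
Qed.

Lemma famsumE (I : choiceType) (u : I -> C) (l : C) :
  has_sum u l -> famsum u = l.
Proof.
by move=> ul; apply: (has_sum_unique _ ul); apply: (xgetPex 0 (ex_intro _ _ ul)).
Qed.

Lemma has_sum_ext (I : choiceType) (u v : I -> C) (l : C) :
  u =1 v -> has_sum u l -> has_sum v l.
Proof. by move=> /funext ->. Qed.

Lemma has_sum0 (I : choiceType) : has_sum (fun _ : I => 0 : C) 0.
Proof.
apply/has_sumP => e e0; exists fset0 => B _.
by rewrite big1// subrr cnorm0.
Qed.

Lemma has_sumD (I : choiceType) (u v : I -> C) (a b : C) :
  has_sum u a -> has_sum v b -> has_sum (fun i => u i + v i) (a + b).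
Proof.
move=> /has_sumP h /has_sumP h'; apply/has_sumP => e e0.
have e20 : 0 < e / 2 by rewrite divr_gt0.
have [A AP] := h _ e20; have [B BP] := h' _ e20.
exists (A `|` B)%fset => D; rewrite fsubUset => /andP[/AP h1 /BP h2].
rewrite big_split /=.
set x := \sum_(i <- _) u i in h1 *; set y := \sum_(i <- _) v i in h2 *.
have -> : x + y - (a + b) = (x - a) + (y - b) by ring.
apply: le_lt_trans (cnormD _ _) _; lra.
Qed.

Lemma has_sumZ (I : choiceType) (u : I -> C) (a c : C) :
  has_sum u a -> has_sum (fun i => c * u i) (c * a).
Proof.
move=> /has_sumP h; apply/has_sumP => e e0.
have e20 : 0 < e / (cnorm c + 1) by rewrite divr_gt0// ltr_wpDl ?cnorm_ge0.
have [A AP] := h _ e20; exists A => D /AP h1.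
rewrite -mulr_sumr -mulrBr cnormM.
apply: le_lt_trans (_ : (cnorm c + 1) * cnorm (\sum_(i <- D) u i - a) < _).
  by rewrite ler_wpM2r ?cnorm_ge0// lerDl.
by rewrite -ltr_pdivlMl ?ltr_wpDl ?cnorm_ge0// mulrC.
Qed.

Lemma has_sumN (I : choiceType) (u : I -> C) (a : C) :
  has_sum u a -> has_sum (fun i => - u i) (- a).
Proof.
move=> h; have := has_sumZ (-1) h; rewrite mulN1r.
by apply: has_sum_ext => i; rewrite mulN1r.
Qed.

Lemma has_sumB (I : choiceType) (u v : I -> C) (a b : C) :
  has_sum u a -> has_sum v b -> has_sum (fun i => u i - v i) (a - b).
Proof. by move=> h /has_sumN; exact: has_sumD. Qed.

Lemma has_sum_sum (I : choiceType) (T : Type) (r : seq T) (P : pred T)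
    (u : T -> I -> C) (a : T -> C) :
  (forall t, P t -> has_sum (u t) (a t)) ->
  has_sum (fun i => \sum_(t <- r | P t) u t i) (\sum_(t <- r | P t) a t).
Proof.
move=> h; elim: r => [|t r IH].
  by rewrite big_nil; apply: has_sum_ext (has_sum0 I) => i; rewrite big_nil.
rewrite big_cons; case: ifPn => Pt.
  by apply: has_sum_ext (has_sumD (h _ Pt) IH) => i; rewrite big_cons Pt.
by apply: has_sum_ext IH => i; rewrite big_cons (negbTE Pt).
Qed.

Lemma has_sum_finite (I : choiceType) (A : {fset I}) (u : I -> C) :
  (forall i, i \notin A -> u i = 0) -> has_sum u (\sum_(i <- A) u i).
Proof.
move=> u0; apply/has_sumP => e e0; exists A => B AB.
by rewrite -(@big_fset_incl _ _ _ _ A B) ?subrr ?cnorm0// => x _ /u0.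
Qed.

Lemma has_sum_single (I : choiceType) (i0 : I) (u : I -> C) :
  (forall i, i != i0 -> u i = 0) -> has_sum u (u i0).
Proof.
move=> u0; rewrite -(big_seq_fset1 +%R i0 u); apply: has_sum_finite => i.
by rewrite inE => /u0.
Qed.

Lemma has_sum_norm_le (I : choiceType) (u : I -> C) l M :
  has_sum u l -> abs_bounded u M -> cnorm l <= M.
Proof.
move=> /has_sumP h uM; apply/ler_addgt0Pl => e /h[A /(_ A (fsubset_refl _))].
move=> h1; have := cnormB (\sum_(i <- A) u i) (\sum_(i <- A) u i - l).
rewrite opprB addrC subrK => /le_trans; apply; rewrite addrC lerD ?(ltW h1)//.
by apply: le_trans (cnorm_sum _ _ _) (uM A).
Qed.

(** The limit is the supremum of the finite partial sums, which grow with the finite set. *)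
Lemma nneg_sum_cvg (I : choiceType) (u : I -> R) M :
  (forall i, 0 <= u i) -> (forall A : {fset I}, \sum_(i <- A) u i <= M) ->
  exists l : R, forall e, 0 < e -> exists A : {fset I},
    forall B : {fset I}, (A `<=` B)%fset -> `|\sum_(i <- B) u i - l| < e.
Proof.
move=> u0 uM; pose S := [set \sum_(i <- A) u i | A in [set: {fset I}]].
have hS : has_sup S.
  split; first by exists (\sum_(i <- fset0) u i), fset0.
  by exists M => _ [A _ <-].
exists (sup S) => e e0; have [_ [A _ <-] hA] := sup_adherent e0 hS.
exists A => B AB; have h1 := fset_sum_le u0 AB.
have h2 : \sum_(i <- B) u i <= sup S.
  by apply: ub_le_sup; [exact: hS.2|exists B].
rewrite ler0_norm; lra.
Qed.

(** [u] is the difference of the nonnegative families [u + |u|] and [|u|]. *)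
Lemma real_sum_cvg (I : choiceType) (u : I -> R) M :
  (forall A : {fset I}, \sum_(i <- A) `|u i| <= M) ->
  exists l : R, forall e, 0 < e -> exists A : {fset I},
    forall B : {fset I}, (A `<=` B)%fset -> `|\sum_(i <- B) u i - l| < e.
Proof.
move=> uM.
have [l1 h1] := nneg_sum_cvg (fun i => normr_ge0 (u i)) uM.
have [||l2 h2] := @nneg_sum_cvg _ (fun i => u i + `|u i|) (M + M).
- by move=> i; have := ler_norm (- u i); rewrite normrN; lra.
- move=> A; apply: le_trans (_ : \sum_(i <- A) (`|u i| + `|u i|) <= _).
    by apply: ler_sum => i _; rewrite lerD2r ler_norm.
  by rewrite big_split lerD.
exists (l2 - l1) => e e0; have e20 : 0 < e / 2 by rewrite divr_gt0.
have [A AP] := h1 _ e20; have [B BP] := h2 _ e20.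
exists (A `|` B)%fset => D; rewrite fsubUset => /andP[/AP k1 /BP].
rewrite big_split /=; set x := \sum_(i <- _) u i.
move: k1; set y := \sum_(i <- _) _ => k1 k2.
have -> : x - (l2 - l1) = (x + y - l2) - (y - l1) by ring.
apply: le_lt_trans (ler_normB _ _) _; lra.
Qed.

Let csum_ReIm (I : choiceType) (B : {fset I}) (u : I -> C) :
  \sum_(i <- B) u i = of_real (\sum_(i <- B) complex.Re (u i : R[i])) +
    of_real (\sum_(i <- B) complex.Im (u i : R[i])) * 'i%C.
Proof.
elim/big_rec3: _ => [|i x y z _ ->].
  by rewrite /of_real mul0r addr0.
rewrite !of_realD mulrDl addrACA; congr (_ + _).
case: (u i) => a b; rewrite /of_real; apply/eqP.
by rewrite eq_complex /=; rewrite !mulr0 !mul0r mulr1 subr0 !addr0 add0r !eqxx.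
Qed.

Let cnormi : cnorm ('i%C : C) = 1.
Proof. by rewrite /cnorm /= expr0n expr1n /= add0r sqrtr1. Qed.

Lemma abs_summable_has_sum (I : choiceType) (u : I -> C) :
  abs_summable u -> exists l, has_sum u l.
Proof.
move=> [M uM].
have [|l1 h1] := @real_sum_cvg _ (fun i => complex.Re (u i : R[i])) M.
  move=> A; apply: le_trans (uM A); apply: ler_sum => i _; exact: Re_le_cnorm.
have [|l2 h2] := @real_sum_cvg _ (fun i => complex.Im (u i : R[i])) M.
  move=> A; apply: le_trans (uM A); apply: ler_sum => i _; exact: Im_le_cnorm.
exists (of_real l1 + of_real l2 * 'i%C); apply/has_sumP => e e0.
have e20 : 0 < e / 2 by rewrite divr_gt0.
have [A AP] := h1 _ e20; have [B BP] := h2 _ e20.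
exists (A `|` B)%fset => D; rewrite fsubUset => /andP[/AP k1 /BP k2].
rewrite csum_ReIm; set x := \sum_(i <- _) _ in k1 *.
set y := \sum_(i <- _) _ in k2 *.
have -> : of_real x + of_real y * 'i%C - (of_real l1 + of_real l2 * 'i%C) =
  of_real (x - l1) + of_real (y - l2) * 'i%C :> C.
  by rewrite !of_realD /of_real !rmorphN /=; ring.
apply: le_lt_trans (cnormD _ _) _.
rewrite cnormM cnormi !cnorm_real; lra.
Qed.

(** Splitting [D] by the sign of [x] turns a bound on all signed partial sums into one on absolute
    sums, at the cost of a factor 2. *)
Let real_sum_bound (I : choiceType) (x : I -> R) (A : {fset I}) M :
  (forall D : {fset I}, [disjoint A & D]%fset -> `|\sum_(i <- D) x i| <= M) ->
  forall D : {fset I}, [disjoint A & D]%fset -> \sum_(i <- D) `|x i| <= M + M.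
Proof.
move=> h D AD; rewrite (big_fsetID _ (fun i => 0 <= x i))/=.
have sub (P : pred I) : [disjoint A & [fset i in D | P i]]%fset.
  apply: fdisjointWr AD; apply/fsubsetP => i; by rewrite !inE => /andP[].
apply: lerD.
  apply: le_trans (h _ (sub (fun i => 0 <= x i))).
  apply: le_trans (ler_norm _); rewrite le_eqVlt; apply/orP; left; apply/eqP.
  rewrite big_seq [RHS]big_seq; apply: eq_bigr => i.
  by rewrite !inE/= => /andP[_ /ger0_norm].
apply: le_trans (h _ (sub (fun i => ~~ (0 <= x i)))).
rewrite -normrN; apply: le_trans (ler_norm _); rewrite -sumrN.
rewrite le_eqVlt; apply/orP; left; apply/eqP.
rewrite big_seq [RHS]big_seq; apply: eq_bigr => i.
by rewrite !inE/= -ltNge => /andP[_ /ltr0_norm].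
Qed.

(** Partial sums over sets containing [A] are within 1 of [l], so every finite sum outside [A] has
    norm at most 2. As this holds for all finite subsets, the absolute sums are bounded too. *)
Lemma has_sum_abs_summable (I : choiceType) (u : I -> C) l :
  has_sum u l -> abs_summable u.
Proof.
move=> /has_sumP/(_ 1 ltr01)[A AP].
have h (D : {fset I}) : [disjoint A & D]%fset -> cnorm (\sum_(i <- D) u i) <= 2.
  move=> AD; have h1 := AP _ (fsubset_refl _).
  have h2 := AP _ (fsubsetUl A D).
  have E : \sum_(i <- (A `|` D)%fset) u i = \sum_(i <- A) u i + \sum_(i <- D) u i.
    rewrite (big_fsetID _ (mem A)) /=; congr (_ + _).
      apply: eq_fbigl => i; rewrite !inE/=.
      by case: (i \in A) => //=; rewrite andbF.
    apply: eq_fbigl => i; rewrite !inE/=.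
    have /fdisjointP/(_ i) := AD; case: (i \in A) => /=.
      by move=> /(_ isT)/negbTE->.
    by rewrite andbT.
  rewrite E in h2.
  set x := \sum_(i <- A) _ in h1 h2; set y := \sum_(i <- D) _ in h2 *.
  have -> : y = (x + y - l) - (x - l) by ring.
  apply: le_trans (cnormB _ _) _; lra.
have hRe : forall D : {fset I}, [disjoint A & D]%fset ->
   `|\sum_(i <- D) complex.Re (u i : R[i])| <= 2.
  move=> D /h; apply: le_trans; rewrite csum_ReIm.
  apply: le_trans (Re_le_cnorm _); rewrite /of_real /=.
  by rewrite !mulr0 mul0r subr0 addr0.
have hIm : forall D : {fset I}, [disjoint A & D]%fset ->
   `|\sum_(i <- D) complex.Im (u i : R[i])| <= 2.
  move=> D /h; apply: le_trans; rewrite csum_ReIm.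
  apply: le_trans (Im_le_cnorm _); rewrite /of_real /=.
  by rewrite mulr1 mul0r add0r addr0.
(* [8] is the bound 2, doubled by the sign splitting, once for the real and once for the imaginary
   part. *)
exists (\sum_(i <- A) cnorm (u i) + 8%:R) => B.
rewrite (big_fsetID _ (mem A)) /=; apply: lerD.
  apply: fset_sum_le => [i|]; first exact: cnorm_ge0.
  by apply/fsubsetP => i; rewrite !inE/= => /andP[].
set D := [fset x in B | x \notin A]%fset.
have AD : [disjoint A & D]%fset.
  by apply/fdisjointP => i iA; rewrite !inE/= iA andbF.
have := real_sum_bound hRe AD; have := real_sum_bound hIm AD.
have : \sum_(i <- D) cnorm (u i) <= \sum_(i <- D) `|complex.Re (u i : R[i])| +
  \sum_(i <- D) `|complex.Im (u i : R[i])|.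
  by rewrite -big_split; apply: ler_sum => i _; exact: cnorm_le_ReIm.
lra.
Qed.

End HasSum.

(** * Interchange of summations, reindexing and products of families *)

Section Fubini.
Variable R : realType.
Local Notation C := (cplx R).

Lemma abs_bounded_le (I : choiceType) (u v : I -> C) M :
  (forall i, cnorm (u i) <= cnorm (v i)) -> abs_bounded v M -> abs_bounded u M.
Proof. by move=> uv vM A; apply: le_trans (vM A); apply: ler_sum. Qed.

Lemma abs_summable_le (I : choiceType) (u v : I -> C) :
  (forall i, cnorm (u i) <= cnorm (v i)) -> abs_summable v -> abs_summable u.
Proof. by move=> uv [M vM]; exists M; exact: abs_bounded_le vM. Qed.

Lemma abs_boundedZ (I : choiceType) (u : I -> C) M c :
  abs_bounded u M -> abs_bounded (fun i => c * u i) (cnorm c * M).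
Proof.
move=> uM A; under eq_bigr do rewrite cnormM.
by rewrite -mulr_sumr ler_wpM2l ?cnorm_ge0.
Qed.

Lemma abs_summableZ (I : choiceType) (u : I -> C) c :
  abs_summable u -> abs_summable (fun i => c * u i).
Proof. by move=> [M]; exists (cnorm c * M); exact: abs_boundedZ. Qed.

Lemma abs_summable_has_famsum (I : choiceType) (u : I -> C) :
  abs_summable u -> has_sum u (famsum u).
Proof. by move=> /abs_summable_has_sum[l h]; rewrite (famsumE h). Qed.

Lemma abs_bounded_comp (I J : choiceType) (u : I -> C) (f : J -> I) M :
  injective f -> abs_bounded u M -> abs_bounded (u \o f) M.
Proof.
move=> fI uM A; have := uM (f @` A)%fset; rewrite big_imfset//=.
by move=> x y _ _ /fI.
Qed.

Lemma abs_summable_comp (I J : choiceType) (u : I -> C) (f : J -> I) :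
  injective f -> abs_summable u -> abs_summable (u \o f).
Proof. by move=> fI [M]; exists M; exact: abs_bounded_comp. Qed.

(* [f] and [g] need only be mutually inverse on the supports of [u] and [w]. *)
Section Transfer.
Variables (I J : choiceType) (u : I -> C) (w : J -> C).
Variables (f : I -> J) (g : J -> I).
Hypothesis gP : forall j, w j != 0 -> f (g j) = j /\ u (g j) = w j.

Lemma abs_bounded_transfer M : abs_bounded u M -> abs_bounded w M.
Proof.
move=> uM B.
rewrite (@fset_sum_transfer R I J (@cnorm R \o u) (@cnorm R \o w) f g) => [|j]; first exact: uM.
by rewrite /= cnorm_eq0 => /gP[-> ->].
Qed.

Lemma abs_summable_transfer : abs_summable u -> abs_summable w.
Proof. by move=> [M]; exists M; exact: abs_bounded_transfer. Qed.

Hypothesis fP : forall i, u i != 0 -> g (f i) = i /\ w (f i) = u i.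

Lemma has_sum_transfer l : has_sum u l -> has_sum w l.
Proof.
move=> /has_sumP ul; apply/has_sumP => e /ul[A AP].
exists (f @` A)%fset => B fAB.
rewrite (@fset_sum_transfer C I J u w f g)//.
set G := (g @` _)%fset; have := AP (A `|` G)%fset (fsubsetUl _ _).
rewrite -(@big_fset_incl _ _ _ _ G) ?fsubsetUr// => i.
rewrite inE => /orP[iA|->//] iG; apply/eqP/negP => /negP ui.
case/negP: iG; have [gf wf] := fP ui; rewrite -gf.
apply: in_imfset; rewrite !inE/= wf ui andbT.
by move/fsubsetP: fAB; apply; exact: in_imfset.
Qed.

End Transfer.

Lemma has_sum_bij (I J : choiceType) (u : I -> C) (f : J -> I) (g : I -> J) l :
  cancel f g -> cancel g f -> has_sum u l -> has_sum (u \o f) l.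
Proof.
move=> fg gf; apply: (@has_sum_transfer _ _ _ _ g f) => [j|i] _ /=.
  by rewrite fg.
by rewrite gf.
Qed.

Lemma abs_bounded_pair (I J : choiceType) (u : I * J -> C) (m : I -> R) M :
  (forall i, abs_bounded (fun j => u (i, j)) (m i)) ->
  (forall A : {fset I}, \sum_(i <- A) m i <= M) -> abs_bounded u M.
Proof.
move=> um mM A.
pose A1 := (fst @` A)%fset; pose A2 := (snd @` A)%fset.
apply: le_trans (_ : \sum_(i <- (A1 `*` A2)%fset) cnorm (u i) <= _).
  apply: fset_sum_le => [i|]; first exact: cnorm_ge0.
  apply/fsubsetP => -[x y] xyA; rewrite in_fsetM/=; apply/andP; split.
    by apply/imfsetP; exists (x, y).
  by apply/imfsetP; exists (x, y).
rewrite sum_fsetM; apply: le_trans (mM A1); apply: ler_sum => i _; exact: um.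
Qed.

Lemma abs_summable_slice (I J : choiceType) (u : I * J -> C) i :
  abs_summable u -> abs_summable (fun j => u (i, j)).
Proof. by apply: (@abs_summable_comp _ _ u (fun j => (i, j))) => x y []. Qed.

(** A finite set [B] of rows is completed by a finite set [D] of columns so large that each row of
    [B] is within [e / 2 / (#B + 1)] of its sum. The total over the product of [B] and [D] is then
    close to [l] and to the sum of the [v i]. *)
Lemma has_sum_fubini (I J : choiceType) (u : I * J -> C) (v : I -> C) l :
  has_sum u l -> (forall i, has_sum (fun j => u (i, j)) (v i)) -> has_sum v l.
Proof.
move=> /has_sumP ul uv; apply/has_sumP => e e0.
have e20 : 0 < e / 2 by rewrite divr_gt0.
have [A AP] := ul _ e20; pose A1 := (fst @` A)%fset.
exists A1 => B A1B.
have n0 : 0 < (#|` B|.+1%:R : R) by [].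
have ee0 : 0 < e / 2 / #|` B|.+1%:R by rewrite divr_gt0.
have /choice[D0 DP] : forall i, exists B' : {fset J}, forall D : {fset J},
    (B' `<=` D)%fset -> cnorm (\sum_(j <- D) u (i, j) - v i) < e / 2 / #|` B|.+1%:R.
  by move=> i; have /has_sumP/(_ _ ee0) := uv i.
pose D := ((\bigcup_(i <- B) D0 i) `|` snd @` A)%fset.
have AD : (A `<=` (B `*` D)%fset)%fset.
  apply/fsubsetP => -[x y] xyA; rewrite in_fsetM/=; apply/andP; split.
    by apply: (fsubsetP A1B); apply/imfsetP; exists (x, y).
  by rewrite inE; apply/orP; right; apply/imfsetP; exists (x, y).
have := AP _ AD; rewrite sum_fsetM => h.
have -> : \sum_(i <- B) v i - l = (\sum_(i <- B) \sum_(j <- D) u (i, j) - l) -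
  \sum_(i <- B) (\sum_(j <- D) u (i, j) - v i).
  by rewrite sumrB; ring.
apply: le_lt_trans (cnormB _ _) _.
rewrite [e]splitr; apply: ltr_leD => //.
apply: le_trans (cnorm_sum _ _ _) _.
apply: le_trans (_ : \sum_(i <- B) (e / 2 / #|` B|.+1%:R) <= _).
  rewrite big_seq [leRHS]big_seq; apply: ler_sum => i iB; apply/ltW/DP.
  apply: fsubset_trans (fsubsetUl _ _); exact: bigfcup_sup.
rewrite big_const_seq count_predT iter_addr_0 -[leLHS]mulr_natr mulrAC.
rewrite ler_pdivrMr// ler_wpM2l ?(ltW e20)// ler_nat.
exact: leqnSn.
Qed.

Lemma has_sum_swap (I J : choiceType) (u : I * J -> C) l :
  has_sum u l -> has_sum (fun x : J * I => u (x.2, x.1)) l.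
Proof.
by apply: (@has_sum_bij _ _ u (fun x : J * I => (x.2, x.1)) (fun x => (x.2, x.1))) => -[].
Qed.

Lemma has_sum_pairM (I J : choiceType) (u : I -> C) (v : J -> C) a b :
  has_sum u a -> has_sum v b -> has_sum (fun x : I * J => u x.1 * v x.2) (a * b).
Proof.
move=> ua vb.
have [Mu uM] := has_sum_abs_summable ua; have [Mv vM] := has_sum_abs_summable vb.
have [l hl] : exists l, has_sum (fun x : I * J => u x.1 * v x.2) l.
  apply: abs_summable_has_sum; exists (Mu * Mv).
  apply: (@abs_bounded_pair _ _ _ (fun i => cnorm (u i) * Mv)) => [i|A].
    exact: (abs_boundedZ (u i) vM).
  by rewrite -mulr_suml ler_wpM2r// (abs_bounded_ge0 vM).
have h i : has_sum (fun j => u i * v j) (u i * b) by exact: has_sumZ.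
have h1 := has_sum_fubini hl h.
have h2 : has_sum (fun i => u i * b) (a * b).
  by rewrite mulrC; apply: has_sum_ext (has_sumZ b ua) => i; rewrite mulrC.
by rewrite -(has_sum_unique h1 h2).
Qed.

Definition ffcons n (x : nat) (k : {ffun 'I_n -> nat}) : {ffun 'I_n.+1 -> nat} :=
  [ffun i => if unlift ord0 i is Some j then k j else x].

Definition ffhead n (k : {ffun 'I_n.+1 -> nat}) : nat := k ord0.

Definition fftail n (k : {ffun 'I_n.+1 -> nat}) : {ffun 'I_n -> nat} :=
  [ffun i => k (lift ord0 i)].

Lemma ffconsK n (k : {ffun 'I_n.+1 -> nat}) : ffcons (ffhead k) (fftail k) = k.
Proof.
by apply/ffunP => i; rewrite ffunE; case: unliftP => [j ->|->//]; rewrite ffunE.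
Qed.

Lemma ffcons_head n x (k : {ffun 'I_n -> nat}) : ffhead (ffcons x k) = x.
Proof. by rewrite /ffhead ffunE unlift_none. Qed.

Lemma ffcons_tail n x (k : {ffun 'I_n -> nat}) : fftail (ffcons x k) = k.
Proof. by apply/ffunP => i; rewrite !ffunE liftK. Qed.

Lemma has_sum_prod n (t : 'I_n -> nat -> C) (S : 'I_n -> C) :
  (forall v, has_sum (t v) (S v)) ->
  has_sum (fun k : {ffun 'I_n -> nat} => \prod_(v < n) t v (k v))
    (\prod_(v < n) S v).
Proof.
elim: n t S => [|n IH] t S tS.
  rewrite big_ord0; pose k0 : {ffun 'I_0 -> nat} := [ffun=> 0%N].
  apply: has_sum_ext (@has_sum_single _ _ k0 (fun=> 1) _) => [k|k].
    by rewrite big_ord0.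
  by case/eqP; apply/ffunP => -[].
have h := has_sum_pairM (tS ord0) (IH (fun v => t (lift ord0 v)) _ (fun v => tS (lift ord0 v))).
rewrite big_ord_recl.
apply: has_sum_ext (has_sum_bij (f := fun k => (ffhead k, fftail k))
  (g := fun x => ffcons x.1 x.2) _ _ h) => [k||[x k]]/=.
- by rewrite big_ord_recl; congr (_ * _); apply: eq_bigr => i _; rewrite ffunE.
- by move=> k; rewrite ffconsK.
- by rewrite ffcons_head ffcons_tail.
Qed.

End Fubini.

(** * The topology of [C^n] in terms of polydiscs *)

Section Topology.
Variable R : realType.
Local Notation C := (cplx R).

Lemma of_real_gt0 (r : R) : (0 < of_real r) = (0 < r).
Proof. exact: (of_real_lt 0 r). Qed.

Lemma gt0_of_real (e : C) : 0 < e -> exists2 r : R, 0 < r & e = of_real r.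
Proof.
move=> e0; exists (cnorm e); first by rewrite cnorm_gt0 gt_eqF.
by rewrite -cnormE gtr0_norm.
Qed.

Lemma nbhs_cplxP (c : C) (P : set C) :
  nbhs c P <-> exists2 r : R, 0 < r & forall z, cnorm (z - c) < r -> P z.
Proof.
split.
  move=> /nbhs_ballP[e /= /gt0_of_real[r r0 ->] h]; exists r => // z zc.
  by apply: h; rewrite -ball_normE /ball_ /= cnormE of_real_lt cnorm_distC.
move=> [r r0 h]; apply/nbhs_ballP; exists (of_real r) => /=.
  by rewrite of_real_gt0.
move=> z; rewrite -ball_normE /ball_ /= cnormE of_real_lt cnorm_distC.
exact: h.
Qed.

Definition polydisc n (w : 'rV[C]_n) (r : R) : set 'rV[C]_n :=
  [set z | forall j, cnorm (z 0 j - w 0 j) < r].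

Lemma nbhs_polydiscP n (w : 'rV[C]_n) (P : set 'rV[C]_n) :
  nbhs w P <-> exists2 r : R, 0 < r & polydisc w r `<=` P.
Proof.
split.
  move=> /nbhs_ballP[e /= /gt0_of_real[r r0 ->] h]; exists r => // z zw.
  apply: h; split=> [|i j]; first by rewrite of_real_gt0.
  rewrite ord1 -ball_normE /ball_ /= cnormE of_real_lt.
  by rewrite cnorm_distC.
move=> [r r0 h]; apply/nbhs_ballP; exists (of_real r) => /=.
  by rewrite of_real_gt0.
move=> z [_ zw]; apply: h => j; have := zw 0 j.
by rewrite -ball_normE /ball_ /= cnormE of_real_lt cnorm_distC.
Qed.

Lemma polydisc_center n (w : 'rV[C]_n) r : 0 < r -> polydisc w r w.
Proof. by move=> r0 j; rewrite subrr cnorm0. Qed.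

Lemma polydisc_le n (w : 'rV[C]_n) r s :
  r <= s -> polydisc w r `<=` polydisc w s.
Proof. by move=> rs z zw j; apply: lt_le_trans (zw j) rs. Qed.

Lemma polydisc_near n (w : 'rV[C]_n) r z :
  polydisc w r z -> exists2 r' : R, 0 < r' & polydisc z r' `<=` polydisc w r.
Proof.
(* For [n = 0] membership in the polydisc is vacuous and gives no information on the sign of [r], so
   this case is treated apart. *)
move=> zw; case: n => [|n] in w z zw *.
  by exists 1 => // u _ [].
pose m := \big[Num.max/0]_j cnorm (z 0 j - w 0 j).
have mr : m < r.
  have r0 : 0 < r by apply: le_lt_trans (zw ord0); exact: cnorm_ge0.
  by rewrite /m; elim/big_rec: _ => // j x _ xr; rewrite gt_max zw.
exists (r - m); first by rewrite subr_gt0.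
move=> u uz j; have h1 := uz j.
have h2 : cnorm (z 0 j - w 0 j) <= m by rewrite /m; exact: le_bigmax.
have -> : u 0 j - w 0 j = (u 0 j - z 0 j) + (z 0 j - w 0 j) by ring.
apply: le_lt_trans (cnormD _ _) _; lra.
Qed.

Lemma nbhs_polydisc n (w : 'rV[C]_n) r z : polydisc w r z ->
  nbhs z (polydisc w r).
Proof. by move=> /polydisc_near h; apply/nbhs_polydiscP. Qed.

Lemma cvg_cplxP (u : nat -> C) (l : C) : (u @ \oo --> l) <->
  forall e : R, 0 < e -> exists N0, forall N, (N0 <= N)%N -> cnorm (u N - l) < e.
Proof.
split.
  move=> /cvgrPdist_lt h e e0; have /h : 0 < (of_real e : C) by rewrite of_real_gt0.
  move=> [N0 _ N0P]; exists N0 => N /N0P /=.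
  by rewrite cnormE of_real_lt cnorm_distC.
move=> h; apply/cvgrPdist_lt => _ /gt0_of_real[r r0 ->].
have [N0 N0P] := h _ r0; exists N0 => // N /N0P /=.
by rewrite cnormE of_real_lt cnorm_distC.
Qed.

Lemma cvg_cplx_unique (u : nat -> C) (l l' : C) :
  u @ \oo --> l -> u @ \oo --> l' -> l = l'.
Proof. move=> h h'; exact: (cvg_unique _ h h'). Qed.

Lemma has_sum_cvg (u : nat -> C) l :
  has_sum u l -> (fun N => \sum_(i < N) u i) @ \oo --> l.
Proof.
move=> /has_sumP ul; apply/cvg_cplxP => e /ul[A AP].
exists (\max_(i <- A) i).+1 => N AN.
have -> : \sum_(i < N) u i = \sum_(i <- [fset i in iota 0 N]%fset) u i.
  rewrite -(big_mkord xpredT) /index_iota subn0; apply: perm_big.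
  apply: uniq_perm; rewrite ?iota_uniq ?fset_uniq// => i.
  by rewrite !inE.
apply: AP; apply/fsubsetP => i iA; rewrite !inE /= mem_iota /= add0n.
by apply: leq_ltn_trans AN; exact: leq_bigmax_seq.
Qed.

Lemma derive_cplxP n (f : 'rV[C]_n -> C) (y v : 'rV[C]_n) (l : C) :
  (forall e : R, 0 < e -> exists2 r : R, 0 < r & forall h : C,
    cnorm h < r -> cnorm (f (h *: v + y) - f y - h * l) <= e * cnorm h) ->
  derivable f y v /\ 'D_v f y = l.
Proof.
move=> H.
have hl : (fun h : C => h^-1 *: (f (h *: v + y) - f y)) @ 0^' --> l.
  apply/cvgrPdist_lt => _ /gt0_of_real[e e0 ->].
  have e20 : 0 < e / 2 by rewrite divr_gt0.
  have [r r0 hr] := H _ e20.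
  rewrite /dnbhs /within /=; apply/nbhs_cplxP; exists r => // h.
  rewrite subr0 => hlt h0; rewrite cnormE of_real_lt cnorm_distC.
  have nh : 0 < cnorm h by rewrite cnorm_gt0.
  have -> : (h^-1 *: (f (h *: v + y) - f y) - l : C) =
    h^-1 * (f (h *: v + y) - f y - h * l).
    by rewrite mulrBr mulKf.
  rewrite cnormM cnormV mulrC ltr_pdivrMr//.
  apply: le_lt_trans (hr _ hlt) _.
  by rewrite ltr_pM2r//; lra.
split; first by apply/cvg_ex; exists l.
exact: cvg_lim hl.
Qed.

End Topology.

(** * Power series in several variables *)

Section MultiIndex.
Variable n : nat.
Implicit Types m k : {ffun 'I_n -> nat}.

Definition mi0 : {ffun 'I_n -> nat} := [ffun=> 0%N].
Definition miU (j : 'I_n) : {ffun 'I_n -> nat} := [ffun i => (i == j : nat)].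
Definition miD m k : {ffun 'I_n -> nat} := [ffun i => (m i + k i)%N].
Definition miB m k : {ffun 'I_n -> nat} := [ffun i => (m i - k i)%N].

Lemma miDK m k : miB (miD m k) k = m.
Proof. by apply/ffunP => i; rewrite !ffunE addnK. Qed.

Lemma miBK m k : (forall i, k i <= m i)%N -> miD (miB m k) k = m.
Proof. by move=> h; apply/ffunP => i; rewrite !ffunE subnK. Qed.

Lemma miDC m k : miD m k = miD k m.
Proof. by apply/ffunP => i; rewrite !ffunE addnC. Qed.

Lemma mi_ind (P : {ffun 'I_n -> nat} -> Prop) :
  P mi0 -> (forall m j, P m -> P (miD m (miU j))) -> forall m, P m.
Proof.
move=> P0 PS m; have [s] := ubnP (\sum_i m i)%N; elim: s m => // s IH m sm.
have [/forallP m0|] := boolP [forall i, m i == 0%N].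
  by have -> : m = mi0 by apply/ffunP => i; rewrite ffunE; apply/eqP.
rewrite negb_forall => /existsP[j mj].
have mU : forall i, (miU j i <= m i)%N.
  by move=> i; rewrite ffunE; case: eqP => [->|//]; rewrite lt0n.
rewrite -(miBK mU); apply/PS/IH; rewrite -(miBK mU) in sm.
move: sm; rewrite ltnS; apply: leq_trans.
rewrite (bigD1 j)//= [X in (_ < X)%N](bigD1 j)//=.
rewrite -addSn; apply: leq_add; first by rewrite !ffunE eqxx addn1.
by apply: leq_sum => i _; rewrite [X in (_ <= X)%N]ffunE leq_addr.
Qed.

End MultiIndex.

Section Monomials.
Variables (R : realType) (n : nat).
Local Notation C := (cplx R).
Implicit Types m k : {ffun 'I_n -> nat}.

Definition vmon (K : pzRingType) (h : 'I_n -> K) m : K := \prod_(i < n) h i ^+ m i.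

Lemma vmon0 (K : pzRingType) (h : 'I_n -> K) : vmon h (mi0 n) = 1.
Proof. by rewrite /vmon big1// => i _; rewrite ffunE expr0. Qed.

Lemma vmonD (K : comPzRingType) (h : 'I_n -> K) m k :
  vmon h (miD m k) = vmon h m * vmon h k.
Proof. by rewrite /vmon -big_split; apply: eq_bigr => i _; rewrite ffunE exprD. Qed.

Lemma vmonU (K : comPzRingType) (h : 'I_n -> K) j : vmon h (miU j) = h j.
Proof.
rewrite /vmon (bigD1 j)//= big1 ?mulr1 ?ffunE ?eqxx ?expr1// => i ij.
by rewrite ffunE (negbTE ij) expr0.
Qed.

Lemma cnorm_vmon (h : 'I_n -> C) m : cnorm (vmon h m) = vmon (fun i => cnorm (h i)) m.
Proof. by rewrite /vmon cnorm_prod; apply: eq_bigr => i _; rewrite cnormX. Qed.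

Lemma vmon_ge0 (h : 'I_n -> R) m : (forall i, 0 <= h i) -> 0 <= vmon h m.
Proof. by move=> h0; apply: prodr_ge0 => i _; exact: exprn_ge0. Qed.

Lemma vmon_gt0 (h : 'I_n -> R) m : (forall i, 0 < h i) -> 0 < vmon h m.
Proof. by move=> h0; apply: prodr_gt0 => i _; exact: exprn_gt0. Qed.

Lemma vmon_le (g h : 'I_n -> R) m :
  (forall i, 0 <= g i <= h i) -> vmon g m <= vmon h m.
Proof.
move=> gh; apply: ler_prod => i _; have /andP[g0 gi] := gh i.
by rewrite exprn_ge0//= lerXn2r ?nnegrE// (le_trans g0).
Qed.

End Monomials.

Section NatSums.
Variable R : realType.
Local Notation C := (cplx R).

Lemma sum_fset_iota (V : nmodType) (u : nat -> V) N :
  \sum_(i <- [fset i in iota 0 N]%fset) u i = \sum_(i < N) u i.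
Proof.
rewrite -(big_mkord xpredT) /index_iota subn0; apply: perm_big.
by apply: uniq_perm; rewrite ?iota_uniq ?fset_uniq// => i; rewrite !inE.
Qed.

Lemma has_sum_nat_lt (u : nat -> C) N :
  (forall k, (N <= k)%N -> u k = 0) -> has_sum u (\sum_(k < N) u k).
Proof.
move=> u0; rewrite -(sum_fset_iota u); apply: has_sum_finite => i.
by rewrite !inE mem_iota /= add0n -leqNgt => /u0.
Qed.

Lemma abs_bounded_nat_lt (u : nat -> C) N :
  (forall k, (N <= k)%N -> u k = 0) -> abs_bounded u (\sum_(k < N) cnorm (u k)).
Proof.
move=> u0 A; rewrite -(sum_fset_iota (fun k => cnorm (u k))).
set B := [fset i in _]%fset.
rewrite (big_fsetID _ (mem B)) /= [X in _ + X]big1_fset ?addr0.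
  by apply: fset_sum_le => [i|]; [exact: cnorm_ge0|apply/fsubsetP => i; rewrite !inE/= => /andP[]].
move=> i; rewrite !inE mem_iota /= add0n -leqNgt => /andP[_ /u0 ->] _.
exact: cnorm0.
Qed.

Lemma abs_bounded_prod n (t : 'I_n -> nat -> C) (M : 'I_n -> R) :
  (forall v, abs_bounded (t v) (M v)) ->
  abs_bounded (fun k : {ffun 'I_n -> nat} => \prod_(v < n) t v (k v))
    (\prod_(v < n) M v).
Proof.
elim: n t M => [|n IH] t M tM.
  move=> A; rewrite big_ord0; under eq_bigr do rewrite big_ord0 cnorm1.
  rewrite big_const_seq count_predT iter_addr_0 -[leRHS]/(1%:R) ler_nat.
  have k0 (k : {ffun 'I_0 -> nat}) : k = [ffun=> 0%N] by apply/ffunP => -[].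
  rewrite -(cardfs1 ([ffun=> 0%N] : {ffun 'I_0 -> nat})).
  by apply: fsubset_leq_card; apply/fsubsetP => k _; rewrite inE; apply/eqP; exact: k0.
have h : abs_bounded (fun x : nat * {ffun 'I_n -> nat} =>
    t ord0 x.1 * \prod_(v < n) t (lift ord0 v) (x.2 v)) (\prod_v M v).
  apply: (@abs_bounded_pair _ _ _ _ (fun i => cnorm (t ord0 i) * \prod_v M (lift ord0 v))) => [i|A].
    exact: (abs_boundedZ (t ord0 i) (IH (fun v => t (lift ord0 v)) _ (fun v => tM (lift ord0 v)))).
  rewrite -mulr_suml big_ord_recl ler_wpM2r//; last exact: tM.
  by apply: prodr_ge0 => v _; exact: abs_bounded_ge0 (tM _).
apply: (@abs_bounded_transfer _ _ _ _ _ (fun x => ffcons x.1 x.2)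
  (fun k => (ffhead k, fftail k)) _ _ h) => k _.
rewrite ffconsK; split=> //=; rewrite big_ord_recl; congr (_ * _).
by apply: eq_bigr => i _; rewrite ffunE.
Qed.

End NatSums.

(** * Re-expansion of a power series at another point *)

Section Reexpansion.
Variables (R : realType) (n : nat).
Local Notation C := (cplx R).
Implicit Types m k : {ffun 'I_n -> nat}.

(** The coefficient of [h^k] in [(u + h)^m]; the binomials make it vanish unless [k <= m] in every
    coordinate. *)
Definition bincoef (u : 'I_n -> C) m k : C :=
  \prod_(i < n) ('C(m i, k i)%:R * u i ^+ (m i - k i)).

Let binT (u h : C) (m k : nat) : C := 'C(m, k)%:R * u ^+ (m - k) * h ^+ k.

Let binT0 (u h : C) (m k : nat) : (m.+1 <= k)%N -> binT u h m k = 0.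
Proof. by move=> mk; rewrite /binT bin_small// !mul0r. Qed.

Let binT_sum (u h : C) (m : nat) : has_sum (binT u h m) ((u + h) ^+ m).
Proof.
rewrite exprDn; have := has_sum_nat_lt (@binT0 u h m).
rewrite (_ : \sum_(k < _) _ = \sum_(i < m.+1) u ^+ (m - i) * h ^+ i *+ 'C(m, i))//.
by apply: eq_bigr => i _; rewrite /binT -mulrA mulr_natl.
Qed.

Let binT_bound (u h : C) (m : nat) : abs_bounded (binT u h m) ((cnorm u + cnorm h) ^+ m).
Proof.
rewrite exprDn; have := abs_bounded_nat_lt (@binT0 u h m).
rewrite (_ : \sum_(k < _) _ = \sum_(i < m.+1) cnorm u ^+ (m - i) * cnorm h ^+ i *+ 'C(m, i))//.
by apply: eq_bigr => i _; rewrite /binT !cnormM !cnormX cnorm_nat -mulrA mulr_natl.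
Qed.

Variables (c : {ffun 'I_n -> nat} -> C) (u : 'I_n -> C) (delta : R).
Hypothesis delta0 : 0 < delta.
Hypothesis csum : abs_summable
  (fun m => c m * vmon (fun i => of_real (cnorm (u i) + delta)) m).

Let W (h : 'I_n -> C) (x : {ffun 'I_n -> nat} * {ffun 'I_n -> nat}) : C :=
  c x.1 * \prod_(i < n) binT (u i) (h i) (x.1 i) (x.2 i).

Let WE h m k : W h (m, k) = vmon h k * (c m * bincoef u m k).
Proof.
rewrite /W mulrCA; congr (_ * _); rewrite /vmon /bincoef -big_split.
by apply: eq_bigr => i _; rewrite /binT /= mulrC.
Qed.

Let W_summable h : (forall i, cnorm (h i) <= delta) -> abs_summable (W h).
Proof.
move=> hd; have [M cM] := csum; exists M.
apply: (@abs_bounded_pair _ _ _ _ (fun m => cnorm (c m) * vmon (fun i => cnorm (u i) + delta) m)).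
  move=> m A; apply: le_trans
    (abs_boundedZ (c m) (abs_bounded_prod (fun v => binT_bound (u v) (h v) (m v))) A) _.
  rewrite ler_wpM2l ?cnorm_ge0//; apply: vmon_le => i.
  by rewrite addr_ge0 ?cnorm_ge0//= lerD2l.
move=> A; apply: le_trans (cM A); rewrite le_eqVlt; apply/orP; left; apply/eqP.
apply: eq_bigr => m _; rewrite cnormM cnorm_vmon; congr (_ * _).
apply: eq_bigr => i _; rewrite cnorm_real ger0_norm//.
by rewrite addr_ge0 ?cnorm_ge0// ltW.
Qed.

Definition recoef k : C := famsum (fun m => c m * bincoef u m k).

Lemma recoef_summable k : abs_summable (fun m => c m * bincoef u m k).
Proof.
(* An increment with nonzero coordinates: the column of index [k] of the double family is summable,
   and [h^k] can then be divided out. *)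
pose h (i : 'I_n) : C := of_real delta.
have hd i : cnorm (h i) <= delta by rewrite cnorm_real gtr0_norm.
have h1 : abs_summable (fun m => W h (m, k)).
  by apply: abs_summable_comp (W_summable hd) => x y [].
have h2 := abs_summableZ (vmon h k)^-1 h1.
apply: abs_summable_le h2 => m; rewrite WE mulKf//.
rewrite -cnorm_gt0 cnorm_vmon; apply: vmon_gt0 => i.
by rewrite cnorm_real gtr0_norm.
Qed.

Lemma recoef_has_sum k : has_sum (fun m => c m * bincoef u m k) (recoef k).
Proof. exact/abs_summable_has_famsum/recoef_summable. Qed.

(** The double family [c m * bincoef u m k * h^k] is absolutely summable, its row [m] being bounded
    by the term of index [m] in [csum]. Summing it by rows and by columns gives the two
    expansions. *)
Lemma reexpansion h S : (forall i, cnorm (h i) <= delta) ->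
  has_sum (fun m => c m * vmon (fun i => u i + h i) m) S ->
  has_sum (fun k => recoef k * vmon h k) S.
Proof.
move=> hd hS; have [S' WS] := abs_summable_has_sum (W_summable hd).
have inner m : has_sum (fun k => W h (m, k)) (c m * vmon (fun i => u i + h i) m).
  exact: (has_sumZ (c m) (has_sum_prod (fun v => binT_sum (u v) (h v) (m v)))).
rewrite (has_sum_unique hS (has_sum_fubini WS inner)).
apply: has_sum_fubini (has_sum_swap WS) _ => k /=; rewrite mulrC.
apply: has_sum_ext (has_sumZ (vmon h k) (recoef_has_sum k)) => m.
by rewrite WE.
Qed.

End Reexpansion.

Section PowerSeries.
Variables (R : realType) (n : nat).
Local Notation C := (cplx R).
Implicit Types (m k : {ffun 'I_n -> nat}) (w z : 'rV[C]_n) (f g : 'rV[C]_n -> C).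
Implicit Types (c : {ffun 'I_n -> nat} -> C).

Definition pseries c w f (r : R) : Prop := forall z, polydisc w r z ->
  has_sum (fun m => c m * vmon (fun i => z 0 i - w 0 i) m) (f z).

Lemma analytic_atP f w :
  analytic_at f w <-> exists c, exists2 r, 0 < r & pseries c w f r.
Proof.
split=> [[c /nbhs_polydiscP[r r0 h]]|[c [r r0 h]]]; exists c.
  by exists r.
by apply/nbhs_polydiscP; exists r.
Qed.

Lemma pseries_le c w f r s : s <= r -> pseries c w f r -> pseries c w f s.
Proof. by move=> sr h z zw; apply: h; apply: polydisc_le zw. Qed.

Lemma pseries_summable c w f r (t : 'I_n -> R) : pseries c w f r ->
  (forall i, 0 <= t i < r) ->
  abs_summable (fun m => c m * vmon (fun i => of_real (t i)) m).
Proof.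
move=> h tr; pose z : 'rV[C]_n := \row_i (w 0 i + of_real (t i)).
have zi i : z 0 i - w 0 i = of_real (t i) by rewrite mxE addrAC subrr add0r.
have zw : polydisc w r z.
  by move=> i; rewrite zi cnorm_real; have /andP[/ger0_norm-> ] := tr i.
have := has_sum_abs_summable (h z zw).
by under eq_fun do under [X in vmon X _]eq_fun do rewrite zi.
Qed.

Lemma pseries_reexpand c w f r z : pseries c w f r -> polydisc w r z ->
  exists c', exists2 d, 0 < d & pseries c' z f d /\
    forall k, has_sum (fun m => c m * bincoef (fun i => z 0 i - w 0 i) m k) (c' k).
Proof.
move=> h zw; have [d d0 zdw] := polydisc_near zw.
pose u i := z 0 i - w 0 i.
have csum : abs_summable (fun m => c m * vmon (fun i => of_real (cnorm (u i) + d / 2)) m).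
  apply: (pseries_summable h) => i; rewrite addr_ge0 ?cnorm_ge0//=; last by rewrite divr_ge0// ltW.
  (* [z'] is [z] pushed outwards by [d / 2] along each [u j]; since it stays in the polydisc of
     radius [r], one gets [|u i| + d / 2 < r]. *)
  pose z' : 'rV[C]_n := \row_j (z 0 j + (if u j == 0 then of_real (d / 2)
     else u j / of_real (cnorm (u j)) * of_real (d / 2))).
  have z'z : polydisc z d z'.
    move=> j; rewrite mxE addrAC subrr add0r; case: eqP => [_|/eqP uj].
      by rewrite cnorm_real gtr0_norm; lra.
    rewrite !cnormM cnormV !cnorm_real [ `|cnorm _|]ger0_norm ?cnorm_ge0//.
    by rewrite divff ?cnorm_eq0// mul1r gtr0_norm; lra.
  have := zdw _ z'z i; rewrite mxE; case: eqP => [uj|/eqP uj].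
    by rewrite addrAC -/(u i) uj add0r cnorm0 add0r cnorm_real gtr0_norm; lra.
  rewrite addrAC -/(u i).
  have -> : u i + u i / of_real (cnorm (u i)) * of_real (d / 2) =
    u i / of_real (cnorm (u i)) * of_real (cnorm (u i) + d / 2).
    by rewrite of_realD mulrDr divfK// -cnormE normr_eq0.
  rewrite !cnormM cnormV !cnorm_real [ `|cnorm _|]ger0_norm ?cnorm_ge0//.
  by rewrite divff ?cnorm_eq0// mul1r ger0_norm// addr_ge0 ?cnorm_ge0//; lra.
have d20 : 0 < d / 2 by rewrite divr_gt0.
exists (recoef c u), (d / 2) => //; split; last first.
  by move=> k; exact: recoef_has_sum d20 csum k.
move=> y yz; have yw : polydisc w r y by apply: zdw; apply: polydisc_le yz; lra.
apply: (reexpansion d20 csum) => [i|]; first exact/ltW/yz.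
apply: has_sum_ext (h y yw) => m; congr (_ * _); apply: eq_bigr => i _.
by congr (_ ^+ _); rewrite /u; ring.
Qed.

Lemma pseries_center c w f r : 0 < r -> pseries c w f r -> f w = c (mi0 n).
Proof.
move=> r0 h; have := h w (polydisc_center w r0).
move=> /has_sum_unique; apply.
have := @has_sum_single R _ (mi0 n) (fun m => c m * vmon (fun i => w 0 i - w 0 i) m).
rewrite vmon0 mulr1; apply=> m m0.
have [i mi] : exists i, m i != 0%N.
  apply/existsP; rewrite -negb_forall; apply: contra m0 => /forallP m0.
  by apply/eqP/ffunP => i; rewrite ffunE; apply/eqP.
by rewrite /vmon (bigD1 i)//= subrr expr0n (negbTE mi) mul0r mulr0.
Qed.

(** Once the constant and linear terms are removed, the monomials that survive on the line in
    direction [j] have degree at least 2, so each is at most [(|x| / rho)^2] times its absolute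
    value at radius [rho]. *)
Lemma pseries_diff_center c w f r j : 0 < r -> pseries c w f r ->
  forall e : R, 0 < e -> exists2 s : R, 0 < s & forall x : C, cnorm x < s ->
    cnorm (f (x *: delta_mx 0 j + w) - f w - x * c (miU j)) <= e * cnorm x.
Proof.
move=> r0 h e e0.
pose rho := r / 2; have rho0 : 0 < rho by rewrite divr_gt0.
have [M cM] : abs_summable (fun m => c m * vmon (fun _ : 'I_n => of_real rho) m).
  by apply: (pseries_summable h) => i; rewrite /rho; lra.
have M0 := abs_bounded_ge0 cM.
pose B := M / rho ^+ 2.
have B0 : 0 <= B by rewrite divr_ge0// exprn_ge0// ltW.
exists (Num.min rho (e / (B + 1))) => [|x].
  by rewrite lt_min rho0 divr_gt0//; lra.
rewrite lt_min => /andP[xr xe].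
pose v (i : 'I_n) : C := if i == j then x else 0.
have vE i : (x *: delta_mx 0 j + w) 0 i - w 0 i = v i.
  by rewrite !mxE eqxx /= /v; case: eqP => _; rewrite ?mulr1 ?mulr0; ring.
have zw : polydisc w r (x *: delta_mx 0 j + w).
  by move=> i; rewrite vE /v; case: eqP => _; rewrite ?cnorm0// (lt_trans xr)// /rho; lra.
have h1 := h _ zw; rewrite (pseries_center r0 h).
(* The constant and the linear term are written as families with a single nonzero entry, so that
   they can be subtracted from the series term by term. *)
have h2 := @has_sum_single R _ (mi0 n) (fun m => if m == mi0 n then c (mi0 n) else 0) (fun i =>
  @ifN_eq _ _ _ _ _ _).
have h3 := @has_sum_single R _ (miU j) (fun m => if m == miU j then x * c (miU j) else 0)
  (fun i => @ifN_eq _ _ _ _ _ _).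
rewrite !eqxx in h2 h3.
have h4 := has_sumB (has_sumB h1 h2) h3.
apply: le_trans (_ : cnorm x ^+ 2 * B <= _).
  apply: has_sum_norm_le h4 _ => A; rewrite /B mulrA mulrAC.
  apply: le_trans (_ : \sum_(m <- A) cnorm x ^+ 2 / rho ^+ 2 * cnorm
    (c m * vmon (fun _ : 'I_n => of_real rho) m) <= _); last first.
    by rewrite -mulr_sumr ler_wpM2l// divr_ge0// exprn_ge0 ?cnorm_ge0// ltW.
  apply: ler_sum => m _.
  have rhs0 : 0 <= cnorm x ^+ 2 / rho ^+ 2 * cnorm (c m * vmon (fun _ : 'I_n => of_real rho) m).
    by rewrite mulr_ge0 ?cnorm_ge0// divr_ge0// exprn_ge0 ?cnorm_ge0// ltW.
  have -> : vmon (fun i => (x *: delta_mx 0 j + w) 0 i - w 0 i) m = vmon v m.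
    by congr vmon; apply/funext.
  have [Em|m0] := eqVneq m (mi0 n).
    rewrite Em in rhs0 *; apply: le_trans rhs0.
    rewrite vmon0 mulr1 subrr sub0r.
    have /negbTE-> : mi0 n != miU j.
      by apply/eqP => /ffunP/(_ j); rewrite !ffunE eqxx.
    by rewrite oppr0 cnorm0.
  have [Em|mj] := eqVneq m (miU j).
    rewrite Em in rhs0 *; apply: le_trans rhs0.
    by rewrite vmonU /v eqxx subr0 mulrC subrr cnorm0.
  rewrite !subr0.
  have [/existsP[i /andP[ij mi]]|] := boolP [exists i, (i != j) && (m i != 0%N)].
    apply: le_trans rhs0; rewrite [vmon v m](_ : _ = 0) ?mulr0 ?cnorm0//.
    by rewrite /vmon (bigD1 i)//= /v (negbTE ij) expr0n (negbTE mi) mul0r.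
  rewrite negb_exists => /forallP mi.
  have mE i : i != j -> m i = 0%N.
    by move=> ij; have := mi i; rewrite ij /= negbK => /eqP.
  have mj2 : (2 <= m j)%N.
    move: mj m0; case E : (m j) => [|[|//]] mj m0.
      case/eqP: m0; apply/ffunP => i; rewrite ffunE.
      by have [->//|/mE] := eqVneq i j.
    case/eqP: mj; apply/ffunP => i; rewrite ffunE.
    by have [->//|/mE] := eqVneq i j.
  have vmE (K : comPzRingType) (a : 'I_n -> K) : vmon a m = a j ^+ m j.
    rewrite /vmon (bigD1 j)//= big1 ?mulr1// => i /mE ->; exact: expr0.
  rewrite !cnormM !cnorm_vmon !vmE /v eqxx cnorm_real gtr0_norm// mulrCA ler_wpM2l ?cnorm_ge0//.
  have -> : cnorm x ^+ 2 / rho ^+ 2 * rho ^+ m j = cnorm x ^+ 2 * rho ^+ (m j - 2).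
    rewrite -{1}(subnK mj2) exprD [rho ^+ _ * _]mulrC mulrA divfK//.
    by rewrite expf_neq0// gt_eqF.
  have -> : cnorm x ^+ m j = cnorm x ^+ 2 * cnorm x ^+ (m j - 2).
    by rewrite -exprD subnKC.
  by rewrite ler_wpM2l ?exprn_ge0 ?cnorm_ge0// lerXn2r ?nnegrE ?cnorm_ge0// ltW.
rewrite expr2 -mulrA mulrC ler_wpM2r ?cnorm_ge0//.
have : cnorm x * (B + 1) <= e by rewrite -ler_pdivlMr ?ltW//; lra.
have := cnorm_ge0 x; nra.
Qed.

Lemma pseries_derive_center c w f r j : 0 < r -> pseries c w f r ->
  derivable f w (delta_mx 0 j) /\ 'D_(delta_mx 0 j) f w = c (miU j).
Proof. by move=> r0 h; apply: derive_cplxP; exact: pseries_diff_center r0 h. Qed.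

Definition dcoef j c m : C := (m j).+1%:R * c (miD m (miU j)).

(** Termwise differentiation is read off the re-expansion: the derivative at [z] is the coefficient
    of index [miU j] of the series re-expanded at [z], and the sum defining that coefficient is the
    differentiated series. *)
Lemma pseries_derive c w f r j : 0 < r -> pseries c w f r ->
  pseries (dcoef j c) w ('D_(delta_mx 0 j) f) r.
Proof.
move=> r0 h z zw; have [c' [d d0 [h' c'E]]] := pseries_reexpand h zw.
rewrite (pseries_derive_center j d0 h').2.
have E m : c (miD m (miU j)) * bincoef (fun i => z 0 i - w 0 i) (miD m (miU j)) (miU j) =
    dcoef j c m * vmon (fun i => z 0 i - w 0 i) m.
  rewrite /dcoef /bincoef (bigD1 j)//= !ffunE eqxx addn1 bin1 subSS subn0.
  rewrite [RHS]mulrAC [RHS]mulrC -!mulrA; congr (_ * (_ * _)).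
  rewrite /vmon [in RHS](bigD1 j)//=; congr (_ * _).
  by apply: eq_bigr => i ij; rewrite !ffunE (negbTE ij) addn0 subn0 bin0 mul1r.
apply: (has_sum_transfer (f := fun m => miB m (miU j)) (g := fun m => miD m (miU j)) _ _
  (c'E (miU j))).
  by move=> m _; rewrite miDK E.
move=> m u0; rewrite -E miBK// => i; rewrite ffunE; case: eqP => // ->.
rewrite lt0n; apply: contra u0 => mj.
by rewrite /bincoef (bigD1 j)//= ffunE eqxx bin_small ?mul0r ?mulr0//= (eqP mj).
Qed.

Lemma pseries_diff c w f r j z : pseries c w f r -> polydisc w r z ->
  forall e : R, 0 < e -> exists2 s : R, 0 < s & forall x : C, cnorm x < s ->
    cnorm (f (x *: delta_mx 0 j + z) - f z - x * 'D_(delta_mx 0 j) f z) <= e * cnorm x.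
Proof.
move=> h zw; have [c' [d d0 [h' _]]] := pseries_reexpand h zw.
by rewrite (pseries_derive_center j d0 h').2; exact: pseries_diff_center d0 h'.
Qed.

(** Up to a nonzero integer, the coefficient of index [m + e_j] is the one of index [m] of the
    derivative; this allows an induction on [m] for all functions at once. *)
Lemma pseries_unique c c' w f r : 0 < r ->
  pseries c w f r -> pseries c' w f r -> c =1 c'.
Proof.
move=> r0 h h' m; elim/mi_ind: m c c' f h h' => [|m j IH] c c' f h h'.
  by rewrite -(pseries_center r0 h) (pseries_center r0 h').
have := IH _ _ _ (pseries_derive j r0 h) (pseries_derive j r0 h').
by rewrite /dcoef => /mulfI; apply; rewrite pnatr_eq0.
Qed.

Lemma pseriesD c c' w f g r : pseries c w f r -> pseries c' w g r ->
  pseries (fun m => c m + c' m) w (fun z => f z + g z) r.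
Proof.
move=> h h' z zw; apply: has_sum_ext (has_sumD (h z zw) (h' z zw)) => m.
by rewrite mulrDl.
Qed.

Lemma pseriesZ (x : C) c w f r : pseries c w f r ->
  pseries (fun m => x * c m) w (fun z => x * f z) r.
Proof.
by move=> h z zw; apply: has_sum_ext (has_sumZ x (h z zw)) => m; rewrite mulrA.
Qed.

Lemma pseriesX c w f r j : pseries c w f r ->
  pseries (fun m => w 0 j * c m + (if m j is 0%N then 0 else c (miB m (miU j))))
    w (fun z => z 0 j * f z) r.
Proof.
move=> h z zw.
have -> : z 0 j * f z = w 0 j * f z + (z 0 j - w 0 j) * f z by ring.
apply: (@has_sum_ext _ _ (fun m => w 0 j * (c m * vmon (fun i => z 0 i - w 0 i) m) +
  (if m j is 0%N then 0 else c (miB m (miU j))) * vmon (fun i => z 0 i - w 0 i) m)).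
  by move=> m; rewrite mulrDl mulrA.
apply: has_sumD; first exact/has_sumZ/h.
have E m : (z 0 j - w 0 j) * (c m * vmon (fun i => z 0 i - w 0 i) m) =
  c m * vmon (fun i => z 0 i - w 0 i) (miD m (miU j)).
  by rewrite vmonD vmonU; ring.
apply: (has_sum_transfer (f := fun m => miD m (miU j)) (g := fun m => miB m (miU j)) _ _
  (has_sumZ _ (h z zw))).
  move=> m; case mj : (m j) => [|p]; first by rewrite mul0r eqxx.
  move=> _; rewrite E miBK// => i; rewrite ffunE; case: eqP => [-> | //].
  by rewrite mj.
by move=> m _; rewrite miDK E ffunE !ffunE eqxx addn1.
Qed.

End PowerSeries.

(** * Germs of analytic functions and their derivatives *)

Section Analytic.
Variables (R : realType) (n : nat).
Local Notation C := (cplx R).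
Implicit Types (w z : 'rV[C]_n) (f g : 'rV[C]_n -> C).
Local Notation pd j f := ('D_(delta_mx 0 j) f).

Lemma analytic_near f w : analytic_at f w -> \forall z \near w, analytic_at f z.
Proof.
move=> /analytic_atP[c [r r0 h]]; apply/nbhs_polydiscP; exists r => // z zw.
have [c' [d d0 [h' _]]] := pseries_reexpand h zw.
by apply/analytic_atP; exists c', d.
Qed.

Lemma analytic_common f g w : analytic_at f w -> analytic_at g w ->
  exists c c', exists2 r, 0 < r & pseries c w f r /\ pseries c' w g r.
Proof.
move=> /analytic_atP[c [r r0 h]] /analytic_atP[c' [s s0 h']].
exists c, c', (Num.min r s); first by rewrite lt_min r0.
by split; [apply: pseries_le h|apply: pseries_le h']; rewrite ge_min lexx ?orbT.
Qed.

Lemma pseries_congr c w f g r : pseries c w f r -> (\forall z \near w, f z = g z) ->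
  0 < r -> exists2 s, 0 < s <= r & pseries c w g s.
Proof.
move=> h /nbhs_polydiscP[s s0 fg] r0.
exists (Num.min r s); first by rewrite lt_min r0 s0 ge_min lexx.
move=> z zw; rewrite -fg; last by apply: polydisc_le zw; rewrite ge_min lexx orbT.
by apply: h; apply: polydisc_le zw; rewrite ge_min lexx.
Qed.

Lemma analytic_congr f g w : analytic_at f w -> (\forall z \near w, f z = g z) ->
  analytic_at g w.
Proof.
move=> /analytic_atP[c [r r0 h]] /(pseries_congr h)/(_ r0)[s /andP[s0 _] h'].
by apply/analytic_atP; exists c, s.
Qed.

Lemma analyticD f g w : analytic_at f w -> analytic_at g w ->
  analytic_at (fun z => f z + g z) w.
Proof.
move=> hf hg; have [c [c' [r r0 [h h']]]] := analytic_common hf hg.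
by apply/analytic_atP; exists (fun m => c m + c' m), r => //; exact: (pseriesD h h').
Qed.

Lemma analyticZ (x : C) f w : analytic_at f w -> analytic_at (fun z => x * f z) w.
Proof.
move=> /analytic_atP[c [r r0 h]]; apply/analytic_atP.
by have := pseriesZ x h; set c' := (X in pseries X); exists c', r.
Qed.

Lemma analyticX f w j : analytic_at f w -> analytic_at (fun z => z 0 j * f z) w.
Proof.
move=> /analytic_atP[c [r r0 h]]; apply/analytic_atP.
by have := pseriesX j h; set c' := (X in pseries X); exists c', r.
Qed.

Lemma analytic0 w : analytic_at (fun=> 0) w.
Proof.
apply/analytic_atP; exists (fun=> 0), 1 => // z _ /=.
by apply: (@has_sum_ext R _ (fun=> 0)) => [m|]; [rewrite mul0r|exact: has_sum0].
Qed.

Lemma analytic_deriv f w j : analytic_at f w -> analytic_at (pd j f) w.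
Proof.
move=> /analytic_atP[c [r r0 h]]; apply/analytic_atP.
by exists (dcoef j c), r => //; exact: pseries_derive.
Qed.

Lemma derivC f w i j : analytic_at f w -> pd i (pd j f) w = pd j (pd i f) w.
Proof.
move=> /analytic_atP[c [r r0 h]].
have E1 := (pseries_derive_center i r0 (pseries_derive j r0 h)).2.
have E2 := (pseries_derive_center j r0 (pseries_derive i r0 h)).2.
apply: (etrans E1); apply: (etrans _ (esym E2)).
by rewrite /dcoef miDC !ffunE eq_sym.
Qed.

Lemma derivD f g w j : analytic_at f w -> analytic_at g w ->
  pd j (fun z => f z + g z) w = pd j f w + pd j g w.
Proof.
move=> hf hg; have [c [c' [r r0 [h h']]]] := analytic_common hf hg.
rewrite (pseries_derive_center j r0 (pseriesD h h')).2.
by rewrite (pseries_derive_center j r0 h).2 (pseries_derive_center j r0 h').2.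
Qed.

Lemma derivZ (x : C) f w j : analytic_at f w ->
  pd j (fun z => x * f z) w = x * pd j f w.
Proof.
move=> /analytic_atP[c [r r0 h]]; rewrite (pseries_derive_center j r0 (pseriesZ x h)).2.
by rewrite (pseries_derive_center j r0 h).2.
Qed.

Lemma derivX f w i j : analytic_at f w ->
  pd i (fun z => z 0 j * f z) w = w 0 j * pd i f w + (i == j)%:R * f w.
Proof.
move=> /analytic_atP[c [r r0 h]]; rewrite (pseries_derive_center i r0 (pseriesX j h)).2.
rewrite (pseries_derive_center i r0 h).2 (pseries_center r0 h) !ffunE eq_sym.
case: eqP => [->|_]; rewrite ?mul0r// mul1r; congr (_ + c _).
by apply/ffunP => l; rewrite !ffunE subnn.
Qed.

Lemma deriv_congr f g w j : analytic_at f w -> (\forall z \near w, f z = g z) ->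
  pd j g w = pd j f w.
Proof.
move=> /analytic_atP[c [r r0 h]] fg; have [s /andP[s0 _] h'] := pseries_congr h fg r0.
by rewrite (pseries_derive_center j s0 h').2 (pseries_derive_center j r0 h).2.
Qed.

End Analytic.

(** * The action of the Weyl algebra *)

Section WeylAction.
Variables (R : realType) (n : nat) (U : set 'rV[cplx R]_n).
Local Notation C := (cplx R).
Local Notation fseries := (fseries R n).
Implicit Types (f g : fseries) (P Q S : weyl R n).
Hypothesis U_nbhs : forall y, U y -> nbhs y U.

Definition analytic_on f := forall y, U y -> forall i, analytic_at (f i) y.
Definition eq_on f g := forall y, U y -> forall i, f i y = g i y.

Lemma eq_on_sym f g : eq_on f g -> eq_on g f.
Proof. by move=> h y Uy i; rewrite h. Qed.

Lemma eq_on_trans f g h : eq_on f g -> eq_on g h -> eq_on f h.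
Proof. by move=> fg gh y Uy i; rewrite fg// gh. Qed.

Lemma eq_on_near f g y i : eq_on f g -> U y -> \forall z \near y, f i z = g i z.
Proof. by move=> fg /U_nbhs; apply: filterS => z /fg. Qed.

Lemma analytic_on_eq f g : analytic_on f -> eq_on f g -> analytic_on g.
Proof.
by move=> fA fg y Uy i; apply: analytic_congr (fA _ Uy i) (eq_on_near i fg Uy).
Qed.

Lemma analytic_onD f g : analytic_on f -> analytic_on g ->
  analytic_on (fun i y => f i y + g i y).
Proof. by move=> fA gA y Uy i; apply: analyticD; [exact: fA|exact: gA]. Qed.

Lemma analytic_onZ (c : C) f : analytic_on f -> analytic_on (fun i y => c * f i y).
Proof. by move=> fA y Uy i; apply: analyticZ; exact: fA. Qed.

Lemma analytic_on_mulX j f : analytic_on f -> analytic_on (fmulX j f).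
Proof.
move=> fA y Uy i; rewrite /fmulX; case: (unlift ord_max j) => [j'|].
  exact: analyticX (fA _ Uy i).
by case: i => [|i]; [exact: analytic0|exact: fA].
Qed.

Lemma analytic_on_deriv j f : analytic_on f -> analytic_on (fderiv j f).
Proof.
move=> fA y Uy i; rewrite /fderiv; case: (unlift ord_max j) => [j'|].
  exact: analytic_deriv (fA _ Uy i).
exact: analyticZ (fA _ Uy i.+1).
Qed.

Lemma analytic_on_act P f : analytic_on f -> analytic_on (weyl_act P f).
Proof.
elim: P f => [c|j|j|P IHP Q IHQ|P IHP Q IHQ] f fA /=.
- exact: analytic_onZ.
- exact: analytic_on_mulX.
- exact: analytic_on_deriv.
- by apply: analytic_onD; [exact: IHP|exact: IHQ].
- exact/IHP/IHQ.
Qed.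

Lemma eq_on_mulX j f g : eq_on f g -> eq_on (fmulX j f) (fmulX j g).
Proof.
move=> fg y Uy i; rewrite /fmulX; case: (unlift ord_max j) => [j'|].
  by rewrite fg.
by case: i => // i; rewrite fg.
Qed.

Lemma eq_on_deriv j f g : analytic_on f -> eq_on f g ->
  eq_on (fderiv j f) (fderiv j g).
Proof.
move=> fA fg y Uy i; rewrite /fderiv; case: (unlift ord_max j) => [j'|].
  by apply/esym/deriv_congr; [exact: fA|exact: eq_on_near].
by rewrite fg.
Qed.

Lemma eq_on_act P f g : analytic_on f -> eq_on f g ->
  eq_on (weyl_act P f) (weyl_act P g).
Proof.
elim: P f g => [c|j|j|P IHP Q IHQ|P IHP Q IHQ] f g fA fg /=.
- by move=> y Uy i; rewrite fg.
- exact: eq_on_mulX.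
- exact: eq_on_deriv.
- by move=> y Uy i; rewrite (IHP f g) ?(IHQ f g).
- by apply: IHP; [exact: analytic_on_act|exact: IHQ].
Qed.

Lemma fderivD j f g : analytic_on f -> analytic_on g ->
  eq_on (fderiv j (fun i y => f i y + g i y)) (fun i y => fderiv j f i y + fderiv j g i y).
Proof.
move=> fA gA y Uy i; rewrite /fderiv; case: (unlift ord_max j) => [j'|].
  by apply: derivD; [exact: fA|exact: gA].
by rewrite mulrDr.
Qed.

Lemma fderivZ j (c : C) f : analytic_on f ->
  eq_on (fderiv j (fun i y => c * f i y)) (fun i y => c * fderiv j f i y).
Proof.
move=> fA y Uy i; rewrite /fderiv; case: (unlift ord_max j) => [j'|].
  by apply: derivZ; exact: fA.
by rewrite mulrCA.
Qed.

Lemma act_additive P f g : analytic_on f -> analytic_on g ->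
  eq_on (weyl_act P (fun i y => f i y + g i y))
        (fun i y => weyl_act P f i y + weyl_act P g i y).
Proof.
elim: P f g => [c|j|j|P IHP Q IHQ|P IHP Q IHQ] f g fA gA /=.
- by move=> y Uy i; rewrite mulrDr.
- move=> y Uy i; rewrite /fmulX; case: (unlift ord_max j) => [j'|].
    by rewrite mulrDr.
  by case: i => //; rewrite addr0.
- exact: fderivD.
- by move=> y Uy i; rewrite (IHP f g)// (IHQ f g)// addrACA.
- apply: eq_on_trans (IHP _ _ _ _); try exact: analytic_on_act.
  by apply: eq_on_act; [apply/analytic_on_act/analytic_onD|exact: IHQ].
Qed.

Lemma act_scale P (c : C) f : analytic_on f ->
  eq_on (weyl_act P (fun i y => c * f i y)) (fun i y => c * weyl_act P f i y).
Proof.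
elim: P f => [c'|j|j|P IHP Q IHQ|P IHP Q IHQ] f fA /=.
- by move=> y Uy i; rewrite mulrCA.
- move=> y Uy i; rewrite /fmulX; case: (unlift ord_max j) => [j'|].
    by rewrite mulrCA.
  by case: i => //; rewrite mulr0.
- exact: fderivZ.
- by move=> y Uy i; rewrite (IHP f)// (IHQ f)// mulrDr.
- apply: eq_on_trans (IHP _ _); try exact: analytic_on_act.
  by apply: eq_on_act; [apply/analytic_on_act/analytic_onZ|exact: IHQ].
Qed.

Lemma fderivC i j f : analytic_on f ->
  eq_on (fderiv i (fderiv j f)) (fderiv j (fderiv i f)).
Proof.
move=> fA y Uy k; rewrite /fderiv.
case: (unlift ord_max i) => [i'|]; case: (unlift ord_max j) => [j'|].
- exact: (derivC i' j' (fA _ Uy k)).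
- exact: (derivZ _ i' (fA _ Uy k.+1)).
- exact: (esym (derivZ _ j' (fA _ Uy k.+1))).
- by [].
Qed.

Lemma fmulXC i j f : eq_on (fmulX i (fmulX j f)) (fmulX j (fmulX i f)).
Proof.
move=> y Uy k; rewrite /fmulX.
case: (unlift ord_max i) => [i'|]; case: (unlift ord_max j) => [j'|] //.
- by rewrite mulrCA.
- by case: k => //; rewrite mulr0.
- by case: k => //; rewrite mulr0.
Qed.

Lemma fderiv_mulX i j f : analytic_on f ->
  eq_on (fderiv i (fmulX j f))
        (fun k y => fmulX j (fderiv i f) k y + (i == j)%:R * f k y).
Proof.
move=> fA y Uy k; rewrite /fderiv /fmulX.
case: (unliftP ord_max i) => [i'|] ->; case: (unliftP ord_max j) => [j'|] ->.
- by rewrite (inj_eq lift_inj); apply: derivX; exact: fA.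
- rewrite [lift _ _ == _]eq_sym (negbTE (neq_lift _ _)) mul0r addr0.
  case: k => [|k]//=.
  have -> : (fun y' : 'rV[C]_n => 0 : C) = (fun y' => 0 * f 0%N y').
    by apply/funext => y'; rewrite mul0r.
  by rewrite derivZ ?mul0r//; exact: fA.
- by rewrite (negbTE (neq_lift _ _)) mul0r addr0 mulrCA.
- rewrite eqxx mul1r; case: k => [|k]; first by rewrite mul1r add0r.
  by rewrite -[in LHS]natr1 mulrDl mul1r.
Qed.

(** Coefficients are total functions, on which partial derivatives need neither commute nor be
    additive; the relations of the Weyl algebra are therefore checked only for series that are
    analytic on the open set [U]. *)
Lemma weyl_eq_act P Q f : weyl_eq P Q -> analytic_on f ->
  eq_on (weyl_act P f) (weyl_act Q f).
Proof.
move=> PQ; elim: PQ f => /=.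
- by [].
- by move=> ? ? _ IH f fA; exact/eq_on_sym/IH.
- by move=> ? ? ? _ IH1 _ IH2 f fA; exact: eq_on_trans (IH1 _ fA) (IH2 _ fA).
- by move=> ? ? ? ? _ IH1 _ IH2 f fA y Uy i; rewrite IH1// IH2.
- move=> P1 P2 Q1 Q2 _ IH1 _ IH2 f fA.
  apply: eq_on_trans (IH1 _ _) _; first exact: analytic_on_act.
  by apply: eq_on_act; [exact: analytic_on_act|exact: IH2].
- by move=> ? ? ? f _ y _ i; rewrite addrA.
- by move=> ? ? f _ y _ i; rewrite addrC.
- by move=> ? f _ y _ i; rewrite mul0r add0r.
- by [].
- by [].
- move=> P1 Q1 S1 f fA; apply: act_additive; exact: analytic_on_act.
- by move=> ? f _ y _ i; rewrite !mul0r.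
- by move=> ? f _ y _ i; rewrite mul1r.
- by move=> c c' f _ y _ i; rewrite mulrDl.
- by move=> c c' f _ y _ i; rewrite mulrA.
- move=> c P1 f fA; exact/eq_on_sym/act_scale.
- by move=> i j f _; exact: fmulXC.
- by move=> i j f fA; exact: fderivC.
- by move=> i j f fA; exact: fderiv_mulX.
Qed.

End WeylAction.

(** * Linear maps defined on monomials *)

Section MpolyLinear.
Variables (K : comNzRingType) (n : nat) (V : lmodType K).
Implicit Types (p q : mpoly n K) (G : multinom n -> V).

(** The linear map that extends [G] from the monomials to all polynomials. *)
Definition lsum G p : V := \sum_(m <- msupp p) mcoeff m p *: G m.

Lemma lsum_sup G p (r : seq (multinom n)) : uniq r -> {subset msupp p <= r} ->
  lsum G p = \sum_(m <- r) mcoeff m p *: G m.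
Proof.
move=> ur pr; rewrite [RHS](bigID (mem (msupp p)))/= [X in _ + X]big1 ?addr0.
  rewrite /lsum -[RHS]big_filter; apply: perm_big; apply: uniq_perm.
  - exact: msupp_uniq.
  - exact: filter_uniq.
  by move=> m; rewrite mem_filter /= andb_idr//; exact: pr.
by move=> m /memN_msupp_eq0 ->; rewrite scale0r.
Qed.

Lemma lsumD G p q : lsum G (p + q) = lsum G p + lsum G q.
Proof.
pose r := undup (msupp (p + q) ++ msupp p ++ msupp q).
rewrite !(@lsum_sup _ _ r) ?undup_uniq//; last first.
- by move=> m mp; rewrite mem_undup !mem_cat mp.
- by move=> m mp; rewrite mem_undup !mem_cat mp orbT.
- by move=> m mp; rewrite mem_undup !mem_cat mp !orbT.
by rewrite -big_split; apply: eq_bigr => m _; rewrite mcoeffD scalerDl.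
Qed.

Lemma lsumZ G c p : lsum G (c *: p) = c *: lsum G p.
Proof.
rewrite (@lsum_sup _ _ (msupp p)) ?msupp_uniq//; last exact: msuppZ_le.
by rewrite scaler_sumr; apply: eq_bigr => m _; rewrite mcoeffZ scalerA.
Qed.

Lemma lsum0 G : lsum G 0 = 0.
Proof. by rewrite /lsum msupp0 big_nil. Qed.

Lemma lsumB G p q : lsum G (p - q) = lsum G p - lsum G q.
Proof. by rewrite lsumD (_ : - q = (-1) *: q) ?lsumZ scaleN1r. Qed.

Lemma lsumX G m : lsum G (mpolyX K m) = G m.
Proof. by rewrite /lsum msuppX big_seq1 mcoeffX eqxx scale1r. Qed.

Lemma lsum_sum G (I : Type) (r : seq I) (F : I -> mpoly n K) :
  lsum G (\sum_(i <- r) F i) = \sum_(i <- r) lsum G (F i).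
Proof. by elim/big_rec2: _ => [|i x y _ <-]; rewrite ?lsum0 ?lsumD. Qed.

Lemma lsumXM G m q : lsum G (mpolyX K m * q) = lsum (fun k => G (mnm_add m k)) q.
Proof.
rewrite {1}[q]mpolyE mulr_sumr lsum_sum; apply: eq_bigr => k _.
by rewrite -scalerAr -mpolyXD lsumZ lsumX.
Qed.

Lemma lsumM G p q :
  lsum G (p * q) = lsum (fun m => lsum (fun k => G (mnm_add m k)) q) p.
Proof.
rewrite {1}[p]mpolyE mulr_suml lsum_sum; apply: eq_bigr => m _.
by rewrite -scalerAl lsumZ lsumXM.
Qed.

End MpolyLinear.

(** * Solutions of the hypergeometric system on an open set *)

Section Solutions.
Variables (R : realType) (n : nat) (a : 'I_n.+1 -> nat) (beta : cplx R).
Local Notation C := (cplx R).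
Local Notation fseries := (fseries R n).
Implicit Types (f g : fseries) (P Q S : weyl R n) (p : mpoly n.+1 C).

Definition wdeg (m : multinom n.+1) : nat := (\sum_j a j * m j)%N.

(** The two monomials of a generator have the same [A]-degree, so any functional that depends only
    on this degree kills it. The shift [s] absorbs multiplication by a polynomial. *)
Lemma toric_lsum (D : nat -> C) p : toric_ideal a p ->
  forall s, lsum (fun m => D (s + wdeg m)%N : C^o) p = 0.
Proof.
elim=> {p} [u u0|p q _ IHp _ IHq|p q _ IH] s.
- rewrite lsumB !lsumX; suff -> : wdeg (pos_part u) = wdeg (neg_part u) by rewrite subrr.
  rewrite /wdeg; apply/eqP; rewrite -eqz_nat -subr_eq0; apply/eqP.
  rewrite -[RHS]u0 !(big_morph Posz PoszD (erefl (Posz 0))) -sumrB; apply: eq_bigr => i _.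
  rewrite !PoszM -mulrBr /pos_part /neg_part !mnmE; congr (_ * _).
  case: (ltrgtP 0 (u i)) => [h|h|<-]; last exact: subrr.
    by rewrite gtz0_abs//; exact: subr0.
  by rewrite ltz0_abs//; apply: (etrans (sub0r _)); exact: opprK.
- by rewrite lsumD IHp IHq addr0.
- rewrite lsumM (_ : (fun m => _) = fun=> 0); last first.
    apply/funext => m; rewrite -[RHS](IH (s + wdeg m)%N); congr lsum.
    apply/funext => k; congr D; rewrite -addnA; congr addn.
    by rewrite /wdeg -big_split; apply: eq_bigr => i _; rewrite mnmDE mulnDr.
  by rewrite /lsum big1// => m _; rewrite scaler0.
Qed.

Lemma weyl_act_sum (s : seq (weyl R n)) f i y :
  weyl_act (weyl_sum s) f i y = \sum_(P <- s) weyl_act P f i y.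
Proof.
by elim: s => [|P s IH] /=; rewrite ?big_nil ?mul0r// big_cons IH.
Qed.

Definition dmon (m : multinom n.+1) : weyl R n :=
  weyl_prod [seq weyl_prod (nseq (m j) (WD R j)) | j : 'I_n.+1].

Lemma weyl_act_dpoly p f i y : weyl_act (weyl_of_dpoly p) f i y =
  lsum (fun m => weyl_act (dmon m) f i y : C^o) p.
Proof. by rewrite /weyl_of_dpoly weyl_act_sum big_map. Qed.

Lemma weyl_act_WDn j k f :
  weyl_act (weyl_prod (nseq k (WD R j))) f = iter k (fderiv j) f.
Proof.
elim: k => [|k IH] /=; last by rewrite IH.
by apply/funext => i; apply/funext => y; rewrite mul1r.
Qed.

Lemma weyl_act_dmon m f :
  weyl_act (dmon m) f = foldr (fun j g => iter (m j) (fderiv j) g) f (enum 'I_n.+1).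
Proof.
rewrite /dmon /image_mem; elim: (enum _) => [|j s IH] /=.
  by apply/funext => i; apply/funext => y; rewrite mul1r.
by rewrite weyl_act_WDn IH.
Qed.

Lemma weyl_act_dmonU j k f :
  weyl_act (dmon (mnm_muln (mnm1 j) k)) f = iter k (fderiv j) f.
Proof.
rewrite weyl_act_dmon; have := enum_uniq 'I_n.+1; have := mem_enum 'I_n.+1 j.
elim: (enum _) => [//|i s IH] /=; rewrite inE mulmnE mnm1E.
have [<- _ /andP[js us]|ij /= js /andP[_ us]] := eqVneq j i; last first.
  exact: IH.
rewrite mul1n; congr iter; elim: s js {IH us} => //= i' s IH.
by rewrite inE mulmnE mnm1E => /norP[/negbTE-> /IH ->].
Qed.

Lemma weyl_act_euler f i y : weyl_act (euler_op a beta) f i y =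
  \sum_j (a j)%:R * fmulX j (fderiv j f) i y - beta * f i y.
Proof. by rewrite /= weyl_act_sum big_map mulNr big_enum. Qed.

Variables (U : set 'rV[C]_n).
Hypothesis U_nbhs : forall y, U y -> nbhs y U.

(* These generators suffice: modulo the [d_v - d_1^(a_v)] every monomial [d^u]
   is [d_1^(a.u)], so that all binomials [d^u - d^u'] with [a.u = a.u'] vanish. *)
Definition is_solution f : Prop := [/\ analytic_on U f,
  forall v, eq_on U (fderiv v f) (iter (a v) (fderiv ord0) f) &
  eq_on U (weyl_act (euler_op a beta) f) (fun _ _ => 0)].

Lemma analytic_on_iter j k f : analytic_on U f -> analytic_on U (iter k (fderiv j) f).
Proof. by move=> fA; elim: k => //= k; exact: analytic_on_deriv. Qed.

Lemma eq_on_iter j k f g : analytic_on U f -> eq_on U f g ->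
  eq_on U (iter k (fderiv j) f) (iter k (fderiv j) g).
Proof.
by move=> fA fg; elim: k => //= k IH; apply: eq_on_deriv => //; exact: analytic_on_iter.
Qed.

Lemma fderiv_iterC i j k f : analytic_on U f ->
  eq_on U (fderiv i (iter k (fderiv j) f)) (iter k (fderiv j) (fderiv i f)).
Proof.
move=> fA; elim: k => //= k IH.
apply: eq_on_trans (fderivC _ _ _) _; first exact: analytic_on_iter.
by apply: eq_on_deriv => //; apply/analytic_on_deriv/analytic_on_iter.
Qed.

Lemma solution_fderiv_iter f v k : is_solution f ->
  eq_on U (fderiv v (iter k (fderiv ord0) f)) (iter (k + a v) (fderiv ord0) f).
Proof.
move=> [fA fD _]; apply: eq_on_trans (fderiv_iterC _ _ _ fA) _.
rewrite iterD; apply: eq_on_iter; first exact: analytic_on_deriv.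
exact: fD.
Qed.

Lemma solution_iter_iter f v k l : is_solution f ->
  eq_on U (iter l (fderiv v) (iter k (fderiv ord0) f))
          (iter (k + a v * l) (fderiv ord0) f).
Proof.
move=> fS; have [fA _ _] := fS; elim: l => [|l IH] /=; first by rewrite muln0 addn0.
apply: eq_on_trans (_ : eq_on U _ (fderiv v (iter (k + a v * l) (fderiv ord0) f))) _.
  by apply: eq_on_deriv => //; do 2! apply: analytic_on_iter.
by rewrite mulnS [(a v + _)%N]addnC addnA; exact: solution_fderiv_iter.
Qed.

Lemma solution_dmon f m : is_solution f ->
  eq_on U (weyl_act (dmon m) f) (iter (wdeg m) (fderiv ord0) f).
Proof.
move=> fS; have [fA _ _] := fS; rewrite weyl_act_dmon /wdeg -big_enum.
have fAf s : analytic_on U (foldr (fun j g => iter (m j) (fderiv j) g) f s).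
  by elim: s => //= j s; exact: analytic_on_iter.
elim: (enum _) => [|j s IH]; first by rewrite big_nil.
rewrite big_cons [_ (a j * _)%N _]addnC /=.
apply: eq_on_trans (solution_iter_iter _ _ _ fS); exact: eq_on_iter.
Qed.

(** On a solution [d^m] acts as [d_1^(wdeg m)], so a toric operator acts through a functional of the
    [A]-degree and [toric_lsum] applies. *)
Lemma solution_annihilated f P : is_solution f -> hyp_ideal a beta P ->
  eq_on U (weyl_act P f) (fun _ _ => 0).
Proof.
move=> fS; have [fA fD fE] := fS; elim=> {P}.
- move=> p pT y Uy i; rewrite weyl_act_dpoly.
  rewrite -[RHS](toric_lsum (fun k => iter k (fderiv ord0) f i y) pT 0%N).
  by congr lsum; apply/funext => m; rewrite add0n; exact: (solution_dmon m fS).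
- exact: fE.
- by move=> P Q _ IHP _ IHQ y Uy i /=; rewrite IHP// IHQ// addr0.
- move=> P Q _ IHQ /=; have QA := analytic_on_act Q fA.
  (* Writing zero as [0 * Q f] reduces the vanishing of [P 0] to the compatibility of the action
     with scalars. *)
  have h0 : eq_on U (weyl_act Q f) (fun i y => 0 * weyl_act Q f i y).
    by move=> y Uy i; rewrite mul0r; exact: IHQ.
  apply: eq_on_trans (eq_on_act U_nbhs P QA h0) _.
  apply: eq_on_trans (act_scale U_nbhs P 0 QA) _.
  by move=> y Uy i; rewrite mul0r.
- move=> P Q PQ _ IH; apply: eq_on_trans (eq_on_sym _) IH.
  exact: weyl_eq_act.
Qed.

Hypothesis a1 : a ord0 = 1%N.

Lemma solution_of_annihilated f : analytic_on U f ->
  (forall v, eq_on U (weyl_act (weyl_of_dpoly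
    (mpolyX C (mnm1 v) - mpolyX C (mnm_muln (mnm1 ord0) (a v)))) f) (fun _ _ => 0)) ->
  eq_on U (weyl_act (euler_op a beta) f) (fun _ _ => 0) -> is_solution f.
Proof.
move=> fA fT fE; split=> // v y Uy i; have := fT v y Uy i.
rewrite weyl_act_dpoly lsumB !lsumX weyl_act_dmonU => /eqP; rewrite subr_eq0.
by rewrite -(mulm1n (mnm1 v)) weyl_act_dmonU => /eqP.
Qed.

Lemma toric_binomial v : toric_ideal a
  (mpolyX C (mnm1 v) - mpolyX C (mnm_muln (mnm1 ord0) (a v))).
Proof.
(* For [v = ord0] the binomial is 0, which lies in the ideal as the product of 0 with the generator
   of [u = 0]. *)
have [->|v0] := eqVneq v ord0.
  rewrite a1 mulm1n subrr -(mul0r 0); apply: toric_mul.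
  have <- : mpolyX C (pos_part (fun=> 0)) - mpolyX C (neg_part (fun=> 0)) = 0
    :> mpoly n.+1 C by exact: subrr.
  by apply: toric_gen; rewrite big1// => i _; rewrite mulr0.
(* [u = e_v - a_v e_1], which [A] kills because [a_1 = 1]. *)
pose u (i : 'I_n.+1) : int := if i == v then 1 else if i == ord0 then - (a v)%:Z else 0.
have -> : mnm1 v = pos_part u.
  apply/mnmP => i; rewrite mnm1E /pos_part mnmE /u eq_sym.
  by case: eqP => //; case: eqP => // _ _; case: (a v).
have -> : mnm_muln (mnm1 ord0) (a v) = neg_part u.
  apply/mnmP => i; rewrite mulmnE mnm1E /neg_part mnmE /u.
  have [->|iv] := eqVneq i v; first by rewrite eq_sym (negbTE v0).
  rewrite [ord0 == i]eq_sym; case: eqP => //= _.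
  by rewrite mul1n oppr_le0 abszN.
apply: toric_gen; rewrite (bigD1 v)//= (bigD1 ord0)/=; last by rewrite eq_sym.
rewrite big1 => [|i /andP[iv i0]]; last by rewrite /u (negbTE iv) (negbTE i0) mulr0.
by rewrite /u !eqxx [ord0 == v]eq_sym (negbTE v0) a1 mulr1 mul1r addr0 subrr.
Qed.

End Solutions.

Section LinearCombinations.
Variables (R : realType) (n : nat) (U : set 'rV[cplx R]_n).
Local Notation C := (cplx R).
Hypothesis U_nbhs : forall y, U y -> nbhs y U.
Variables (I : Type) (c : I -> C) (phi : I -> fseries R n).
Hypothesis phiA : forall j, analytic_on U (phi j).

Let comb (s : seq I) : fseries R n := fun i y => \sum_(j <- s) c j * phi j i y.

Let comb_nil : comb [::] = fun i y => 0.
Proof. by apply/funext => i; apply/funext => y; rewrite /comb big_nil. Qed.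

Let comb_cons j s : comb (j :: s) = fun i y => c j * phi j i y + comb s i y.
Proof. by apply/funext => i; apply/funext => y; rewrite /comb big_cons. Qed.

Lemma analytic_on_comb s : analytic_on U (comb s).
Proof.
elim: s => [|j s IH]; first by rewrite comb_nil => y Uy i; exact: analytic0.
by rewrite comb_cons; apply: analytic_onD => //; exact: analytic_onZ.
Qed.

Lemma act_comb P s : eq_on U (weyl_act P (comb s))
  (fun i y => \sum_(j <- s) c j * weyl_act P (phi j) i y).
Proof.
elim: s => [|j s IH].
  have A0 : analytic_on U (fun (_ : nat) (_ : 'rV[C]_n) => 0 : C).
    by move=> y Uy i; exact: analytic0.
  move=> y Uy i; rewrite big_nil comb_nil.
  have -> : (fun (_ : nat) (_ : 'rV[C]_n) => 0 : C) = fun i y => 0 * (fun _ _ => 0) i y.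
    by apply/funext => k; apply/funext => z; rewrite mul0r.
  by rewrite (act_scale U_nbhs P 0 A0)// mul0r.
rewrite comb_cons => y Uy i; rewrite big_cons.
rewrite (act_additive U_nbhs P (analytic_onZ _ (phiA j)) (analytic_on_comb s))//.
by rewrite IH// (act_scale U_nbhs P (c j) (phiA j)).
Qed.

End LinearCombinations.

(** * The Taylor recurrence of a solution *)

Section SolutionTaylor.
Variables (R : realType) (d : nat) (a : 'I_d.+3 -> nat) (beta : cplx R).
Local Notation C := (cplx R).
Local Notation fseries := (fseries R d.+2).
Implicit Types (f g : fseries).
Hypothesis a1 : a ord0 = 1%N.
Variable (U : set 'rV[C]_d.+2).
Hypothesis U_nbhs : forall y, U y -> nbhs y U.

Definition ywt (v : 'I_d.+2) : nat := a (lift ord_max v).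
Definition ydeg (k : {ffun 'I_d.+2 -> nat}) : nat := (\sum_v ywt v * k v)%N.
Definition mifact n (k : {ffun 'I_n -> nat}) : nat := (\prod_(v < n) (k v)`!)%N.

Lemma ord0_lift : ord0 = lift ord_max ord0 :> 'I_d.+3.
Proof. exact: val_inj. Qed.

Lemma ywt0 : ywt ord0 = 1%N.
Proof. by rewrite /ywt -ord0_lift. Qed.

Lemma ydegD k l : ydeg (miD k l) = (ydeg k + ydeg l)%N.
Proof. by rewrite /ydeg -big_split; apply: eq_bigr => v _; rewrite ffunE mulnDr. Qed.

Lemma ydegU v : ydeg (miU v) = ywt v.
Proof.
rewrite /ydeg (bigD1 v)//= ffunE eqxx muln1 big1 ?addn0// => i /negbTE iv.
by rewrite ffunE iv muln0.
Qed.

Lemma ydeg0 : ydeg (mi0 _) = 0%N.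
Proof. by rewrite /ydeg big1// => i _; rewrite ffunE muln0. Qed.

Lemma mifactDU n (k : {ffun 'I_n -> nat}) j :
  mifact (miD k (miU j)) = ((k j).+1 * mifact k)%N.
Proof.
rewrite /mifact (bigD1 j)//= [in RHS](bigD1 j)//= !ffunE eqxx addn1 factS -mulnA.
congr (_ * (_ * _))%N; apply: eq_bigr => i /negbTE ij.
by rewrite !ffunE ij addn0.
Qed.

Lemma mifact_gt0 n (k : {ffun 'I_n -> nat}) : (0 < mifact k)%N.
Proof. by apply: prodn_gt0 => i; exact: fact_gt0. Qed.

Lemma mifact0 n : mifact (mi0 n) = 1%N.
Proof. by rewrite /mifact big1// => i _; rewrite ffunE. Qed.

(* The derivatives [d_1^k f] on [x_n = 0].  Since [d^u f = d_1^(a.u) f] for a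
   solution, they contain all its Taylor coefficients. *)
Definition taylor_fun f (y : 'rV[C]_d.+2) (k : nat) : C :=
  iter k (fderiv ord0) f 0%N y.

Lemma fderiv_lift v f i : fderiv (lift ord_max v) f i = 'D_(delta_mx 0 v) (f i).
Proof. by apply/funext => y; rewrite /fderiv liftK. Qed.

Lemma iter_fderiv0 k f i :
  iter k (fderiv ord0) f i = iter k (fun u : 'rV[C]_d.+2 -> C => 'D_(delta_mx 0 ord0) u) (f i).
Proof. by elim: k => //= k IH; rewrite {1}ord0_lift fderiv_lift IH. Qed.

(** A derivative in direction [j] turns [d_1^s f] into [d_1^(s + a_j) f]; the induction on the
    multi-index is therefore run for all iterates [d_1^s f] simultaneously. *)
Lemma solution_coef f y c r : is_solution a beta U f -> U y -> 0 < r ->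
  pseries c y (f 0%N) r ->
  forall k, c k = taylor_fun f y (ydeg k) / (mifact k)%:R.
Proof.
move=> fS Uy r0 h k; have [fA _ _] := fS.
suff : forall s c r, 0 < r -> pseries c y (iter s (fderiv ord0) f 0%N) r ->
    c k * (mifact k)%:R = taylor_fun f y (s + ydeg k)%N.
  move=> /(_ 0%N c r r0 h) <-; rewrite mulfK// pnatr_eq0 -lt0n.
  exact: mifact_gt0.
elim/mi_ind: k {c r r0 h} => [|k j IH] s c r r0 h.
  by rewrite ydeg0 mifact0 mulr1 addn0 -(pseries_center r0 h).
have hd := pseries_derive j r0 h.
have hn := eq_on_near U_nbhs 0%N (solution_fderiv_iter U_nbhs (lift ord_max j) s fS) Uy.
rewrite fderiv_lift in hn.
have [r' /andP[r'0 _] h'] := pseries_congr hd hn r0.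
have := IH _ _ _ r'0 h'.
rewrite mifactDU ydegD ydegU natrM /dcoef mulrA [c _ * _]mulrC => ->.
by rewrite -addnA [(ydeg k + _)%N]addnC.
Qed.

Lemma analytic_sum (I : Type) (s : seq I) (F : I -> 'rV[C]_d.+2 -> C) y :
  (forall i, analytic_at (F i) y) -> analytic_at (fun z => \sum_(i <- s) F i z) y.
Proof.
move=> FA; elim: s => [|i s IH].
  by rewrite (_ : (fun z => _) = fun=> 0); [exact: analytic0|apply/funext => z; rewrite big_nil].
rewrite (_ : (fun z => _) = fun z => F i z + \sum_(j <- s) F j z); first exact: analyticD.
by apply/funext => z; rewrite big_cons.
Qed.

Lemma deriv_sum (I : Type) (s : seq I) (F : I -> 'rV[C]_d.+2 -> C) y j :
  (forall i, analytic_at (F i) y) ->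
  'D_(delta_mx 0 j) (fun z => \sum_(i <- s) F i z) y =
  \sum_(i <- s) 'D_(delta_mx 0 j) (F i) y.
Proof.
move=> FA; elim: s => [|i s IH].
  rewrite big_nil (_ : (fun z => _) = fun z => 0 * (fun=> 0) z).
    by rewrite derivZ ?mul0r//; exact: analytic0.
  by apply/funext => z; rewrite big_nil mul0r.
rewrite (_ : (fun z => _) = fun z => F i z + \sum_(j <- s) F j z); last first.
  by apply/funext => z; rewrite big_cons.
by rewrite big_cons -IH; apply: derivD => //; exact: analytic_sum.
Qed.

(** The Euler equation is differentiated [k] times by [d_1]. Each time the commutator of [d_1] with
    [x_1] contributes one more copy of the next Taylor number, which raises the coefficient
    [k - beta] by 1. *)
Lemma solution_recurrence f y k : is_solution a beta U f -> U y ->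
  \sum_v (ywt v)%:R * y 0 v * taylor_fun f y (k + ywt v) +
  (k%:R - beta) * taylor_fun f y k = 0.
Proof.
move=> fS; have [fA fD fE] := fS.
have gA l z : U z -> analytic_at (iter l (fderiv ord0) f 0%N) z.
  by move=> Uz; apply: (analytic_on_iter ord0 l fA).
elim: k y => [|k IH] y Uy.
  (* In the component of index 0 the summand [a_n x_n d_n] vanishes, and the others become shifts
     through [d_v f = d_1^(a_v) f]. *)
  have := fE y Uy 0%N; rewrite weyl_act_euler (bigD1_ord ord_max)//=.
  rewrite /fmulX unlift_none mulr0 add0r sub0r mulNr => E.
  rewrite /taylor_fun -[RHS]E; congr (_ - _); apply: eq_bigr => v _.
  by rewrite liftK -mulrA fD.
pose h (z : 'rV[C]_d.+2) : C := \sum_v (ywt v)%:R * (z 0 v * taylor_fun f z (k + ywt v)) +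
  (k%:R - beta) * taylor_fun f z k.
have h0 : \forall z \near y, h z = 0 * (fun _ : 'rV[C]_d.+2 => 0) z.
  apply: filterS (U_nbhs Uy) => z Uz; rewrite mul0r -[RHS](IH z Uz) /h.
  by congr (_ + _); apply: eq_bigr => v _; rewrite mulrA.
have XA v : analytic_at (fun z : 'rV[C]_d.+2 => (ywt v)%:R * (z 0 v * taylor_fun f z (k + ywt v)))
  y.
  by apply/analyticZ/analyticX/gA.
have hA : analytic_at h y.
  by apply: analyticD; [exact: analytic_sum|exact/analyticZ/gA].
have := deriv_congr ord0 hA h0; rewrite derivZ ?mul0r; last exact: analytic0.
have hs : analytic_at (fun z => \sum_v (ywt v)%:R * (z 0 v * taylor_fun f z (k + ywt v))) y.
  exact: analytic_sum.
have hz : analytic_at (fun z => (k%:R - beta) * taylor_fun f z k) y.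
  exact/analyticZ/gA.
rewrite /h derivD//.
have DS l : 'D_(delta_mx 0 ord0) (fun z => taylor_fun f z l) y = taylor_fun f y l.+1.
  by rewrite /taylor_fun /= {2}ord0_lift fderiv_lift.
rewrite deriv_sum// derivZ ?DS; last exact: gA.
under eq_bigr => v _.
  rewrite derivZ; last exact/analyticX/gA.
  rewrite derivX; last exact/gA.
  rewrite DS mulrDr mulrA -addSn.
  over.
rewrite /= big_split /= [X in _ + X + _](bigD1 ord0)//= ywt0 ?eqxx /= ?mul1r.
rewrite [X in _ + (_ + X) + _]big1; last first.
  by move=> v; rewrite eq_sym => /negbTE ->; rewrite mul0r mulr0.
rewrite addr0 addn1 => E; rewrite [RHS]E -addrA; congr (_ + _).
by rewrite -natr1; ring.
Qed.

(** The left side is the component of index 0 of [d_n^i f], and [d_n] acts as [d_1^(a_n)]. Thus the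
    whole series is determined by [f_0]. *)
Lemma solution_component f i y : is_solution a beta U f -> U y ->
  (i`!)%:R * f i y = taylor_fun f y (a ord_max * i).
Proof.
move=> fS; have [fA fD _] := fS; elim: i y => [|i IH] y Uy.
  by rewrite muln0 mul1r.
have := fD ord_max y Uy i; rewrite {1}/fderiv unlift_none => E.
rewrite factS mulnC natrM -mulrA E mulnS addnC /taylor_fun addnC iterD.
have h : eq_on U (fun=> iter (a ord_max * i) (fderiv ord0) f 0%N)
    (fun=> fun z => (i`!)%:R * f i z).
  by move=> z Uz _; rewrite IH.
have hA : analytic_on U (fun=> iter (a ord_max * i) (fderiv ord0) f 0%N).
  by move=> z Uz _; apply: (analytic_on_iter ord0 _ fA).
have := eq_on_iter U_nbhs ord0 (a ord_max) hA h Uy 0%N.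
rewrite !iter_fderiv0 => ->; rewrite -iter_fderiv0.
have fiA : analytic_on U (fun=> f i) by move=> z Uz _; exact: fA.
have := act_scale U_nbhs (weyl_prod (nseq (a ord_max) (WD R ord0))) (i`!)%:R fiA Uy 0%N.
rewrite !weyl_act_WDn.
by rewrite !iter_fderiv0 => ->.
Qed.

End SolutionTaylor.

(** * The recurrence as a statement on sequences *)

Section Recurrence.
Variables (R : realType) (n : nat) (b : 'I_n -> nat) (x : 'I_n -> cplx R).
Variable beta : cplx R.
Local Notation C := (cplx R).
Implicit Types D E : nat -> C.

(* The Euler equation in terms of the numbers [D k = (d_1^k f)(y, 0)]. *)
Definition recurrence D : Prop := forall k,
  \sum_v (b v)%:R * x v * D (k + b v)%N + (k%:R - beta) * D k = 0.

Lemma recurrence_comb (I : Type) (s : seq I) (c : I -> C) (D : I -> nat -> C) :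
  (forall j, recurrence (D j)) -> recurrence (fun k => \sum_(j <- s) c j * D j k).
Proof.
move=> h k; under eq_bigr do rewrite mulr_sumr.
rewrite exchange_big mulr_sumr -big_split big1//= => j _.
have E := congr1 (fun z => c j * z) (h j k).
rewrite mulr0 mulrDr mulr_sumr in E; rewrite -[RHS]E.
by congr (_ + _); [apply: eq_bigr => v _|]; ring.
Qed.

Lemma recurrence_unique D (v0 : 'I_n) : recurrence D -> x v0 != 0 ->
  (0 < b v0)%N -> (forall v, v != v0 -> b v < b v0)%N ->
  (forall k, (k < b v0)%N -> D k = 0) -> forall k, D k = 0.
Proof.
move=> h x0 b0 bv D0; elim/ltn_ind => k IH.
have [/D0//|kN] := ltnP k (b v0).
have := h (k - b v0)%N; rewrite (bigD1 v0)//= subnK// big1 => [|v vv0].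
  rewrite addr0 (IH (k - b v0)%N) ?mulr0 ?addr0; last first.
    by rewrite ltn_subrL b0 (leq_trans b0).
  by move/eqP; rewrite !mulf_eq0 (negbTE x0) pnatr_eq0 gtn_eqF//= => /eqP.
by rewrite IH ?mulr0// -ltn_subRL subKn ?bv// ltn_subrL.
Qed.

Hypothesis b_gt0 : forall v, (0 < b v)%N.

(** If all terms after [k0] vanish, the equation at [k0] reduces to [(k0 - beta) D_(k0) = 0], which
    leaves only the index equal to [beta] undecided. *)
Lemma recurrence_backward D k0 : recurrence D -> (forall k, (k0 <= k)%N -> D k = 0) ->
  (forall k : nat, beta = k%:R -> D k = 0) -> forall k, D k = 0.
Proof.
move=> h D0 Db; elim: k0 D0 => [|k0 IH] D0 k; first exact: D0.
apply: IH => l; rewrite leq_eqVlt => /orP[/eqP<-|]; last exact: D0.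
have [/Db//|bk] := eqVneq beta k0%:R.
have := h k0; rewrite big1 => [|v _]; last first.
  by rewrite D0 ?mulr0// -addn1 leq_add2l.
by move/eqP; rewrite add0r mulf_eq0 subr_eq0 eq_sym (negbTE bk) => /eqP.
Qed.

Variables (N : nat) (sigma A K : R).
Hypothesis b_le : forall v, (b v <= N)%N.
Hypotheses (sigma0 : 0 <= sigma) (sigmaN : N%:R * sigma < 1) (A1 : 1 <= A).

Let w (k : nat) : R := A ^+ k * (k`!)%:R `^ sigma.

Let w_ge0 k : 0 <= w k.
Proof. by rewrite mulr_ge0 ?powR_ge0// exprn_ge0// (le_trans ler01). Qed.

Let fact_shift k v : ((k + b v)`! <= k`! * (k + N) ^ N)%N.
Proof.
apply: leq_trans (_ : k`! * (k + N) ^ (b v) <= _)%N; last first.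
  rewrite leq_mul2l; apply/orP; right; case: (posnP (k + N)) => [|kN0].
    move/eqP; rewrite addn_eq0 => /andP[_ /eqP N0].
    by have := b_gt0 v; rewrite ltnNge (leq_trans (b_le v))// N0.
  exact: leq_pexp2l.
have := b_le v; elim: (b v) => [|m IH] mN; first by rewrite addn0 expn0 muln1.
rewrite addnS factS expnS mulnCA; apply: leq_mul; last exact/IH/ltnW.
by rewrite -addnS leq_add2l.
Qed.

(** A step in the index multiplies the weight by at most a constant times [(k + N)^(N sigma)]. As
    [N sigma < 1], this grows more slowly than the factor [k - beta] of the recurrence. *)
Let w_shift k v : w (k + b v) <= A ^+ N * (k + N)%:R `^ (N%:R * sigma) * w k.
Proof.
rewrite /w exprD; apply: le_trans
  (_ : A ^+ k * A ^+ N * ((k`!)%:R `^ sigma * ((k + N)%:R `^ (N%:R * sigma))) <= _); last first.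
  by rewrite le_eqVlt; apply/orP; left; apply/eqP; ring.
apply: ler_pM; rewrite ?powR_ge0 ?mulr_ge0 ?exprn_ge0 ?(le_trans ler01 A1)//.
  by rewrite ler_wpM2l ?exprn_ge0 ?(le_trans ler01 A1)// ler_weXn2l.
rewrite powRrM powR_mulrn// -powRM ?exprn_ge0//.
apply: ge0_ler_powR; rewrite ?nnegrE ?mulr_ge0 ?exprn_ge0//.
by rewrite -natrX -natrM ler_nat.
Qed.

(* Since [N * sigma < 1], for large [k] solving the recurrence for [D k] halves
   any bound [lam * w k] valid on all later terms; iterating gives [D k = 0]. *)
Lemma recurrence_gevrey D : recurrence D ->
  (forall k, cnorm (D k) <= K * (A ^+ k * (k`!)%:R `^ sigma)) ->
  exists k0, forall k, (k0 <= k)%N -> D k = 0.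
Proof.
move=> h DK.
pose S := \sum_v cnorm ((b v)%:R * x v).
have S0 : 0 <= S by apply: sumr_ge0 => v _; exact: cnorm_ge0.
pose c' := S * A ^+ N.
have AN0 : 0 <= A ^+ N by rewrite exprn_ge0// (le_trans ler01 A1).
have c'0 : 0 <= c' by rewrite mulr_ge0.
pose tau := N%:R * sigma.
have tau1 : 0 < 1 - tau by rewrite subr_gt0.
pose L := 4 * c' + 1.
have L0 : 0 < L by rewrite /L; lra.
(* With [X = k + N], the first summand gives [L X^tau <= X], hence [c' X^tau <= X / 4]; the second
   one gives [X / 4 <= (k - |beta|) / 2]. *)
pose k0 := (Num.truncn (L `^ (1 - tau)^-1 + 2 * (N%:R + cnorm beta))).+1.
exists k0.
have key k : (k0 <= k)%N -> c' * (k + N)%:R `^ tau <= (k%:R - cnorm beta) / 2 /\ cnorm beta < k%:R.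
  move=> kk0; have hk : L `^ (1 - tau)^-1 + 2 * (N%:R + cnorm beta) < k%:R.
    by apply: lt_le_trans (truncnS_gt _) _; rewrite ler_nat.
  have P0 := powR_ge0 L (1 - tau)^-1; have B0 := cnorm_ge0 beta.
  have N0 : 0 <= N%:R :> R by [].
  have kB : cnorm beta < k%:R by lra.
  split=> //; pose X : R := (k + N)%:R.
  have XE : X = k%:R + N%:R by rewrite /X natrD.
  have X0 : 0 < X by lra.
  have LX : L <= X `^ (1 - tau).
    have -> : L = (L `^ (1 - tau)^-1) `^ (1 - tau).
      by rewrite -powRrM mulVf ?gt_eqF//; apply/esym/powRr1/ltW.
    by apply: ge0_ler_powR; rewrite ?nnegrE; lra.
  have XX : X `^ tau * X `^ (1 - tau) = X.
    rewrite -powRD; last by rewrite (gt_eqF X0) implybT.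
    by rewrite addrC subrK; apply/powRr1/ltW.
  have Xt0 : 0 <= X `^ tau by exact: powR_ge0.
  have : X `^ tau * L <= X by rewrite -[leRHS]XX ler_wpM2l.
  rewrite /L; nra.
have step lam : 0 <= lam -> (forall k, (k0 <= k)%N -> cnorm (D k) <= lam * w k) ->
    forall k, (k0 <= k)%N -> cnorm (D k) <= lam / 2 * w k.
  move=> lam0 hlam k kk0; have [h1 h2] := key k kk0.
  have kb0 : 0 < k%:R - cnorm beta by rewrite subr_gt0.
  have kbn : k%:R - cnorm beta <= cnorm (k%:R - beta).
    by rewrite lerBlDr -(cnorm_nat R k) -{1}(subrK beta k%:R) cnormD.
  have : (k%:R - cnorm beta) * cnorm (D k) <= lam * w k * (c' * (k + N)%:R `^ tau).
    apply: le_trans (_ : cnorm ((k%:R - beta) * D k) <= _).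
      by rewrite cnormM ler_wpM2r ?cnorm_ge0.
    have /eqP := h k; rewrite addrC addr_eq0 => /eqP ->; rewrite cnormN.
    apply: le_trans (cnorm_sum _ _ _) _.
    rewrite (_ : lam * w k * _ = S * (lam * (A ^+ N * (k + N)%:R `^ tau * w k)));
      last by rewrite /c'; ring.
    rewrite mulr_suml; apply: ler_sum => v _; rewrite cnormM ler_wpM2l ?cnorm_ge0//.
    apply: le_trans (hlam _ _) _; first by rewrite (leq_trans kk0)// leq_addr.
    by rewrite ler_wpM2l//; exact: w_shift.
  move=> h3; rewrite -(ler_pM2l kb0); apply: (le_trans h3).
  have lw : 0 <= lam * w k by rewrite mulr_ge0.
  have := ler_wpM2l lw h1.
  by rewrite (_ : _ * (lam / 2 * w k) = lam * w k * ((k%:R - cnorm beta) / 2)) //; ring.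
have K0 : 0 <= K.
  have := DK 0%N; rewrite expr0 fact0 powR1 !mulr1; apply: le_trans.
  exact: cnorm_ge0.
have iterK t k : (k0 <= k)%N -> cnorm (D k) <= K / 2 ^+ t * w k.
  elim: t k => [|t IH] k kk0; first by rewrite expr0 divr1; exact: DK.
  have /step/(_ k kk0) := IH; rewrite exprS invfM.
  rewrite (_ : K / 2 ^+ t / 2 = K * (2^-1 / 2 ^+ t)); last by ring.
  by apply; rewrite divr_ge0// exprn_ge0.
move=> k kk0; apply: cnorm_lt_eps0 => e e0.
pose t := (Num.truncn (K * w k / e)).+1.
have ht : K * w k / e < 2 ^+ t.
  apply: lt_le_trans (truncnS_gt _) _; rewrite -natrX ler_nat.
  exact/ltnW/ltn_expl.
apply: le_lt_trans (iterK t k kk0) _.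
by move: ht; rewrite ltr_pdivrMr// mulrAC ltr_pdivrMr ?exprn_gt0// [e * _]mulrC.
Qed.

End Recurrence.

(** * Gevrey bounds on solutions *)

Section NatSeries.
Variable R : realType.
Local Notation C := (cplx R).

Lemma abs_bounded_nat (u : nat -> C) M :
  (forall N, \sum_(i < N) cnorm (u i) <= M) -> abs_bounded u M.
Proof.
move=> uM A; have [N AN] : exists N, forall i, i \in A -> (i < N)%N.
  by exists (\max_(i <- A) i).+1 => i iA; rewrite ltnS; exact: leq_bigmax_seq.
apply: le_trans (uM N); rewrite -(sum_fset_iota (fun i => cnorm (u i))).
apply: fset_sum_le => [i|]; first exact: cnorm_ge0.
by apply/fsubsetP => i /AN iN; rewrite !inE /= mem_iota.
Qed.

Lemma abs_bounded_geometric (q : R) : 0 <= q < 1 ->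
  abs_bounded (fun i : nat => of_real (q ^+ i)) (1 - q)^-1.
Proof.
move=> /andP[q0 q1]; apply: abs_bounded_nat => N.
have -> : \sum_(i < N) cnorm (of_real (q ^+ i)) = \sum_(i < N) q ^+ i.
  by apply: eq_bigr => i _; rewrite cnorm_real ger0_norm// exprn_ge0.
have q1' : 0 < 1 - q by rewrite subr_gt0.
rewrite -(ler_pM2l q1') divff ?gt_eqF//.
have := subrX1 q N; have : 0 <= q ^+ N by rewrite exprn_ge0.
set S := \sum_(i < N) _; set X := q ^+ N; lra.
Qed.

Lemma abs_summable_power (u : nat -> C) (M r : R) (t : C) : 0 < r ->
  (forall i, cnorm (u i) * r ^+ i <= M) -> cnorm t < r ->
  abs_summable (fun i => u i * t ^+ i).
Proof.
move=> r0 uM tr; have q01 : 0 <= cnorm t / r < 1.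
  by rewrite divr_ge0 ?cnorm_ge0 ?ltW//= ltr_pdivrMr// mul1r.
have M0 : 0 <= M by apply: le_trans (uM 0%N); rewrite mulr_ge0 ?cnorm_ge0// exprn_ge0// ltW.
have h := abs_summableZ (of_real M) (ex_intro _ _ (abs_bounded_geometric q01)).
apply: abs_summable_le h => i.
rewrite !cnormM !cnorm_real cnormX ger0_norm// ger0_norm ?exprn_ge0 ?divr_ge0 ?cnorm_ge0
  ?(ltW r0)//.
rewrite expr_div_n mulrA ler_pdivlMr ?exprn_gt0// mulrAC.
by rewrite ler_wpM2r ?exprn_ge0 ?cnorm_ge0.
Qed.

(** The hypothesis concerns ordered partial sums only. Abel's argument makes the series absolutely
    summable on a smaller disc, where uniqueness of power series applies. *)
Lemma power_series_zero (u : nat -> C) (r : R) : 0 < r ->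
  (forall t : C, cnorm t < r -> (fun N => \sum_(i < N) u i * t ^+ i) @ \oo --> (0 : C)) ->
  forall i, u i = 0.
Proof.
move=> r0 h.
have r20 : 0 < r / 2 by rewrite divr_gt0.
(* From [N0] on, each term at [t = r / 2] is a difference of two partial sums of norm less than 1;
   the finitely many earlier terms enter [M] as a sum. *)
have [M uM] : exists M, forall i, cnorm (u i) * (r / 2) ^+ i <= M.
  have /h : cnorm (of_real (r / 2) : C) < r by rewrite cnorm_real gtr0_norm; lra.
  move=> /cvg_cplxP/(_ 1 ltr01)[N0 N0P].
  exists (\sum_(i < N0) cnorm (u i) * (r / 2) ^+ i + 2) => i.
  have E : cnorm (u i) * (r / 2) ^+ i = cnorm (u i * of_real (r / 2) ^+ i).
    by rewrite cnormM cnormX cnorm_real gtr0_norm.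
  have [iN|iN] := ltnP i N0.
    rewrite (bigD1 (Ordinal iN))//= -addrA lerDl addr_ge0// sumr_ge0// => j _.
    by rewrite mulr_ge0 ?cnorm_ge0// exprn_ge0// ltW.
  apply: le_trans (_ : 2 <= _); last first.
    by rewrite lerDr sumr_ge0// => j _; rewrite mulr_ge0 ?cnorm_ge0// exprn_ge0// ltW.
  have := N0P i iN; have := N0P i.+1 (leqW iN); rewrite big_ord_recr /= !subr0 => h1 h2.
  rewrite E; set y := \sum_(j < i) _ in h1 h2; set x := u i * _ in h1 *.
  have -> : x = (y + x) - y by ring.
  apply: le_trans (cnormB _ _) _; lra.
pose c (m : {ffun 'I_1 -> nat}) : C := u (m ord0).
have pc : pseries c (0 : 'rV[C]_1) (fun=> 0) (r / 2).
  move=> z /(_ ord0); have z00 : z 0 ord0 - (0 : 'rV[C]_1) 0 ord0 = z 0 ord0.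
    by rewrite [X in _ - X]mxE subr0.
  rewrite z00 => zr.
  have us := abs_summable_power r20 uM zr.
  have hs := abs_summable_has_famsum us.
  have zr' : cnorm (z 0 0) < r by lra.
  have l0 := cvg_cplx_unique (has_sum_cvg hs) (h _ zr'); rewrite l0 in hs.
  apply: has_sum_ext (has_sum_bij (f := fun m : {ffun 'I_1 -> nat} => m ord0)
    (g := fun k => [ffun=> k]) _ _ hs) => [m||k].
  - rewrite /c /vmon big_ord1 /=; congr (_ * _ ^+ _); exact: esym z00.
  - by move=> m; apply/ffunP => i; rewrite ffunE (ord1 i).
  - by rewrite ffunE.
have pz : pseries (fun=> 0) (0 : 'rV[C]_1) (fun=> 0 : C) (r / 2).
  move=> z _; apply: (@has_sum_ext R _ (fun=> 0)) => [m|]; first by rewrite mul0r.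
  exact: has_sum0.
move=> i; have := pseries_unique r20 pc pz [ffun=> i].
by rewrite /c ffunE.
Qed.

End NatSeries.

(** * Joint Taylor expansion and powers of the last variable *)

Section LastVariable.
Variables (R : realType) (n : nat).
Local Notation C := (cplx R).

Definition xjoin (y : 'rV[C]_n) (t : C) : 'rV[C]_n.+1 :=
  \row_j (if unlift ord_max j is Some v then y 0 v else t).

Lemma xjoin_lift y t v : xjoin y t 0 (lift ord_max v) = y 0 v.
Proof. by rewrite mxE liftK. Qed.

Lemma xjoin_max y t : xjoin y t 0 ord_max = t.
Proof. by rewrite mxE unlift_none. Qed.

Lemma col'_xjoin y t : col' ord_max (xjoin y t) = y.
Proof. by apply/rowP => v; rewrite mxE xjoin_lift. Qed.

Definition mjoin (k : {ffun 'I_n -> nat}) (i : nat) : {ffun 'I_n.+1 -> nat} :=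
  [ffun j => if unlift ord_max j is Some v then k v else i].

Definition mbody (m : {ffun 'I_n.+1 -> nat}) : {ffun 'I_n -> nat} :=
  [ffun v => m (lift ord_max v)].

Lemma mjoin_body m : mjoin (mbody m) (m ord_max) = m.
Proof.
by apply/ffunP => j; rewrite ffunE; case: unliftP => [v|] ->//; rewrite ffunE.
Qed.

Lemma mbody_join k i : mbody (mjoin k i) = k.
Proof. by apply/ffunP => v; rewrite !ffunE liftK. Qed.

Lemma mjoin_lift k i v : mjoin k i (lift ord_max v) = k v.
Proof. by rewrite ffunE liftK. Qed.

Lemma mjoin_max k i : mjoin k i ord_max = i.
Proof. by rewrite ffunE unlift_none. Qed.

Lemma vmon_join (K : comPzRingType) (h : 'I_n.+1 -> K) k i :
  vmon h (mjoin k i) = vmon (fun v => h (lift ord_max v)) k * h ord_max ^+ i.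
Proof.
rewrite /vmon (bigD1_ord ord_max)//= mjoin_max mulrC; congr (_ * _).
by apply: eq_bigr => v _; rewrite mjoin_lift.
Qed.

Lemma has_sum_mjoin (u : {ffun 'I_n.+1 -> nat} -> C) l :
  has_sum u l -> has_sum (fun x : nat * {ffun 'I_n -> nat} => u (mjoin x.2 x.1)) l.
Proof.
apply: (has_sum_bij (f := fun x : nat * {ffun 'I_n -> nat} => mjoin x.2 x.1)
  (g := fun m => (m ord_max, mbody m))) => [[i k]|m] /=.
  by rewrite mjoin_max mbody_join.
by rewrite mjoin_body.
Qed.

(** [convergent_at] provides only an analytic limit [F] of partial sums in [x_n]. Expanding [F]
    jointly at [p] and grouping by powers of [x_n] yields a second series with the same sums, so its
    coefficients are the [f i]; the joint expansion then supplies a Cauchy estimate uniform in [i]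
    and [k]. *)
Lemma convergent_at_coef (p : 'rV[C]_n.+1) (f : fseries R n) :
  p 0 ord_max = 0 -> convergent_at p f ->
  exists (c : nat -> {ffun 'I_n -> nat} -> C) (r M : R), [/\ 0 < r,
    forall i, pseries (c i) (col' ord_max p) (f i) r &
    forall i k, cnorm (c i k) * vmon (fun=> r) k * r ^+ i <= M].
Proof.
move=> p0 [F /nbhs_polydiscP[r1 r10 hr1]].
have [FA _] := hr1 p (polydisc_center p r10).
have [c [r2 r20 hc]] := (analytic_atP _ _).1 FA.
pose r := Num.min r1 r2; have r0 : 0 < r by rewrite lt_min r10.
pose w : 'rV[C]_n := col' ord_max p.
have wv v : w 0 v = p 0 (lift ord_max v) by rewrite mxE.
have xP y t : polydisc w r y -> cnorm t < r -> polydisc p r (xjoin y t).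
  move=> yw tr j; case: (unliftP ord_max j) => [v|] ->.
    by rewrite xjoin_lift -wv.
  by rewrite xjoin_max p0 subr0.
have xs y t : polydisc w r y -> cnorm t < r ->
    has_sum (fun x : nat * {ffun 'I_n -> nat} => c (mjoin x.2 x.1) *
      (vmon (fun v => y 0 v - w 0 v) x.2 * t ^+ x.1)) (F (xjoin y t)).
  move=> yw tr; have xp := xP _ _ yw tr.
  have xp2 : polydisc p r2 (xjoin y t) by apply: polydisc_le xp; rewrite ge_min lexx orbT.
  apply: has_sum_ext (has_sum_mjoin (hc _ xp2)) => -[i k] /=.
  rewrite vmon_join xjoin_max p0 subr0; congr (_ * (_ * _)).
  by congr vmon; apply/funext => v; rewrite xjoin_lift wv.
have sl y i : polydisc w r y ->
    abs_summable (fun k => c (mjoin k i) * vmon (fun v => y 0 v - w 0 v) k).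
  move=> yw; have t0 : 0 < r / 2 by rewrite divr_gt0.
  have tr : cnorm (of_real (r / 2) : C) < r by rewrite cnorm_real gtr0_norm//; lra.
  have := abs_summable_slice i (has_sum_abs_summable (xs y _ yw tr)).
  move=> /(abs_summableZ (of_real (r / 2) ^+ i)^-1).
  have ti0 : of_real (r / 2) ^+ i != 0 :> C.
    by rewrite expf_neq0// -cnorm_gt0 cnorm_real gtr0_norm.
  apply: abs_summable_le => k /=; rewrite le_eqVlt; apply/orP; left; apply/eqP.
  move: (of_real (r / 2) ^+ i) ti0 => t ti0; congr cnorm.
  by rewrite [RHS]mulrC !mulrA mulfK.
pose g (y : 'rV[C]_n) (i : nat) : C :=
  famsum (fun k => c (mjoin k i) * vmon (fun v => y 0 v - w 0 v) k).
have fE y i : polydisc w r y -> f i y = g y i.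
  move=> yw; apply/eqP; rewrite -subr_eq0; apply/eqP; move: i.
  apply: (power_series_zero r0) => t tr.
  have inner i : has_sum (fun k => c (mjoin k i) * (vmon (fun v => y 0 v - w 0 v) k * t ^+ i))
      (g y i * t ^+ i).
    have hk := has_sumZ (t ^+ i) (abs_summable_has_famsum (sl y i yw)).
    by rewrite mulrC; apply: has_sum_ext hk => k; ring.
  have hs := has_sum_cvg (has_sum_fubini (xs y t yw tr) inner).
  have hF : (fun N => \sum_(i < N) f i y * t ^+ i) @ \oo --> F (xjoin y t).
    have rr1 : r <= r1 by rewrite ge_min lexx.
    have [_] := hr1 _ (polydisc_le rr1 (xP _ _ yw tr)).
    by rewrite xjoin_max col'_xjoin.
  have h0 : (fun N => \sum_(i < N) f i y * t ^+ i - \sum_(i < N) g y i * t ^+ i) @ \oo -->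
      F (xjoin y t) - F (xjoin y t) by exact: cvgB hF hs.
  rewrite subrr in h0.
  apply/cvg_cplxP => e e0; have [N0 N0P] := (cvg_cplxP _ _).1 h0 e e0.
  exists N0 => N /N0P; congr (cnorm (_ - _) < e); rewrite -sumrB.
  by apply: eq_bigr => i _; rewrite mulrBl.
pose rho := r / 2; have rho0 : 0 < rho by rewrite divr_gt0.
have rr : rho < r by rewrite /rho; lra.
have [M cM] : abs_summable (fun m => c m * vmon (fun _ : 'I_n.+1 => of_real rho) m).
  apply: (pseries_summable hc) => i; rewrite ltW//=.
  by apply: lt_le_trans rr _; rewrite ge_min lexx orbT.
exists (fun i k => c (mjoin k i)), rho, M; split=> // [i y yw|i k].
  have yw' : polydisc w r y by apply: polydisc_le yw; exact: ltW.
  by rewrite fE//; exact/abs_summable_has_famsum/sl.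
have := abs_bounded_term (mjoin k i) cM.
by rewrite cnormM cnorm_vmon vmon_join cnorm_real gtr0_norm// mulrA.
Qed.

End LastVariable.

Section IteratedDerivative.
Variables (R : realType) (n : nat).
Local Notation C := (cplx R).

Definition miM (q : nat) (j : 'I_n) : {ffun 'I_n -> nat} :=
  [ffun i => if i == j then q else 0%N].

Lemma vmon_miM (K : comPzRingType) (h : 'I_n -> K) q j : vmon h (miM q j) = h j ^+ q.
Proof.
rewrite /vmon (bigD1 j)//= big1 ?mulr1 ?ffunE ?eqxx// => v /negbTE vj.
by rewrite ffunE vj expr0.
Qed.

Lemma pseries_iter (c : {ffun 'I_n -> nat} -> C) w f r q j : 0 < r ->
  pseries c w f r ->
  iter q (fun u : 'rV[C]_n -> C => 'D_(delta_mx 0 j) u) f w = (q`!)%:R * c (miM q j).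
Proof.
move=> r0 h.
have hq : pseries (iter q (dcoef j) c) w
    (iter q (fun u : 'rV[C]_n -> C => 'D_(delta_mx 0 j) u) f) r.
  by elim: q => //= q IH; exact: pseries_derive.
have E m : iter q (dcoef j) c m * ((m j)`!)%:R = ((m j + q)`!)%:R * c (miD m (miM q j)).
  elim: q m {hq} => [|q IH] m /=.
    rewrite addn0 mulrC; congr (_ * c _).
    by apply/ffunP => i; rewrite !ffunE; case: eqP; rewrite addn0.
  rewrite {1}/dcoef mulrAC -natrM -factS mulrC.
  have := IH (miD m (miU j)); rewrite !ffunE eqxx addn1 => ->.
  rewrite addSnnS; congr (_ * c _); apply/ffunP => i; rewrite !ffunE.
  by case: eqP => _; rewrite ?addn0// -addnA add1n.
rewrite (pseries_center r0 hq); have := E (mi0 n).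
rewrite !ffunE add0n mulr1 => ->; congr (_ * c _).
by apply/ffunP => i; rewrite !ffunE add0n.
Qed.

End IteratedDerivative.

Lemma fact_exp_le m i : (i`! ^ m <= (m * i)`!)%N.
Proof.
elim: m => [|m IH]; first by rewrite expn0 fact_gt0.
rewrite expnS mulSn -(bin_fact (leq_addr (m * i) i)) addKn.
rewrite mulnC; apply: (leq_trans _ (leq_pmull _ _)); last by rewrite bin_gt0 leq_addr.
by rewrite mulnC leq_mul2l IH orbT.
Qed.

(** * Germs of solutions: uniqueness and growth *)

Section SolutionGerms.
Variables (R : realType) (d : nat) (a : 'I_d.+3 -> nat) (beta : cplx R).
Local Notation C := (cplx R).
Implicit Types (f g : fseries R d.+2) (p : 'rV[C]_d.+3).
Hypothesis a1 : a ord0 = 1%N.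
Hypothesis a_incr : forall i j : 'I_d.+3, (i < j)%N -> (a i < a j)%N.

Local Notation ybase p := (col' ord_max p : 'rV[C]_d.+2).

Lemma a_gt0 i : (0 < a i)%N.
Proof.
have [i0|i0] := posnP i; last exact: leq_ltn_trans (a_incr (i := ord0) i0).
by have -> : i = ord0; [exact: val_inj|rewrite a1].
Qed.

Lemma ywt_penult : ywt a ord_max = a (penult d). Proof. by []. Qed.

Lemma ywt_lt v : v != ord_max -> (ywt a v < a (penult d))%N.
Proof.
move=> v0; apply: a_incr; rewrite !lift_max /=.
by rewrite ltn_neqAle v0 /= -ltnS ltn_ord.
Qed.

Lemma ywt_le v : (ywt a v <= a (penult d))%N.
Proof. by have [->//|/ywt_lt/ltnW] := eqVneq v ord_max. Qed.

Lemma polydisc_nbhs (w : 'rV[C]_d.+2) r y : polydisc w r y -> nbhs y (polydisc w r).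
Proof. exact: nbhs_polydisc. Qed.

(** The neighbourhood on which an operator kills [f] depends on the operator. Only finitely many
    operators are used here, so they share a polydisc. *)
Lemma ext0_solution s p f : ext0 a beta s p f ->
  exists2 r, 0 < r & is_solution a beta (polydisc (ybase p) r) f.
Proof.
move=> [[fA _] fann].
have hE := fann _ (hyp_euler a beta).
have hT : \forall y \near ybase p, forall v i, weyl_act (weyl_of_dpoly
    (mpolyX C (mnm1 v) - mpolyX C (mnm_muln (mnm1 ord0) (a v)))) f i y = 0.
  pose G (v : 'I_d.+3) (y : 'rV[C]_d.+2) := forall i, weyl_act (weyl_of_dpoly
    (mpolyX C (mnm1 v) - mpolyX C (mnm_muln (mnm1 ord0) (a v)))) f i y = 0.
  have FF : Filter (nbhs (ybase p)) by exact: nbhs_filter.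
  apply: (@filter_forall _ _ G _ FF) => v.
  exact: fann (hyp_toric _ (toric_binomial _ a1 v)).
have [r1 r10 h1] := (nbhs_polydiscP _ _).1 fA.
have [r2 r20 h2] := (nbhs_polydiscP _ _).1 hE.
have [r3 r30 h3] := (nbhs_polydiscP _ _).1 hT.
pose r := Num.min r1 (Num.min r2 r3).
have [rr1 rr2 rr3] : [/\ r <= r1, r <= r2 & r <= r3] by rewrite !ge_min !lexx !orbT.
exists r; first by rewrite !lt_min r10 r20.
apply: solution_of_annihilated.
- by move=> y /(polydisc_le rr1)/h1.
- by move=> v y /(polydisc_le rr3)/h3 h i; exact: h.
- by move=> y /(polydisc_le rr2)/h2 h i; exact: h.
Qed.

Lemma solution_ext0 s p f r : 0 < r -> is_solution a beta (polydisc (ybase p) r) f ->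
  gevrey s p f -> ext0 a beta s p f.
Proof.
move=> r0 fS fg; split=> // P hP; apply/nbhs_polydiscP; exists r => // y yr i.
exact: (solution_annihilated (@polydisc_nbhs _ _) fS hP).
Qed.

(** The numbers [D_k] give all Taylor coefficients of the component of index 0, and this component
    gives the others by [solution_component]. *)
Lemma solution_germ_unique w r f g : 0 < r ->
  is_solution a beta (polydisc w r) f -> is_solution a beta (polydisc w r) g ->
  (forall k, taylor_fun f w k = taylor_fun g w k) ->
  exists2 s, 0 < s & forall y, polydisc w s y -> forall i, f i y = g i y.
Proof.
move=> r0 fS gS fg; have [fA _ _] := fS; have [gA _ _] := gS.
have ww := polydisc_center w r0.
have [c [c' [s0 s00 [h h']]]] := analytic_common (fA w ww 0%N) (gA w ww 0%N).
have cc : c = c'.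
  apply/funext => k.
  rewrite (solution_coef (@polydisc_nbhs _ _) fS ww s00 h).
  by rewrite (solution_coef (@polydisc_nbhs _ _) gS ww s00 h') fg.
pose s := Num.min r s0; exists s => [|y ys i]; first by rewrite lt_min r0.
have yr : polydisc w r y by apply: polydisc_le ys; rewrite ge_min lexx.
have fg0 : eq_on (polydisc w s) (fun=> f 0%N) (fun=> g 0%N).
  move=> z zs _; have zs0 : polydisc w s0 z by apply: polydisc_le zs; rewrite ge_min lexx orbT.
  by rewrite cc in h; exact: has_sum_unique (h z zs0) (h' z zs0).
have f0A : analytic_on (polydisc w s) (fun=> f 0%N).
  by move=> z zs _; apply: fA; apply: polydisc_le zs; rewrite ge_min lexx.
have i0 : (i`!)%:R != 0 :> C by rewrite pnatr_eq0 -lt0n fact_gt0.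
apply: (mulfI i0).
rewrite (solution_component (@polydisc_nbhs _ _) i fS yr).
rewrite (solution_component (@polydisc_nbhs _ _) i gS yr) /taylor_fun.
have := eq_on_iter (@polydisc_nbhs _ _) ord0 (a ord_max * i) f0A fg0 ys 0%N.
by rewrite !iter_fderiv0.
Qed.

Lemma solution_taylor_recurrence w r f : 0 < r -> is_solution a beta (polydisc w r) f ->
  recurrence (ywt a) (fun v => w 0 v) beta (taylor_fun f w).
Proof.
move=> r0 fS k; apply: (solution_recurrence a1 (@polydisc_nbhs _ _) k fS).
exact: polydisc_center.
Qed.

(** Divide [k = q + L i] by [L = a_n]. Then [D_k = i! q! i!^(s-1) c_i(q e_1)], where [c_i] obeys a
    Cauchy estimate, [q! <= L!], and [i!^s <= k!^(s / L)] because [i!^L <= (L i)! <= k!]. *)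
Lemma solution_gevrey_bound p f r s : p 0 ord_max = 0 -> 0 < r -> 1 <= s ->
  is_solution a beta (polydisc (ybase p) r) f -> gevrey s%:E p f ->
  exists K A : R, 1 <= A /\ forall k, cnorm (taylor_fun f (ybase p) k) <=
    K * (A ^+ k * (k`!)%:R `^ (s / (a ord_max)%:R)).
Proof.
move=> p0 r0 s1 fS [_ /(convergent_at_coef p0)[c [rho [M [rho0 cP cM]]]]].
set w := ybase p in fS cP *; have ww := polydisc_center w r0.
have M0 : 0 <= M.
  apply: le_trans (cM 0%N (mi0 _)); rewrite !mulr_ge0 ?cnorm_ge0 ?exprn_ge0 ?(ltW rho0)//.
  by apply: vmon_ge0 => _; exact: ltW.
pose L := a ord_max; have L0 : (0 < L)%N by exact: a_gt0.
pose g i : R := (i`!)%:R `^ (s - 1).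
have g0 i : 0 < g i by rewrite powR_gt0// ltr0n fact_gt0.
have cP' i : pseries (fun m => of_real (g i) * c i m) w (f i) rho.
  rewrite (_ : f i = fun y => of_real (g i) * (f i y / of_real (g i))).
    exact: pseriesZ (cP i).
  apply/funext => y; rewrite mulrC divfK// -cnorm_gt0 cnorm_real.
  by rewrite gtr0_norm.
have DE i q : taylor_fun f w (q + L * i) =
  (i`!)%:R * ((q`!)%:R * (of_real (g i) * c i (miM q ord0))).
  rewrite -(pseries_iter q ord0 rho0 (cP' i)) /taylor_fun iterD.
  have h : eq_on (polydisc w r) (fun=> iter (L * i) (fderiv ord0) f 0%N)
      (fun=> fun z => (i`!)%:R * f i z).
    by move=> z zr _; rewrite (solution_component (@polydisc_nbhs _ _) i fS zr).
  have [fA _ _] := fS.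
  have hA : analytic_on (polydisc w r) (fun=> iter (L * i) (fderiv ord0) f 0%N).
    by move=> z zr _; apply: (analytic_on_iter ord0 _ fA).
  have := eq_on_iter (@polydisc_nbhs _ _) ord0 q hA h ww 0%N.
  rewrite !iter_fderiv0 => ->.
  have fiA : analytic_on (polydisc w r) (fun=> f i) by move=> z zr _; exact: fA.
  have := act_scale (@polydisc_nbhs _ _) (weyl_prod (nseq q (WD R ord0))) (i`!)%:R fiA ww 0%N.
  by rewrite !weyl_act_WDn !iter_fderiv0.
pose A := Num.max 1 rho^-1; have A1 : 1 <= A by rewrite le_max lexx.
exists ((L`!)%:R * M), A; split=> // k.
pose i := (k %/ L)%N; pose q := (k %% L)%N.
have kE : k = (q + L * i)%N by rewrite addnC mulnC -divn_eq.
have qL : (q < L)%N by rewrite ltn_pmod.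
rewrite {1}kE DE !cnormM !cnorm_nat cnorm_real gtr0_norm//.
have h1 : (i`!)%:R * g i <= (k`!)%:R `^ (s / L%:R).
  have i0 : 0 < (i`!)%:R :> R by rewrite ltr0n fact_gt0.
  have -> : (i`!)%:R * g i = ((i`! ^ L)%N)%:R `^ (s / L%:R).
    rewrite natrX -powR_mulrn ?ler0n// -powRrM mulrCA mulfV ?mulr1 ?pnatr_eq0 -?lt0n//.
    rewrite /g -[X in X * _]powRr1 ?ler0n// -powRD ?(gt_eqF i0) ?implybT//.
    by rewrite addrC subrK.
  apply: ge0_ler_powR; rewrite ?nnegrE ?ler0n ?divr_ge0 ?(le_trans ler01 s1) ?ler0n//.
  rewrite ler_nat; apply: leq_trans (fact_exp_le _ _) _.
  by rewrite leq_fact // [leqRHS]kE leq_addl.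
have h2 : cnorm (c i (miM q ord0)) <= M * A ^+ k.
  have := cM i (miM q ord0).
  rewrite vmon_miM.
  rewrite -mulrA -exprD -ler_pdivlMr ?exprn_gt0// => /le_trans; apply.
  rewrite ler_wpM2l// -exprVn; apply: le_trans (_ : A ^+ (q + i) <= _).
    by rewrite lerXn2r ?nnegrE ?invr_ge0 ?(ltW rho0) ?(le_trans ler01 A1)// le_max lexx orbT.
  by rewrite ler_weXn2l// kE leq_add2l leq_pmull.
have h3 : (q`!)%:R <= (L`!)%:R :> R by rewrite ler_nat leq_fact// ltnW.
have -> : (i`!)%:R * ((q`!)%:R * (g i * cnorm (c i (miM q ord0)))) =
  ((i`!)%:R * g i) * ((q`!)%:R * cnorm (c i (miM q ord0))) by ring.
have -> : (L`!)%:R * M * (A ^+ k * (k`!)%:R `^ (s / L%:R)) =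
  (k`!)%:R `^ (s / L%:R) * ((L`!)%:R * (M * A ^+ k)) by ring.
apply: ler_pM => //; rewrite ?mulr_ge0 ?cnorm_ge0 ?ler0n ?(ltW (g0 _))//.
by apply: ler_pM; rewrite ?ler0n ?cnorm_ge0.
Qed.

Lemma solution_gevrey_vanish p f r s : p 0 ord_max = 0 -> 0 < r -> 1 <= s ->
  s < (a ord_max)%:R / (a (penult d))%:R ->
  is_solution a beta (polydisc (ybase p) r) f -> gevrey s%:E p f ->
  exists k0, forall k, (k0 <= k)%N -> taylor_fun f (ybase p) k = 0.
Proof.
move=> p0 r0 s1 sL fS fg.
have [K [A [A1 DK]]] := solution_gevrey_bound p0 r0 s1 fS fg.
have L0 : 0 < (a ord_max)%:R :> R by rewrite ltr0n a_gt0.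
have N0 : 0 < (a (penult d))%:R :> R by rewrite ltr0n a_gt0.
apply: (recurrence_gevrey (N := a (penult d)) (fun v => a_gt0 (lift ord_max v)) ywt_le _ _ A1
  (solution_taylor_recurrence r0 fS) DK).
  by rewrite divr_ge0 ?(le_trans ler01 s1)// ltW.
by rewrite mulrA ltr_pdivrMr// mul1r mulrC -ltr_pdivlMr.
Qed.

End SolutionGerms.

(** * Branches of complex powers *)

Section RealDiff.
Variable R : realType.

Lemma real_diffP (f : R -> R) (x l : R) : is_derive x 1 f l <->
  forall e : R, 0 < e -> exists2 r : R, 0 < r &
    forall h, `|h| < r -> `|f (x + h) - f x - h * l| <= e * `|h|.
Proof.
split=> [[dfx dfl] e e0|H].
  have /cvgrPdist_lt/(_ e e0) : (fun h : R => h^-1 *: (f (h *: 1 + x) - f x)) @ 0^' --> l.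
    by rewrite -dfl; exact: dfx.
  move=> /nbhs_ballP[r /= r0 hr]; exists r => // h hlt.
  have [->|h0] := eqVneq h 0; first by rewrite addr0 subrr mul0r subrr normr0 mulr0.
  have hb : ball 0 r h by rewrite -ball_normE /ball_ /= sub0r normrN.
  have := hr h hb h0; rewrite /= scaler1 [h + x]addrC distrC => {}hr.
  have -> : f (x + h) - f x - h * l = h * (h^-1 *: (f (x + h) - f x) - l).
    by rewrite mulrBr /GRing.scale /= mulrA divff// mul1r.
  by rewrite normrM mulrC ler_wpM2r// ltW.
have hl : (fun h : R => h^-1 *: (f (h *: 1 + x) - f x)) @ 0^' --> l.
  apply/cvgrPdist_lt => e e0; have e20 : 0 < e / 2 by rewrite divr_gt0.
  have [r r0 hr] := H _ e20; apply/nbhs_ballP; exists r => //= h.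
  rewrite -ball_normE /ball_ /= sub0r normrN => hlt h0.
  rewrite scaler1 [h + x]addrC distrC.
  have -> : h^-1 *: (f (x + h) - f x) - l = h^-1 * (f (x + h) - f x - h * l).
    by rewrite mulrBr mulKf.
  have h00 : 0 < `|h| by rewrite normr_gt0.
  rewrite normrM normfV mulrC ltr_pdivrMr//; apply: le_lt_trans (hr _ hlt) _.
  by rewrite ltr_pM2r//; lra.
by split; [apply/cvg_ex; exists l|exact: cvg_lim hl].
Qed.

End RealDiff.

Section ComplexDiff.
Variable R : realType.
Local Notation C := (cplx R).

Definition cdiff (f : C -> C) (z l : C) : Prop := forall e : R, 0 < e ->
  exists2 r : R, 0 < r & forall h : C, cnorm h < r ->
    cnorm (f (z + h) - f z - h * l) <= e * cnorm h.

Lemma cdiff_lipschitz f z l : cdiff f z l -> exists2 r : R, 0 < r &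
  forall h : C, cnorm h < r -> cnorm (f (z + h) - f z) <= (cnorm l + 1) * cnorm h.
Proof.
move=> /(_ 1 ltr01)[r r0 hr]; exists r => // h /hr h1.
rewrite -[X in cnorm X](subrK (h * l)); apply: le_trans (cnormD _ _) _.
by rewrite cnormM; lra.
Qed.

Lemma cdiffM f g z l m : cdiff f z l -> cdiff g z m ->
  cdiff (fun x => f x * g x) z (l * g z + f z * m).
Proof.
move=> hf hg e e0.
have [rl rl0 hl] := cdiff_lipschitz hf.
pose B := cnorm (f z) + cnorm (g z) + (cnorm l + 1) * (cnorm m + 1) + 1.
have := cnorm_ge0 (f z); have := cnorm_ge0 (g z); have := cnorm_ge0 l.
have := cnorm_ge0 m => m0 l0 g0 f0.
have B0 : 0 < B by rewrite /B; nra.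
have [rm rm0 hm] := cdiff_lipschitz hg.
have eB : 0 < e / B by rewrite divr_gt0.
have [r1 r10 h1] := hf _ eB; have [r2 r20 h2] := hg _ eB.
exists (Num.min (Num.min rl rm) (Num.min (Num.min r1 r2) (e / B))).
  by rewrite !lt_min rl0 rm0 r10 r20 eB.
move=> h; rewrite !lt_min => /andP[/andP[/hl hl' /hm hm'] /andP[/andP[/h1 h1' /h2 h2'] hB]].
have -> : f (z + h) * g (z + h) - f z * g z - h * (l * g z + f z * m) =
  (f (z + h) - f z - h * l) * g z + f z * (g (z + h) - g z - h * m) +
  (f (z + h) - f z) * (g (z + h) - g z) by ring.
apply: le_trans (cnormD _ _) _.
apply: le_trans (lerD (cnormD _ _) (lexx _)) _; rewrite !cnormM.
have H0 := cnorm_ge0 h.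
apply: le_trans (_ : e / B * cnorm h * cnorm (g z) + cnorm (f z) * (e / B * cnorm h) +
  (cnorm l + 1) * cnorm h * ((cnorm m + 1) * cnorm h) <= _).
  apply: lerD; first apply: lerD.
  - by rewrite ler_wpM2r.
  - by rewrite ler_wpM2l.
  - by apply: ler_pM => //; exact: cnorm_ge0.
apply: le_trans (_ : e / B * B * cnorm h <= _); last by rewrite divfK// gt_eqF.
have : (cnorm l + 1) * cnorm h * ((cnorm m + 1) * cnorm h) <=
   (cnorm l + 1) * (cnorm m + 1) * (e / B) * cnorm h.
  rewrite (_ : _ * ((cnorm m + 1) * cnorm h) = (cnorm l + 1) * (cnorm m + 1) * cnorm h * cnorm h);
    last by ring.
  rewrite ler_wpM2r// ler_wpM2l ?(ltW hB)// mulr_ge0//; lra.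
rewrite {5}/B; set E := e / B; move: (cnorm l) (cnorm m) (cnorm h) (cnorm (g z)) (cnorm (f z)) l0
  m0 H0 g0 f0 => L M H G F *.
have EH : 0 <= E * H by rewrite mulr_ge0// ltW.
nra.
Qed.

(** The mean value theorem is applied to the real and imaginary parts of [f] along the segment from
    [t] to [t + h]; [P] below stands for either part. *)
Lemma cdiff_zero_const (f : C -> C) (t : C) (r : R) :
  (forall h, cnorm h < r -> cdiff f (t + h) 0) ->
  forall h, cnorm h < r -> f (t + h) = f t.
Proof.
move=> hf h hr.
suff H (P : C -> R) : (forall x y, P x - P y = P (x - y)) -> (forall x, `|P x| <= cnorm x) ->
    P (f (t + h)) = P (f t).
  have E1 : complex.Re (f (t + h) : R[i]) = complex.Re (f t : R[i]).
    apply: (H (fun x => complex.Re (x : R[i]))) => [[? ?] [? ?]//|x].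
    exact: Re_le_cnorm.
  have E2 : complex.Im (f (t + h) : R[i]) = complex.Im (f t : R[i]).
    apply: (H (fun x => complex.Im (x : R[i]))) => [[? ?] [? ?]//|x].
    exact: Im_le_cnorm.
  by move: E1 E2; case: (f (t + h)) => ? ?; case: (f t) => ? ? /= -> ->.
move=> PB Pn; pose phi s := P (f (t + of_real s * h)).
have dphi (s : R) : 0 <= s <= 1 -> is_derive s 1 phi 0.
  move=> /andP[s0 s1]; apply/real_diffP => e e0.
  have sh : cnorm (of_real s * h) < r.
    rewrite cnormM cnorm_real ger0_norm//; apply: le_lt_trans hr.
    by rewrite ler_piMl// cnorm_ge0.
  have eh : 0 < e / (cnorm h + 1) by rewrite divr_gt0// ltr_wpDl ?cnorm_ge0.
  have [d d0 hd] := hf _ sh _ eh.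
  have h0 := cnorm_ge0 h.
  exists (d / (cnorm h + 1)) => [|x xd]; first by rewrite divr_gt0//; lra.
  rewrite mulr0 subr0 /phi PB; apply: le_trans (Pn _) _.
  have -> : t + of_real (s + x) * h = t + of_real s * h + of_real x * h.
    by rewrite of_realD mulrDl addrA.
  have xh : cnorm (of_real x * h) <= `|x| * (cnorm h + 1).
    by rewrite cnormM cnorm_real ler_wpM2l//; lra.
  have xhd : cnorm (of_real x * h) < d.
    by apply: le_lt_trans xh _; rewrite -ltr_pdivlMr//; lra.
  have := hd _ xhd; rewrite mulr0 subr0 => /le_trans; apply.
  by rewrite mulrAC ler_pdivrMr ?ltr_wpDl// -mulrA ler_wpM2l// ltW.
have dphi' : forall x : R, x \in `]0, 1[%R -> is_derive x 1 phi ((fun=> 0) x).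
  by move=> x; rewrite in_itv /= => /andP[x0 x1]; apply: dphi; rewrite !ltW.
have cphi : {within `[0, 1], continuous phi}.
  apply: derivable_within_continuous => x; rewrite in_itv /= => x01.
  by have [] := dphi x x01.
have [c _] := MVT ltr01 dphi' cphi.
move=> /eqP; rewrite mul0r subr_eq0 /phi /of_real mul0r addr0 mul1r => /eqP.
by [].
Qed.

Lemma cexpD (z w : C) : cexp (z + w) = cexp z * cexp w.
Proof.
case: z => a b; case: w => c e; rewrite /cexp /= expRD cosD sinD.
by apply/eqP; rewrite eq_complex /=; apply/andP; split; apply/eqP; ring.
Qed.

Lemma cexp0 : cexp 0 = 1 :> C.
Proof. by rewrite /cexp /= expR0 cos0 sin0 mulr1 mulr0. Qed.

Lemma cexpN (z : C) : cexp z * cexp (- z) = 1.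
Proof. by rewrite -cexpD subrr cexp0. Qed.

Lemma cexp_neq0 (z : C) : cexp z != 0.
Proof.
apply/eqP => z0; have := cexpN z; rewrite z0 mul0r => /eqP.
by rewrite eq_sym oner_eq0.
Qed.

Lemma cdiff_cexp0 : cdiff (@cexp R) 0 1.
Proof.
move=> e e0.
(* The errors in the real and imaginary parts will be [4 e' N] and [5 e' N], with [N] the norm of
   [h]; [e / 16] leaves room for their sum. *)
have [e' e'0 [e'1 e'8]] : exists2 e' : R, 0 < e' & e' <= 1 /\ e' <= e / 16.
  exists (Num.min 1 (e / 16)); first by rewrite lt_min ltr01 divr_gt0.
  by rewrite !ge_min !lexx orbT.
have [r1 r10 h1] := (real_diffP _ _ _).1 (@is_derive_expR R 0) _ e'0.
have [r2 r20 h2] := (real_diffP _ _ _).1 (@is_derive_cos R 0) _ e'0.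
have [r3 r30 h3] := (real_diffP _ _ _).1 (@is_derive_sin R 0) _ e'0.
exists (Num.min (Num.min r1 r2) (Num.min r3 e')).
  by rewrite !lt_min r10 r20 r30.
move=> h; rewrite !lt_min => /andP[/andP[hr1 hr2] /andP[hr3 he]].
have hRe := Re_le_cnorm h; have hIm := Im_le_cnorm h.
rewrite add0r mulr1 cexp0.
have N0 := cnorm_ge0 h.
move: (cnorm h) hr1 hr2 hr3 he hRe hIm N0 => N hr1 hr2 hr3 he.
case: h => x y hx hy N0; rewrite /= in hx hy.
have := h1 x (le_lt_trans hx hr1); have := h2 y (le_lt_trans hy hr2).
have := h3 y (le_lt_trans hy hr3); rewrite !add0r expR0 cos0 sin0 oppr0 !mulr0 !mulr1 !subr0 addr0.
move=> k3 k2 k1.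
apply: le_trans (cnorm_le_ReIm _) _.
rewrite /cexp /= !oppr0 !addr0.
have kx : `|expR x - 1| <= 2 * N.
  rewrite -(subrK x (expR x - 1)); apply: le_trans (ler_normD _ _) _; nra.
have ex : `|expR x| <= 3.
  rewrite -(subrK 1 (expR x)); apply: le_trans (ler_normD _ _) _.
  by rewrite normr1; lra.
have A1 : `|expR x * cos y - 1 - x| <= 4 * e' * N.
  have -> : expR x * cos y - 1 - x = (expR x - 1 - x) + expR x * (cos y - 1) by ring.
  apply: le_trans (ler_normD _ _) _; rewrite normrM.
  have K1 := ler_pM (normr_ge0 _) (normr_ge0 _) ex k2.
  have K2 := ler_wpM2l (ltW e'0) hx; have K3 := ler_wpM2l (ltW e'0) hy; lra.
have A2 : `|expR x * sin y - y| <= 5 * e' * N.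
  have -> : expR x * sin y - y = expR x * (sin y - y) + (expR x - 1) * y by ring.
  apply: le_trans (ler_normD _ _) _; rewrite !normrM.
  have K1 := ler_pM (normr_ge0 _) (normr_ge0 _) ex k3.
  have K2 := ler_pM (normr_ge0 _) (normr_ge0 _) kx hy.
  have K3 := ler_wpM2l (ltW e'0) hy; have K4 := ler_wpM2r N0 (ltW he); lra.
apply: le_trans (lerD A1 A2) _; have K := ler_wpM2r N0 e'8.
have K' := mulr_ge0 (ltW e0) N0; lra.
Qed.

End ComplexDiff.

Lemma leq_bin_exp n k : ('C(n, k) <= 2 ^ n)%N.
Proof.
have [kn|nk] := leqP k n; last by rewrite bin_small.
rewrite -[2%N]/(1 + 1)%N expnDn (bigD1 (Ordinal (kn : (k < n.+1)%N)))//=.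
by rewrite !exp1n !muln1 leq_addr.
Qed.

Lemma fact_add_le x y : ((x + y)`! <= 2 ^ (x + y) * (x`! * y`!))%N.
Proof.
rewrite -(bin_fact (leq_addr y x)) addKn leq_mul2r.
by rewrite leq_bin_exp orbT.
Qed.

Section FallingFactorial.
Variable R : realType.
Local Notation C := (cplx R).

Lemma ffact_CS (z : C) m : ffact_C z m.+1 = ffact_C z m * (z - m%:R).
Proof. by rewrite /ffact_C big_ord_recr. Qed.

Lemma ffact_CD (z : C) l k : ffact_C z (l + k) = ffact_C z l * ffact_C (z - l%:R) k.
Proof.
elim: k => [|k IH]; first by rewrite addn0 [ffact_C _ 0]/ffact_C big_ord0 mulr1.
by rewrite addnS !ffact_CS IH -mulrA natrD opprD addrA.
Qed.

(** As [|z - m| <= G + m], the product is at most [(G + m)! / G!], which is at most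
    [2^(G + m) m!]. *)
Lemma ffact_C_bound (z : C) G m : cnorm z <= G%:R ->
  cnorm (ffact_C z m) <= (2 ^ (G + m) * m`!)%:R.
Proof.
move=> zG.
have h : cnorm (ffact_C z m) * (G`!)%:R <= ((G + m)`!)%:R.
  elim: m => [|m IH]; first by rewrite /ffact_C big_ord0 cnorm1 mul1r addn0.
  rewrite ffact_CS cnormM addnS factS natrM mulrAC [leRHS]mulrC.
  apply: ler_pM; rewrite ?mulr_ge0 ?cnorm_ge0//.
  apply: le_trans (cnormB _ _) _; rewrite cnorm_nat -natr1 natrD.
  by rewrite -addrA; apply: lerD => //; rewrite lerDl.
have G0 : 0 < (G`!)%:R :> R by rewrite ltr0n fact_gt0.
rewrite -(ler_pM2r G0); apply: (le_trans h).
by rewrite -natrM ler_nat -mulnA [(m`! * _)%N]mulnC fact_add_le.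
Qed.

End FallingFactorial.

Section PowerBranch.
Variable R : realType.
Local Notation C := (cplx R).

Lemma cexpMn (z : C) n : cexp (n%:R * z) = cexp z ^+ n.
Proof.
by elim: n => [|n IH]; rewrite ?mul0r ?cexp0// exprS -IH -cexpD -natr1 mulrDl mul1r addrC.
Qed.

Lemma continuous_cplxP (ell : C -> C) z : {for z, continuous ell} ->
  forall e : R, 0 < e -> exists2 r : R, 0 < r &
    forall h, cnorm h < r -> cnorm (ell (z + h) - ell z) < e.
Proof.
move=> /cvgrPdist_lt H e e0; have /H : 0 < (of_real e : C) by rewrite of_real_gt0.
move=> /nbhs_cplxP[r r0 hr]; exists r => // h hlt.
have := hr (z + h); rewrite addrAC subrr add0r => /(_ hlt).
by rewrite cnormE of_real_lt cnorm_distC.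
Qed.

(** No differentiability of [ell] is assumed. The increment [delta] of [ell] satisfies
    [cexp delta = 1 + h / z] and is small by continuity, so the derivative of [cexp] at 0 forces
    [delta] to be close to [h / z]. *)
Lemma cdiff_branch (ell : C -> C) (z g : C) : log_branch z ell ->
  cdiff (fun x => cexp (g * ell x)) z (g / z * cexp (g * ell z)).
Proof.
move=> hb; have [r0 r00 hr0] := (nbhs_cplxP _ _).1 hb.
have [zc zE] : {for z, continuous ell} /\ cexp (ell z) = z.
  by apply: hr0; rewrite subrr cnorm0.
have z0 : z != 0 by rewrite -zE cexp_neq0.
move=> e e0.
pose E := cnorm (cexp (g * ell z)) + 1; pose G := cnorm g + 1.
pose Z := (cnorm z)^-1.
have nz : 0 < cnorm z by rewrite cnorm_gt0.
have Z0 : 0 < Z by rewrite invr_gt0.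
have E1 : 0 < E by rewrite ltr_wpDl ?cnorm_ge0.
have G1 : 0 < G by rewrite ltr_wpDl ?cnorm_ge0.
(* The 4 collects two errors, that of the exponential at [g * delta] and that of [delta] against
   [h / z], each with the factor 2 of [|delta| <= 2 |h / z|]. This last bound comes from [h2], used
   with precision 1/2. *)
pose e1 := e / (4 * G * Z * E).
have D0 : 0 < 4 * G * Z * E by rewrite !mulr_gt0.
have e10 : 0 < e1 by rewrite divr_gt0.
have half0 : 0 < 2^-1 :> R by rewrite invr_gt0.
have [s1 s10 h1] := @cdiff_cexp0 R _ e10.
have [s2 s20 h2] := @cdiff_cexp0 R _ half0.
pose s := Num.min (Num.min s1 s2) (s1 / G).
have s0 : 0 < s by rewrite !lt_min s10 s20 divr_gt0.
have [r1 r10 hr1] := continuous_cplxP zc s0.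
exists (Num.min r0 r1) => [|h]; first by rewrite lt_min r00.
rewrite lt_min => /andP[hh0 hh1]; have := hr1 h hh1.
set delta := ell (z + h) - ell z; rewrite !lt_min => /andP[/andP[d1 d2] d3].
have [_ zhE] : {for z + h, continuous ell} /\ cexp (ell (z + h)) = z + h.
  by apply: hr0; rewrite addrAC subrr add0r.
have expd : cexp delta = 1 + h / z.
  have : cexp delta * cexp (ell z) = z + h by rewrite -cexpD /delta subrK zhE.
  by rewrite zE => /(canRL (mulfK z0)) ->; rewrite mulrDl divff.
have dh (eps : R) : cnorm (cexp (0 + delta) - cexp 0 - delta * 1) <= eps * cnorm delta ->
    cnorm (h / z - delta) <= eps * cnorm delta.
  rewrite add0r cexp0 mulr1 expd; apply: le_trans.
  by rewrite [1 + _]addrC addrK.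
have k1 := dh _ (h1 _ d1); have k2 := dh _ (h2 _ d2).
have hz : cnorm (h / z) = cnorm h * Z by rewrite cnormM cnormV.
have dle : cnorm delta <= 2 * (cnorm h * Z).
  have : cnorm delta <= cnorm (h / z) + cnorm (h / z - delta).
    by rewrite -{1}(subKr (h / z) delta) cnormB.
  rewrite hz; lra.
have gd : cnorm (g * delta) < s1.
  rewrite cnormM; apply: le_lt_trans (_ : G * cnorm delta < _).
    by rewrite ler_wpM2r ?cnorm_ge0// lerDl.
  by rewrite mulrC -ltr_pdivlMr.
have := h1 _ gd; rewrite add0r cexp0 mulr1 => k3.
have -> : cexp (g * ell (z + h)) = cexp (g * ell z) * cexp (g * delta).
  by rewrite -cexpD -mulrDr /delta addrCA subrr addr0.
have -> : cexp (g * ell z) * cexp (g * delta) - cexp (g * ell z) - h * (g / z * cexp (g * ell z))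
  = cexp (g * ell z) * ((cexp (g * delta) - 1 - g * delta) - g * (h / z - delta)) by ring.
rewrite cnormM.
apply: le_trans (_ : E * (4 * e1 * G * Z * cnorm h) <= _); last first.
  rewrite le_eqVlt; apply/orP; left; apply/eqP.
  rewrite (_ : E * _ = e1 * (4 * G * Z * E) * cnorm h); last by ring.
  by rewrite divfK// gt_eqF.
apply: ler_pM; rewrite ?cnorm_ge0//; first by rewrite lerDl.
apply: le_trans (cnormB _ _) _; rewrite !cnormM in k3 *.
have H0 := cnorm_ge0 h; have dd0 := cnorm_ge0 delta.
have gG : cnorm g <= G by rewrite lerDl.
have m1 : cnorm g * cnorm delta <= G * (2 * (cnorm h * Z)) by apply: ler_pM; rewrite ?cnorm_ge0.
have m2 : cnorm g * cnorm (h / z - delta) <= G * (e1 * (2 * (cnorm h * Z))).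
  apply: ler_pM; rewrite ?cnorm_ge0//; apply: (le_trans k1).
  by rewrite ler_wpM2l// ltW.
have m3 := ler_wpM2l (ltW e10) m1.
rewrite (_ : 4 * e1 * G * Z * cnorm h = e1 * (G * (2 * (cnorm h * Z))) + G *
  (e1 * (2 * (cnorm h * Z)))); last by ring.
apply: lerD => //; exact: le_trans k3 m3.
Qed.

(** The sum [f] of the binomial series satisfies [z f' = g f], so [f] times the branch of [z^(-g)]
    has derivative zero. It is constant, and its value at the centre is 1. *)
Lemma branch_binomial_series (ell : C -> C) (t : C) (r0 : R) : 0 < r0 ->
  (forall z, cnorm (z - t) < r0 -> {for z, continuous ell} /\ cexp (ell z) = z) ->
  forall g h : C, cnorm h < Num.min r0 (cnorm t / 2) ->
  has_sum (fun k => ffact_C g k / (k`!)%:R * cexp ((g - k%:R) * ell t) * h ^+ k)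
    (cexp (g * ell (t + h))).
Proof.
move=> r00 hell g h0 h0r.
have [_ tE] : {for t, continuous ell} /\ cexp (ell t) = t.
  by apply: hell; rewrite subrr cnorm0.
have t0 : t != 0 by rewrite -tE cexp_neq0.
have nt : 0 < cnorm t by rewrite cnorm_gt0.
pose b k : C := ffact_C g k / (k`!)%:R * cexp ((g - k%:R) * ell t).
have f0 k : (k`!)%:R != 0 :> C by rewrite pnatr_eq0 -lt0n fact_gt0.
(* The differential equation [z f' = g f] on the level of coefficients around [t]. *)
have bS k : t * (k.+1%:R * b k.+1) = (g - k%:R) * b k.
  rewrite /b ffact_CS factS natrM invfM.
  have -> : (g - k%:R) * ell t = (g - k.+1%:R) * ell t + ell t.
    by rewrite -natr1; ring.
  rewrite cexpD tE.
  have k1 : k.+1%:R != 0 :> C by rewrite pnatr_eq0.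
  move: (cexp ((g - k.+1%:R) * ell t)) => X.
  move: (k.+1%:R : C) k1 ((k`!)%:R : C) (f0 k) => K K0 F F0.
  by field; rewrite K0 F0.
have [G gG] : exists G : nat, cnorm g <= G%:R.
  by exists (Num.truncn (cnorm g)).+1; exact/ltW/truncnS_gt.
pose E := cnorm (cexp (g * ell t)).
have expk k : cnorm (cexp ((g - k%:R) * ell t)) * cnorm t ^+ k = E.
  rewrite -cnormX -cnormM -{2}tE -cexpMn -cexpD /E; congr (cnorm (cexp _)).
  by rewrite -mulrDl subrK.
(* The factor [2^k] of [ffact_C_bound] is paid for by halving the radius [|t|]. *)
have bM k : cnorm (b k) * (cnorm t / 2) ^+ k <= 2 ^+ G * E.
  rewrite /b 2!cnormM expr_div_n mulrA -[_ * _ * cnorm t ^+ k]mulrA expk.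
  rewrite ler_pdivrMr ?exprn_gt0// [leRHS]mulrAC ler_wpM2r ?cnorm_ge0//.
  rewrite cnormV cnorm_nat ler_pdivrMr ?ltr0n ?fact_gt0//.
  apply: le_trans (ffact_C_bound k gG) _.
  by rewrite natrM natrX exprD.
have t20 : 0 < cnorm t / 2 by rewrite divr_gt0.
pose w : 'rV[C]_1 := const_mx t.
pose c (m : {ffun 'I_1 -> nat}) : C := b (m ord0).
pose f (z : 'rV[C]_1) : C := famsum (fun m => c m * vmon (fun i => z 0 i - w 0 i) m).
have hf : pseries c w f (cnorm t / 2).
  move=> z zw; apply: abs_summable_has_famsum.
  have := abs_summable_power t20 bM (zw ord0).
  apply: (abs_summable_transfer (f := fun k => [ffun=> k]) (g := fun m : {ffun 'I_1 -> nat} =>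
    m ord0)) => m _.
  split; first by apply/ffunP => i; rewrite ffunE (ord1 i).
  by rewrite /c /vmon big_ord1.
clearbody f.
have hfD z : polydisc w (cnorm t / 2) z -> exists L, z 0 ord0 * L = g * f z /\
    forall e : R, 0 < e -> exists2 s : R, 0 < s & forall x : C, cnorm x < s ->
      cnorm (f (x *: delta_mx 0 ord0 + z) - f z - x * L) <= e * cnorm x.
  move=> zw; exists ('D_(delta_mx 0 ord0) f z); split; last exact: pseries_diff hf zw.
  have h1 := pseriesX ord0 (pseries_derive ord0 t20 hf) zw.
  apply: (has_sum_unique h1); apply: has_sum_ext (pseriesZ g hf zw) => m.
  congr (_ * _); rewrite mxE /dcoef /c ffunE [miU _ _]ffunE /= addn1 bS.
  case E0 : (m ord0) => [|k]; first by rewrite subr0 addr0.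
  rewrite !ffunE E0 /= subSS subn0 addn1; ring.
have rmin : Num.min r0 (cnorm t / 2) <= cnorm t / 2 by rewrite ge_min lexx orbT.
have rmin0 : Num.min r0 (cnorm t / 2) <= r0 by rewrite ge_min lexx.
have zP h : cnorm h < Num.min r0 (cnorm t / 2) -> polydisc w (cnorm t / 2) (const_mx (t + h)).
  by move=> hr i; rewrite !mxE addrAC subrr add0r (lt_le_trans hr).
pose u (z : C) : C := f (const_mx z) * cexp (- g * ell z).
have udiff h : cnorm h < Num.min r0 (cnorm t / 2) -> cdiff u (t + h) 0.
  move=> hr; have zw := zP h hr.
  have hz : log_branch (t + h) ell.
    apply/nbhs_cplxP; exists (r0 - cnorm h) => [|z zh].
      by rewrite subr_gt0 (lt_le_trans hr).
    apply: hell; have -> : z - t = (z - (t + h)) + h by ring.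
    by apply: le_lt_trans (cnormD _ _) _; lra.
  have [_ zE] := nbhs_singleton hz.
  have z0 : t + h != 0 by rewrite -zE cexp_neq0.
  have [L [LE Ldiff]] := hfD _ zw.
  have d1 : cdiff (fun z => f (const_mx z)) (t + h) L.
    move=> e e0; have [s s0 hs] := Ldiff e e0; exists s => // x xs.
    have <- : x *: delta_mx 0 ord0 + const_mx (t + h) = const_mx (t + h + x) :> 'rV[C]_1.
      by apply/rowP => i; rewrite !mxE (ord1 i) eqxx mulr1 addrC.
    exact: hs x xs.
  have := cdiffM d1 (cdiff_branch (- g) hz).
  congr (cdiff _ _ _).
  move: LE; rewrite mxE => /(canRL (mulKf z0)) ->.
  by field.
have := cdiff_zero_const udiff h0r; rewrite /u.
have -> : f (const_mx t) = cexp (g * ell t).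
  rewrite (pseries_center t20 hf) /c ffunE /b /ffact_C big_ord0.
  by rewrite invr1 !mul1r subr0.
rewrite !mulNr cexpN => fE.
have -> : cexp (g * ell (t + h0)) = f (const_mx (t + h0)).
  by apply: (mulIf (cexp_neq0 (- (g * ell (t + h0))))); rewrite cexpN fE.
have := hf _ (zP _ h0r).
apply: (has_sum_transfer (f := fun m : {ffun 'I_1 -> nat} => m ord0) (g := fun k => [ffun=> k])).
  move=> k _; rewrite ffunE; split=> //.
  by rewrite /c /vmon big_ord1 /= !ffunE !mxE addrAC subrr add0r.
move=> m _; split; first by apply/ffunP => i; rewrite ffunE (ord1 i).
by rewrite /c /vmon big_ord1 /= !mxE addrAC subrr add0r.
Qed.

End PowerBranch.

Lemma fact_sum_le (I : Type) (r : seq I) (F : I -> nat) :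
  ((\sum_(i <- r) F i)`! <= 2 ^ (size r * \sum_(i <- r) F i) * \prod_(i <- r) (F i)`!)%N.
Proof.
elim: r => [|i r IH]; first by rewrite !big_nil.
rewrite !big_cons /=; apply: leq_trans (fact_add_le _ _) _.
rewrite mulSn [X in (_ <= X * _)%N]expnD -!mulnA leq_mul2l; apply/orP; right.
rewrite mulnCA leq_mul2l; apply/orP; right; apply: leq_trans IH _.
by rewrite leq_mul2r leq_pexp2l ?orbT// leq_mul2l leq_addl orbT.
Qed.

(** The converse of [fact_exp_le] up to a geometric factor. *)
Lemma fact_mul_le a k : ((a * k)`! <= 2 ^ (a * (a * k)) * k`! ^ a)%N.
Proof.
have := fact_sum_le (iota 0 a) (fun=> k).
by rewrite !big_const_seq !count_predT !size_iota iter_addn_0 iter_muln_1 [(k * a)%N]mulnC.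
Qed.

(** * Estimates for the Gamma-series *)

Section Estimates.
Variable R : realType.

Lemma power_over_fact_bounded (P : R) : 0 <= P ->
  exists K, 1 <= K /\ forall k, P ^+ k / (k`!)%:R <= K.
Proof.
move=> P0; pose n := (Num.truncn P).+1.
have Pn : P < n%:R by exact: truncnS_gt.
(* Up to [n] the numerators are at most this power; from [n] on the ratio [P / (k + 1)] of
   successive terms is at most 1. *)
exists ((1 + P) ^+ n); split; first by rewrite exprn_ege1// lerDl.
elim=> [|k IH]; first by rewrite expr0 fact0 divr1 exprn_ege1// lerDl.
have [kn|nk] := ltnP k n.
  rewrite ler_pdivrMr ?ltr0n ?fact_gt0//.
  apply: le_trans (_ : (1 + P) ^+ n <= _); last first.
    by rewrite ler_peMr ?exprn_ge0 ?addr_ge0// ler1n fact_gt0.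
  apply: le_trans (_ : (1 + P) ^+ k.+1 <= _).
    by rewrite lerXn2r ?nnegrE ?addr_ge0// lerDr.
  by rewrite ler_weXn2l// lerDl.
apply: le_trans IH; rewrite exprS factS natrM invfM mulrACA.
rewrite ler_piMl ?mulr_ge0 ?exprn_ge0 ?invr_ge0//.
rewrite ler_pdivrMr ?ltr0n// mul1r; apply/ltW/(lt_le_trans Pn).
by rewrite ler_nat ltnW.
Qed.

Section Factors.
Variables (N : nat) (D : R).
Hypothesis D1 : 1 <= D.

Let factor (a : nat) (x : R) (k : nat) : R :=
  D ^+ (a * k) * x ^+ (N * k) * ((a * k)`!)%:R / (k`!)%:R ^+ N.

Let fact0R k : 0 < (k`!)%:R :> R.
Proof. by rewrite ltr0n fact_gt0. Qed.

Let D0 : 0 <= D. Proof. exact: le_trans ler01 D1. Qed.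

Let factor_le a x k : 0 <= x ->
  factor a x k <= ((D * 2 ^+ a) ^+ a * x ^+ N) ^+ k * ((k`!)%:R ^+ a / (k`!)%:R ^+ N).
Proof.
move=> x0; rewrite /factor mulrA; apply: ler_wpM2r.
  by rewrite invr_ge0 exprn_ge0// ltW.
rewrite exprMn -!exprM exprMn -!exprM.
rewrite -[leRHS]mulrA [x ^+ (N * k) * _]mulrC -[leLHS]mulrA [x ^+ (N * k) * _]mulrC.
rewrite !mulrA ler_wpM2r ?exprn_ge0//.
rewrite -mulrA ler_wpM2l ?exprn_ge0// -natrX -natrX -natrM ler_nat.
exact: fact_mul_le.
Qed.

(** For [a < N] a quotient [1 / k!] remains, which beats every geometric growth; hence [x] is not
    restricted. *)
Lemma factor_small a x : 0 <= x -> (a < N)%N -> exists K, 1 <= K /\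
  forall k, D ^+ (a * k) * x ^+ (N * k) * ((a * k)`!)%:R / (k`!)%:R ^+ N <= K / 2 ^+ (N * k).
Proof.
move=> x0 aN; pose P := (D * 2 ^+ a) ^+ a * x ^+ N.
have P0 : 0 <= P by rewrite mulr_ge0 ?exprn_ge0 ?mulr_ge0.
have [|K [K1 KP]] := @power_over_fact_bounded (P * 2 ^+ N); first by rewrite mulr_ge0.
exists K; split=> // k; apply: le_trans (factor_le a k x0) _.
rewrite ler_pdivlMr ?exprn_gt0//; apply: le_trans (KP k).
rewrite -/P mulrAC [X in _ <= X / _]exprMn -exprM.
rewrite ler_wpM2l ?mulr_ge0 ?exprn_ge0//.
rewrite -(subnK (ltnW aN)) exprD invfM mulrCA mulfV ?mulr1; last first.
  by rewrite expf_neq0// gt_eqF.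
rewrite lef_pV2 ?posrE ?exprn_gt0//; apply: ler_eXnr.
  by rewrite subn_gt0.
by rewrite ler1n fact_gt0.
Qed.

(** The hypothesis on [z] cancels the factorials entirely. What remains is geometric with rate
    [P x^N], and [rho = 1 / (2 P)] makes it at most [2^(-N)]. *)
Lemma factor_critical a : exists2 rho : R, 0 < rho & forall x k (z : R), 0 <= x <= rho ->
  0 <= z -> z * (k`!)%:R ^+ a <= (k`!)%:R ^+ N -> (0 < N)%N ->
  D ^+ (a * k) * x ^+ (N * k) * ((a * k)`!)%:R / (k`!)%:R ^+ N * z <= 1 / 2 ^+ (N * k).
Proof.
pose P := (D * 2 ^+ a) ^+ a.
have P1 : 1 <= P by rewrite exprn_ege1// mulr_ege1// exprn_ege1// ler1n.
have P0 : 0 < P := lt_le_trans ltr01 P1.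
exists ((2 * P)^-1); first by rewrite invr_gt0 mulr_gt0.
move=> x k z /andP[x0 xr] z0 hz N0.
apply: le_trans (ler_wpM2r z0 (factor_le a k x0)) _.
have A0 : 0 <= P * x ^+ N by apply: mulr_ge0; [exact: ltW|exact: exprn_ge0].
have step2 : (k`!)%:R ^+ a / (k`!)%:R ^+ N * z <= 1.
  by rewrite mulrAC ler_pdivrMr ?exprn_gt0 ?fact0R// mul1r mulrC.
rewrite -/P -[X in X <= _]mulrA; apply: le_trans (_ : (P * x ^+ N) ^+ k * 1 <= _).
  by rewrite ler_wpM2l// exprn_ge0.
rewrite mulr1 mul1r exprM -exprVn lerXn2r ?nnegrE ?invr_ge0 ?exprn_ge0//.
apply: le_trans (_ : P * ((2 * P)^-1) ^+ N <= _).
  rewrite ler_wpM2l ?(ltW P0)// lerXn2r ?nnegrE// invr_ge0 mulr_ge0//.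
  exact: ltW.
rewrite exprVn exprMn invfM mulrCA ler_piMr ?invr_ge0 ?exprn_ge0//.
have PN0 : 0 < P ^+ N by exact: exprn_gt0.
by rewrite ler_pdivrMr// mul1r; exact: ler_eXnr.
Qed.

End Factors.
End Estimates.

(** * Bound on a single term of the Gamma-series *)

Section TermBound.
Variables (R : realType) (d : nat) (a : 'I_d.+3 -> nat).
Hypothesis a1 : a ord0 = 1%N.
Hypothesis a_incr : forall i j : 'I_d.+3, (i < j)%N -> (a i < a j)%N.
Local Notation C := (cplx R).
Local Notation N := (a (penult d)).

Definition awt (v : 'I_d.+1) : nat := ywt a (lift ord_max v).
Definition adeg (al : {ffun 'I_d.+1 -> nat}) : nat := (\sum_v awt v * al v)%N.
Definition xdeg (m : {ffun 'I_d.+3 -> nat}) : nat := (\sum_u a u * m u)%N.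
Definition msize n (k : {ffun 'I_n -> nat}) : nat := (\sum_v k v)%N.

Let N_gt0 : (0 < N)%N. Proof. exact: a_gt0. Qed.

Lemma awt_lt v : (awt v < N)%N.
Proof. by apply: ywt_lt => //; rewrite eq_sym neq_lift. Qed.

Lemma vmon_cst (K : comPzRingType) n (x : K) (k : {ffun 'I_n -> nat}) :
  vmon (fun=> x) k = x ^+ msize k.
Proof. by rewrite /vmon /msize; elim/big_rec2: _ => [|i y z _ ->]; rewrite ?expr0 ?exprD. Qed.

Lemma xdeg_lift m : xdeg m = (ydeg a (mbody m) + a ord_max * m ord_max)%N.
Proof.
rewrite /xdeg (bigD1_ord ord_max)//= addnC; congr (_ + _)%N.
by apply: eq_bigr => v _; rewrite ffunE.
Qed.

Lemma ydeg_lift k : ydeg a k = (adeg (mbody k) + N * k ord_max)%N.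
Proof.
rewrite /ydeg (bigD1_ord ord_max)//= addnC; congr (_ + _)%N.
by apply: eq_bigr => v _; rewrite ffunE.
Qed.

(** [2 * d + 6] is a generous common exponent: the successive splittings cost at most [d + 5] powers
    of 2 per unit of degree. *)
Lemma fact_degrees_le al m K : ((adeg al + xdeg m + K)`! <=
  2 ^ ((2 * d + 6) * (adeg al + xdeg m + K)) *
  (K`! * (\prod_v (awt v * al v)`!) * \prod_u (a u * m u)`!))%N.
Proof.
apply: leq_trans (fact_add_le _ _) _.
have h1 : ((adeg al)`! <= 2 ^ (d.+1 * adeg al) * \prod_v (awt v * al v)`!)%N.
  have := fact_sum_le (enum 'I_d.+1) (fun v => (awt v * al v)%N).
  by rewrite !big_enum size_enum_ord.
have h2 : ((xdeg m)`! <= 2 ^ (d.+3 * xdeg m) * \prod_u (a u * m u)`!)%N.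
  have := fact_sum_le (enum 'I_d.+3) (fun u => (a u * m u)%N).
  by rewrite !big_enum size_enum_ord.
set A := adeg al in h1 *; set Y := xdeg m in h2 *.
set P1 := (\prod_v _)%N in h1 *; set P2 := (\prod_u _)%N in h2 *.
apply: leq_trans (_ : 2 ^ (A + Y + K) *
  (2 ^ (A + Y) * (2 ^ (d.+1 * A) * P1 * (2 ^ (d.+3 * Y) * P2)) * K`!) <= _)%N.
  rewrite leq_mul2l; apply/orP; right; rewrite leq_mul2r; apply/orP; right.
  by apply: leq_trans (fact_add_le _ _) _; rewrite leq_mul2l leq_mul ?orbT.
rewrite (_ : (_ * _)%N = 2 ^ (A + Y + K + (A + Y) + d.+1 * A + d.+3 * Y) * (K`! * P1 * P2))%N;
  last first.
  by rewrite !expnD; ring.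
rewrite leq_mul2r leq_pexp2l ?orbT//.
rewrite (_ : ((2 * d + 6) * _ = A + Y + K + (A + Y) + d.+1 * A + d.+3 * Y +
  ((d + 3) * A + (d + 1) * Y + (2 * d + 5) * K))%N) ?leq_addr//; ring.
Qed.

Section Critical.
Variables (s B X : R).
Hypotheses (sN : (a ord_max)%:R <= N%:R * s) (B1 : 1 <= B) (X0 : 0 <= X).

(* We compare [N]-th powers.  The degree constraint gives
   [l!^N <= (N l)! <= (adeg al + xdeg m + K)!], which splits, up to a geometric
   factor, into one factor per exponent.  The factors of weight [< N] tolerate any
   [X]; the radius has to be small only for [x_(n-1)], of weight [N], and for
   [x_n], whose weight exceeds [N] but is compensated by the Gevrey factor. *)
Lemma term_bound : exists2 rho : R, 0 < rho & forall K, exists C0 : R,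
  forall j (al : {ffun 'I_d.+1 -> nat}) (m : {ffun 'I_d.+3 -> nat}) l (x : 'I_d.+3 -> R),
  (adeg al + xdeg m + K = j + N * l)%N ->
  (forall u, 0 <= x u <= if (u == ord_max) || (u == penult d) then rho else X) ->
  (l`!)%:R * B ^+ l * (X ^+ msize al / (mifact al)%:R) *
    (vmon x m / (mifact m)%:R) * (((m ord_max)`!)%:R `^ (1 - s)) <=
  C0 / 2 ^+ (msize al + msize m).
Proof.
(* [D] gathers what grows geometrically in the total degree: the powers of 2 from [fact_degrees_le],
   and [B^N], because [l] is at most that degree. *)
pose D : R := 2 ^+ (2 * d + 6) * B ^+ N.
have D1 : 1 <= D by rewrite mulr_ege1// exprn_ege1// ler1n.
have D0 : 0 <= D := le_trans ler01 D1.
have B0 : 0 <= B := le_trans ler01 B1.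
have /choice[K1 K1P] := fun v => factor_small D1 X0 (awt_lt v).
have [rho1 rho10 hrho1] := factor_critical N D1 N.
have [rho2 rho20 hrho2] := factor_critical N D1 (a ord_max).
pose rho := Num.min rho1 rho2.
exists rho; first by rewrite lt_min rho10.
have /choice[K2 K2P] : forall u : 'I_d.+3, exists K2 : R, 1 <= K2 /\ forall k (x z : R),
    0 <= x <= (if (u == ord_max) || (u == penult d) then rho else X) ->
    0 <= z -> (if u == ord_max then z * (k`!)%:R ^+ a ord_max <= (k`!)%:R ^+ N else z == 1) ->
    D ^+ (a u * k) * x ^+ (N * k) * ((a u * k)`!)%:R / (k`!)%:R ^+ N * z <= K2 / 2 ^+ (N * k).
  move=> u; have [->|un] := eqVneq u ord_max.
    exists 1; split=> // k x z /andP[x0 xr] z0 hz; apply: hrho2 => //.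
    by rewrite x0 (le_trans xr)// ge_min lexx orbT.
  have [->|up] := eqVneq u (penult d).
    exists 1; split=> // k x z /andP[x0 xr] z0 /eqP ->; apply: hrho1 => //.
      by rewrite x0 (le_trans xr)// ge_min lexx.
    by rewrite mul1r.
  have uN : (a u < N)%N.
    apply: a_incr; case: (unliftP ord_max u) un up => [v|] ->; last by rewrite eqxx.
    rewrite (inj_eq lift_inj) !lift_max => _ vn /=.
    by rewrite ltn_neqAle -val_eqE /= in vn *; rewrite vn -ltnS ltn_ord.
  have [K [K1' KP]] := factor_small D1 X0 uN.
  exists K; split=> // k x z /andP[x0 xr] z0 /eqP ->; rewrite mulr1; apply: le_trans (KP k).
  rewrite ler_wpM2r ?invr_ge0 ?exprn_ge0// ler_wpM2r// ler_wpM2l ?exprn_ge0//.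
  by rewrite lerXn2r ?nnegrE.
move=> K; pose C0 := D ^+ K * (K`!)%:R * (\prod_v K1 v) * (\prod_u K2 u).
(* The estimate is on [N]-th powers and produces the constant [C0], not [C0^N]; [C0 >= 1] gives
   [C0 <= C0^N]. *)
have C01 : 1 <= C0.
  have prod1 n (F : 'I_n -> R) : (forall i, 1 <= F i) -> 1 <= \prod_i F i.
    by move=> F1; elim/big_ind: _ => // x y; exact: mulr_ege1.
  rewrite /C0; apply: mulr_ege1; last by apply: prod1 => u; have [] := K2P u.
  apply: mulr_ege1; last by apply: prod1 => v; have [] := K1P v.
  by apply: mulr_ege1; [exact: exprn_ege1|rewrite ler1n fact_gt0].
have C00 : 0 <= C0 := le_trans ler01 C01.
exists C0 => j al m l x hS hx.
set z0 := _ `^ (1 - s); have z00 : 0 <= z0 by exact: powR_ge0.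
set M := (msize al + msize m)%N.
have x0 u : 0 <= x u by have /andP[] := hx u.
set T := (X in X <= _).
have T0 : 0 <= T.
  by rewrite /T !mulr_ge0 ?invr_ge0 ?exprn_ge0// vmon_ge0.
suff : T ^+ N <= (C0 / 2 ^+ M) ^+ N.
  by rewrite ler_pXn2r// nnegrE// divr_ge0// exprn_ge0.
apply: le_trans (_ : C0 / 2 ^+ (N * M) <= _); last first.
  rewrite expr_div_n -exprM mulnC ler_wpM2r ?invr_ge0 ?exprn_ge0//.
  exact: ler_eXnr.
pose S := (adeg al + xdeg m + K)%N.
have lS : (l <= S)%N by rewrite /S hS (leq_trans (leq_pmull l N_gt0))// leq_addl.
have hl : (l`!)%:R ^+ N * B ^+ (N * l) <= D ^+ S *
   ((K`!)%:R * (\prod_v ((awt v * al v)`!)%:R) * \prod_u ((a u * m u)`!)%:R).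
  rewrite /D exprMn -!exprM mulrAC; apply: ler_pM; rewrite ?exprn_ge0//; last first.
    by rewrite ler_weXn2l// leq_mul2l lS orbT.
  rewrite -!natrX -!natr_prod -!natrM ler_nat; apply: leq_trans (fact_exp_le _ _) _.
  apply: leq_trans (fact_degrees_le al m K); apply: leq_fact.
  by rewrite hS leq_addl.
have natprod n (F : 'I_n -> nat) : ((\prod_v F v)%N)%:R = \prod_v (F v)%:R :> R.
  by rewrite natr_prod.
have TE : T ^+ N = (l`!)%:R ^+ N * B ^+ (N * l) *
   (\prod_v (X ^+ (N * al v) / ((al v)`!)%:R ^+ N)) *
   (\prod_u (x u ^+ (N * m u) / ((m u)`!)%:R ^+ N)) * z0 ^+ N.
  rewrite /T !exprMn !exprVn -exprM [(l * N)%N]mulnC; congr (_ * _ * _ * _).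
    rewrite prodf_div; congr (_ / _).
      by rewrite -vmon_cst /vmon -prodrXl; apply: eq_bigr => v _; rewrite -exprM mulnC.
    by rewrite natprod -prodrXl.
  rewrite prodf_div; congr (_ / _).
    by rewrite /vmon -prodrXl; apply: eq_bigr => v _; rewrite -exprM mulnC.
  by rewrite natprod -prodrXl.
rewrite TE.
apply: le_trans (_ : D ^+ S * ((K`!)%:R * (\prod_v ((awt v * al v)`!)%:R) * \prod_u
  ((a u * m u)`!)%:R) *
   (\prod_v (X ^+ (N * al v) / ((al v)`!)%:R ^+ N)) *
   (\prod_u (x u ^+ (N * m u) / ((m u)`!)%:R ^+ N)) * z0 ^+ N <= _).
  have pr0 n (F : 'I_n -> R) (k : 'I_n -> nat) : (forall i, 0 <= F i) ->
      0 <= \prod_i (F i ^+ (N * k i) / ((k i)`!)%:R ^+ N).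
    by move=> F0; apply: prodr_ge0 => i _; rewrite divr_ge0 ?exprn_ge0.
  apply: ler_wpM2r; first exact: exprn_ge0.
  apply: ler_wpM2r; first exact: pr0.
  apply: ler_wpM2r; first exact: (pr0 _ (fun=> X)).
  exact: hl.
pose z u := if u == ord_max :> 'I_d.+3 then z0 ^+ N else 1.
have zE : z0 ^+ N = \prod_u z u.
  rewrite (bigD1 ord_max)//= /z eqxx big1 ?mulr1// => u /negbTE un.
  by rewrite un.
pose phi v := D ^+ (awt v * al v) * X ^+ (N * al v) * ((awt v * al v)`!)%:R / ((al v)`!)%:R ^+ N.
pose psi u := D ^+ (a u * m u) * x u ^+ (N * m u) * ((a u * m u)`!)%:R / ((m u)`!)%:R ^+ N * z u.
have -> : D ^+ S * ((K`!)%:R * (\prod_v ((awt v * al v)`!)%:R) * \prod_u ((a u * m u)`!)%:R) *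
   (\prod_v (X ^+ (N * al v) / ((al v)`!)%:R ^+ N)) *
   (\prod_u (x u ^+ (N * m u) / ((m u)`!)%:R ^+ N)) * z0 ^+ N =
   D ^+ K * (K`!)%:R * \prod_v phi v * \prod_u psi u.
  rewrite zE /S !exprD /adeg /xdeg !expr_sum.
  rewrite /phi /psi !big_split /=; ring.
rewrite /C0 -!mulrA; apply: le_trans (_ : D ^+ K * ((K`!)%:R *
  ((\prod_v (K1 v / 2 ^+ (N * al v))) * \prod_u (K2 u / 2 ^+ (N * m u)))) <= _); last first.
  rewrite le_eqVlt; apply/orP; left; apply/eqP; congr (_ * (_ * _)).
  rewrite !big_split /= !prodfV -!expr_sum mulrACA -invfM -exprD -mulrA.
  by rewrite -!big_distrr /= -mulnDr.
rewrite ler_wpM2l ?exprn_ge0// ler_wpM2l//.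
have phi0 v : 0 <= phi v by rewrite !mulr_ge0 ?invr_ge0 ?exprn_ge0.
have z0' u : 0 <= z u by rewrite /z; case: ifP => // _; exact: exprn_ge0.
have psi0 u : 0 <= psi u by rewrite !mulr_ge0 ?invr_ge0 ?exprn_ge0.
apply: ler_pM; rewrite ?prodr_ge0//.
  by apply: ler_prod => v _; rewrite phi0; have [_] := K1P v; apply.
apply: ler_prod => u _; rewrite psi0; have [_] := K2P u; apply=> //.
rewrite /z; case: eqP => [->|//].
have f1 : 1 <= ((m ord_max)`!)%:R :> R by rewrite ler1n fact_gt0.
have f0 : 0 < ((m ord_max)`!)%:R :> R := lt_le_trans ltr01 f1.
(* For [x_n] the total exponent of the factorial is [N (1 - s) + a_n], and it is at most [N] exactly
   by [sN]. *)
rewrite /z0 -[_ ^+ N]powR_mulrn ?powR_ge0// -powRrM.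
rewrite -[X in _ * X <= _]powR_mulrn ?ler0n// -[leRHS]powR_mulrn ?ler0n//.
rewrite -powRD; last by rewrite (gt_eqF f0) implybT.
by apply: ler_powR => //; rewrite mulrBl mul1r -addrA gerDl addrC subr_le0 mulrC.
Qed.

End Critical.
End TermBound.

(** * Domination of the terms by a geometric series *)

Section Domination.
Variables (R : realType) (d : nat) (a : 'I_d.+3 -> nat).
Hypothesis a1 : a ord0 = 1%N.
Hypothesis a_incr : forall i j : 'I_d.+3, (i < j)%N -> (a i < a j)%N.
Local Notation C := (cplx R).
Local Notation N := (a (penult d)).

(* Holds for all [g] when [s >= a_n / a_(n-1)], and for all [s >= 1] when [g] is a
   natural number, since then [ffact_C g l = 0] for [l > g]. *)
Definition dominated (g : C) (s : R) : Prop := forall B X : R, 1 <= B -> 0 <= X ->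
  exists2 rho : R, 0 < rho & forall K, exists C0 : R,
  forall j (al : {ffun 'I_d.+1 -> nat}) (m : {ffun 'I_d.+3 -> nat}) l (x : 'I_d.+3 -> R),
  (j < N)%N -> (adeg a al + xdeg a m + K = j + N * l)%N ->
  (forall u, 0 <= x u <= if (u == ord_max) || (u == penult d) then rho else X) ->
  cnorm (ffact_C g l) * B ^+ l * (X ^+ msize al / (mifact al)%:R) *
    (vmon x m / (mifact m)%:R) * (((m ord_max)`!)%:R `^ (1 - s)) <=
  C0 / 2 ^+ (msize al + msize m).

Lemma dominated_critical g s : (a ord_max)%:R <= N%:R * s -> dominated g s.
Proof.
move=> sN B X B1 X0; have B0 := le_trans ler01 B1.
(* The falling factorial is at most [2^G 2^l l!]; its factor [2^l] is absorbed into [B^l]. *)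
have B21 : 1 <= 2 * B by rewrite mulr_ege1// ler1n.
have [rho rho0 hrho] := term_bound a1 a_incr sN B21 X0.
have [G gG] : exists G : nat, cnorm g <= G%:R.
  by exists (Num.truncn (cnorm g)).+1; exact/ltW/truncnS_gt.
exists rho => // K; have [C0 hC] := hrho K; exists (2 ^+ G * C0).
move=> j al m l x _ hS hx; have := hC j al m l x hS hx.
have x0 u : 0 <= x u by have /andP[] := hx u.
set Y := X ^+ _ / _; set V := vmon x m / _; set z := _ `^ _ => h.
have Y0 : 0 <= Y by rewrite divr_ge0// exprn_ge0.
have V0 : 0 <= V by rewrite divr_ge0// vmon_ge0.
have z0 : 0 <= z by exact: powR_ge0.
rewrite -[leRHS]mulrA; apply: le_trans (ler_wpM2l (exprn_ge0 G (ler0n R 2)) h).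
clearbody Y V z; rewrite !mulrA; do 3! apply: ler_wpM2r => //.
apply: le_trans (ler_wpM2r (exprn_ge0 l B0) (ffact_C_bound l gG)) _.
by rewrite natrM natrX exprD exprMn -!mulrA ler_wpM2l ?exprn_ge0// mulrCA.
Qed.

Lemma leq_msize_adeg al : (msize al <= adeg a al)%N.
Proof. by apply: leq_sum => v _; rewrite leq_pmull// a_gt0. Qed.

Lemma leq_msize_xdeg m : (msize m <= xdeg a m)%N.
Proof. by apply: leq_sum => v _; rewrite leq_pmull// a_gt0. Qed.

(** Terms with [l > l0] vanish, and the constraint bounds the degree of the others by [S0]. Every
    factor is then bounded separately, [X1] serving for both the radius 1 and [X]. *)
Lemma dominated_polynomial l0 s : 1 <= s -> dominated l0%:R s.
Proof.
move=> s1 B X B1 X0; have B0 := le_trans ler01 B1.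
exists 1 => // K; pose S0 := (N + N * l0)%N; pose X1 : R := 1 + X.
have X11 : 1 <= X1 by rewrite lerDl.
have X10 : 0 <= X1 := le_trans ler01 X11.
pose F : R := (2 ^ (l0 + l0) * l0`!)%:R.
exists (F * B ^+ l0 * X1 ^+ S0 * X1 ^+ S0 * 2 ^+ S0).
move=> j al m l x jN hS hx.
have x0 u : 0 <= x u by have /andP[] := hx u.
have C00 : 0 <= F * B ^+ l0 * X1 ^+ S0 * X1 ^+ S0 * 2 ^+ S0.
  by rewrite !mulr_ge0 ?exprn_ge0.
have [ll0|ll0] := ltnP l0 l.
  rewrite (_ : ffact_C _ l = 0); last first.
    by rewrite /ffact_C (bigD1 (Ordinal ll0))//= subrr mul0r.
  by rewrite cnorm0 !mul0r divr_ge0 ?exprn_ge0.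
have SS0 : (adeg a al + xdeg a m <= S0)%N.
  apply: leq_trans (leq_addr K _) _; rewrite hS; apply: leq_add; first exact: ltnW.
  by rewrite leq_mul2l ll0 orbT.
have alS : (msize al <= S0)%N.
  by apply: leq_trans (leq_msize_adeg al) (leq_trans (leq_addr _ _) SS0).
have mS : (msize m <= S0)%N.
  by apply: leq_trans (leq_msize_xdeg m) (leq_trans (leq_addl _ _) SS0).
have amS : (msize al + msize m <= S0)%N.
  by apply: leq_trans SS0; rewrite leq_add ?leq_msize_adeg ?leq_msize_xdeg.
have divfact n (k : {ffun 'I_n -> nat}) (A A' : R) : 0 <= A -> A <= A' ->
    0 <= A / (mifact k)%:R <= A'.
  move=> A0 AA; rewrite divr_ge0//=; apply: le_trans AA.
  by rewrite ler_pdivrMr ?ltr0n ?mifact_gt0// ler_peMr// ler1n mifact_gt0.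
have e1 : cnorm (ffact_C (l0%:R : C) l) <= F.
  have h : cnorm (l0%:R : C) <= l0%:R by rewrite cnorm_nat.
  apply: le_trans (ffact_C_bound l h) _; rewrite ler_nat leq_mul//.
    by rewrite leq_pexp2l// leq_add2l.
  exact: leq_fact.
have e2 : B ^+ l <= B ^+ l0 by rewrite ler_weXn2l.
have /andP[e30 e3] : 0 <= X ^+ msize al / (mifact al)%:R <= X1 ^+ S0.
  apply: divfact; first exact: exprn_ge0.
  apply: le_trans (_ : X1 ^+ msize al <= _); last by rewrite ler_weXn2l.
  by rewrite lerXn2r ?nnegrE// lerDr.
have /andP[e40 e4] : 0 <= vmon x m / (mifact m)%:R <= X1 ^+ S0.
  apply: divfact; first exact: vmon_ge0.
  apply: le_trans (_ : vmon (fun=> X1) m <= _).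
    apply: vmon_le => u; have /andP[-> xu] /= := hx u; apply: (le_trans xu).
    by case: ifP => _; rewrite /X1 ?lerDl// lerDr.
  by rewrite vmon_cst ler_weXn2l.
have e5 : ((m ord_max)`!)%:R `^ (1 - s) <= 1 :> R.
  rewrite -[leRHS](powRr0 ((m ord_max)`!)%:R); apply: ler_powR.
    by rewrite ler1n fact_gt0.
  by rewrite subr_le0.
have e6 : 2 ^+ (msize al + msize m) <= 2 ^+ S0 :> R by rewrite ler_weXn2l// ler1n.
rewrite ler_pdivlMr ?exprn_gt0//.
move: e1 e2 e30 e3 e40 e4 e5 e6 (cnorm_ge0 (ffact_C (l0%:R : C) l)) (exprn_ge0 l B0)
  (powR_ge0 ((m ord_max)`!)%:R (1 - s)) (exprn_ge0 (msize al + msize m) (ler0n R 2)).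
move: (cnorm _) (B ^+ l) (X ^+ _ / _) (vmon x m / _) (_ `^ _) (2 ^+ (_ + _)) => p1 p2 p3 p4 p5 p6.
move=> e1 e2 e30 e3 e40 e4 e5 e6 p10 p20 p50 p60.
rewrite -[in leRHS](mulr1 (F * _ * _ * _)).
apply: ler_pM => //; rewrite ?mulr_ge0//.
apply: ler_pM => //; rewrite ?mulr_ge0//.
apply: ler_pM => //; rewrite ?mulr_ge0//.
apply: ler_pM => //; rewrite ?mulr_ge0//.
exact: ler_pM.
Qed.

End Domination.

Section AtMostOne.
Variable R : realType.

Lemma abs_bounded_at_most_one (I : choiceType) (u : I -> cplx R) (M : R) : 0 <= M ->
  (forall i, cnorm (u i) <= M) -> (forall i i', u i != 0 -> u i' != 0 -> i = i') ->
  abs_bounded u M.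
Proof.
move=> M0 uM u1 A.
have [/existsP[[i iA] /= ui]|] := boolP [exists i : A, u (val i) != 0].
  rewrite (big_fsetD1 i)//= big_seq big1 ?addr0// => i'.
  rewrite !inE => /andP[ii' _]; apply/eqP; rewrite cnorm_eq0; apply/negPn/negP => /u1.
  by move=> /(_ _ ui) E; rewrite E eqxx in ii'.
rewrite negb_exists => /forallP u0; rewrite big_seq big1// => i iA.
by apply/eqP; rewrite cnorm_eq0; have := u0 [` iA]%fset; rewrite /= negbK.
Qed.

Lemma abs_bounded_half n : abs_bounded
  (fun k : {ffun 'I_n -> nat} => of_real (2^-1 ^+ msize k) : cplx R) (2 ^+ n).
Proof.
have h : 0 <= (2^-1 : R) < 1 by rewrite invr_ge0 ler0n invf_lt1// ltr1n.
have := abs_bounded_prod (fun v : 'I_n => abs_bounded_geometric h).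
rewrite prodr_const card_ord (_ : (1 - 2^-1)^-1 = 2); last first.
  by rewrite -[RHS]invrK; congr _^-1; rewrite {1}(splitr 1) mul1r addrK.
apply: abs_bounded_le => k; rewrite le_eqVlt; apply/orP; left; apply/eqP.
congr cnorm; rewrite -vmon_cst /vmon.
by elim/big_ind2: _ => // x y x' y'; rewrite of_realM => -> ->.
Qed.

End AtMostOne.

(** * The Gamma-series as solutions *)

Section Psi.
Variables (R : realType) (d : nat) (a : 'I_d.+3 -> nat).
Hypothesis a1 : a ord0 = 1%N.
Hypothesis a_incr : forall i j : 'I_d.+3, (i < j)%N -> (a i < a j)%N.
Local Notation C := (cplx R).
Local Notation N := (a (penult d)).
Variables (j : nat) (g : C) (ell : C -> C).
Implicit Types (y : 'rV[C]_d.+2) (h : 'I_d.+3 -> C) (K : nat).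
Hypothesis jN : (j < N)%N.

Definition gscale (s : R) (i : nat) : C := of_real ((i`!)%:R `^ (1 - s)).

(* [j! * psi K y] is the value at [(y, 0)] of [d_1^K phi_(v^j)], with
   [g = (beta - j) / a_(n-1)]; [al] collects the exponents of [x_1, .., x_(n-2)],
   and [l] is [m_(n-1)]. *)
Definition psi_term (K : nat) (y : 'rV[C]_d.+2) (q : {ffun 'I_d.+1 -> nat} * nat) : C :=
  if (adeg a q.1 + K == j + N * q.2)%N
  then ffact_C g q.2 * cexp ((g - q.2%:R) * ell (y 0 ord_max)) *
       (vmon (fun v => y 0 (lift ord_max v)) q.1 / (mifact q.1)%:R)
  else 0.

Definition psi (K : nat) (y : 'rV[C]_d.+2) : C := famsum (psi_term K y).

(* The joint family whose sum is the Gevrey-rescaled Taylor expansion around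
   [(y, 0)], with increment [h], of [d_1^K phi_(v^j) / j!]. *)
Definition psi_joint (s : R) (K : nat) (y : 'rV[C]_d.+2) (h : 'I_d.+3 -> C)
    (x : {ffun 'I_d.+3 -> nat} * ({ffun 'I_d.+1 -> nat} * nat)) : C :=
  psi_term (K + xdeg a x.1) y x.2 *
    (vmon h x.1 / (mifact x.1)%:R * gscale s (x.1 ord_max)).

Lemma cexp_branch_bound (t : C) l : t != 0 -> cexp (ell t) = t ->
  cnorm (cexp ((g - l%:R) * ell t)) <=
  cnorm (cexp (g * ell t)) * (1 + (cnorm t)^-1) ^+ l.
Proof.
move=> t0 tE; have nt : 0 < cnorm t by rewrite cnorm_gt0.
have <- : cnorm (cexp ((g - l%:R) * ell t)) * cnorm t ^+ l = cnorm (cexp (g * ell t)).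
  rewrite -cnormX -cnormM -{2}tE -cexpMn -cexpD; congr (cnorm (cexp _)).
  by rewrite -mulrDl subrK.
rewrite -mulrA ler_peMr ?cnorm_ge0// -exprMn exprn_ege1//.
by rewrite mulrDr mulr1 mulfV ?gt_eqF// lerDr ltW.
Qed.

(** The monomials in [y] and in the increment are dominated together by [2^-(|m| + |al|)], while
    [B^l] accounts for the negative powers of [x_(n-1)]. *)
Lemma psi_joint_summable s y : dominated a g s ->
  y 0 ord_max != 0 -> cexp (ell (y 0 ord_max)) = y 0 ord_max ->
  forall X : R, 0 <= X -> exists2 rho : R, 0 < rho & forall K h,
    (forall u, cnorm (h u) <= if (u == ord_max) || (u == penult d) then rho else X) ->
    abs_summable (psi_joint s K y h).
Proof.
move=> dom y0 yE X X0; set t := y 0 ord_max in y0 yE.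
pose B : R := 1 + (cnorm t)^-1.
have B1 : 1 <= B by rewrite lerDl invr_ge0 cnorm_ge0.
have B0 : 0 <= B := le_trans ler01 B1.
(* The exponents [al] are evaluated at [y] and the exponents [m] at the increment; [X'] bounds
   both. *)
pose X' := X + \sum_(v < d.+1) cnorm (y 0 (lift ord_max v)).
have S0 : 0 <= \sum_(v < d.+1) cnorm (y 0 (lift ord_max v)).
  by apply: sumr_ge0 => v _; exact: cnorm_ge0.
have X'0 : 0 <= X' by rewrite addr_ge0.
have [rho rho0 hrho] := dom B X' B1 X'0.
exists rho => // K h hX; have [C0 hC] := hrho K.
pose E := cnorm (cexp (g * ell t)).
have E0 : 0 <= E := cnorm_ge0 _.
pose c (m : {ffun 'I_d.+3 -> nat}) (al : {ffun 'I_d.+1 -> nat}) : R :=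
  E * Num.max C0 0 * (2^-1 ^+ msize m * 2^-1 ^+ msize al).
have half0 k : 0 <= (2^-1 : R) ^+ k by rewrite exprn_ge0// invr_ge0.
have c0 m al : 0 <= c m al by rewrite /c !mulr_ge0// le_max lexx orbT.
have term_le m al l : cnorm (psi_joint s K y h (m, (al, l))) <= c m al.
  rewrite /psi_joint /psi_term /=; case: eqP => [hS|_]; last by rewrite mul0r cnorm0.
  have hS' : (adeg a al + xdeg a m + K = j + N * l)%N by rewrite -hS -addnA [(_ + K)%N]addnC.
  have hx u : 0 <= cnorm (h u) <= if (u == ord_max) || (u == penult d) then rho else X'.
    rewrite cnorm_ge0 (le_trans (hX u))//; case: ifP => // _.
    by rewrite lerDl.
  have := hC j al m l (fun u => cnorm (h u)) jN hS' hx.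
  rewrite !cnormM !cnormV !cnorm_nat !cnorm_vmon cnorm_real ger0_norm ?powR_ge0//.
  set z := _ `^ _; have z0 : 0 <= z by exact: powR_ge0.
  set V := vmon _ m / _; have V0 : 0 <= V by rewrite divr_ge0// vmon_ge0// => u; exact: cnorm_ge0.
  clearbody V z => hh.
  have Y1 : vmon (fun v => cnorm (y 0 (lift ord_max v))) al / (mifact al)%:R <= X' ^+ msize al /
    (mifact al)%:R.
    rewrite ler_wpM2r ?invr_ge0// -vmon_cst; apply: vmon_le => v; rewrite cnorm_ge0 /=.
    rewrite /X' (bigD1 v)//= addrCA lerDl addr_ge0// sumr_ge0// => *; exact: cnorm_ge0.
  have Y0 : 0 <= vmon (fun v => cnorm (y 0 (lift ord_max v))) al / (mifact al)%:R.
    by rewrite divr_ge0// vmon_ge0// => u; exact: cnorm_ge0.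
  have EB := cexp_branch_bound l y0 yE.
  apply: le_trans (_ : E * (cnorm (ffact_C g l) * B ^+ l * (X' ^+ msize al / (mifact al)%:R) * V *
    z) <= _).
    rewrite [X in _ <= X](_ : _ = cnorm (ffact_C g l) * (E * B ^+ l) *
      (X' ^+ msize al / (mifact al)%:R) * (V * z)); last by ring.
    apply: ler_wpM2r; first exact: mulr_ge0.
    by apply: ler_pM => //; rewrite ?mulr_ge0 ?cnorm_ge0// ler_wpM2l ?cnorm_ge0.
  rewrite /c -[leRHS]mulrA ler_wpM2l//; apply: le_trans hh _.
  rewrite exprD invfM !exprVn [_^-1 * _]mulrC ler_wpM2r ?mulr_ge0 ?invr_ge0 ?exprn_ge0//.
  by rewrite le_max lexx.
(* Reassociated so that [l] is innermost: for given [m] and [al] the degree constraint admits at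
   most one [l], because [N > 0]. *)
pose u (x : ({ffun 'I_d.+3 -> nat} * {ffun 'I_d.+1 -> nat}) * nat) : C :=
  psi_joint s K y h (x.1.1, (x.1.2, x.2)).
have us : abs_summable u.
  exists (E * Num.max C0 0 * (2 ^+ d.+3 * 2 ^+ d.+1)).
  apply: (abs_bounded_pair (m := fun x => c x.1 x.2)) => [[m al]|A].
    apply: abs_bounded_at_most_one => //= [l|l l']; first exact: term_le.
    rewrite /u /psi_joint /psi_term /=.
    case: (_ =P (j + N * l)%N) => [h1|_]; last by rewrite mul0r eqxx.
    case: (_ =P (j + N * l')%N) => [h2|_]; last by rewrite mul0r eqxx.
    move=> _ _; apply/eqP; move/eqP: h2; rewrite h1 eqn_add2l eqn_pmul2l//.
    exact: a_gt0.
  rewrite -mulr_sumr ler_wpM2l ?mulr_ge0 ?le_max ?lexx ?orbT//.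
  have hb : abs_bounded (fun x : {ffun 'I_d.+3 -> nat} * {ffun 'I_d.+1 -> nat} =>
      of_real (2^-1 ^+ msize x.1) * of_real (2^-1 ^+ msize x.2) : C) (2 ^+ d.+3 * 2 ^+ d.+1).
    apply: (abs_bounded_pair (m := fun m => cnorm (of_real (2^-1 ^+ msize m) : C) * 2 ^+ d.+1)) =>
      [m|A'].
      exact: (abs_boundedZ (of_real (2^-1 ^+ msize m)) (@abs_bounded_half R d.+1)).
    by rewrite -mulr_suml ler_wpM2r ?exprn_ge0//; exact: abs_bounded_half.
  apply: le_trans (hb A); apply: ler_sum => x _.
  by rewrite cnormM !cnorm_real !ger0_norm.
by apply: (abs_summable_transfer (f := fun x => (x.1.1, (x.1.2, x.2)))
  (g := fun x => ((x.1, x.2.1), x.2.2)) _ us) => -[m [al l]].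
Qed.

Lemma xdeg0 : xdeg a (mi0 _) = 0%N.
Proof. by rewrite /xdeg big1// => u _; rewrite ffunE muln0. Qed.

Lemma gscale0 s : gscale s 0 = 1.
Proof. by rewrite /gscale powR1. Qed.

Lemma psi_term_summable s K y : dominated a g s ->
  y 0 ord_max != 0 -> cexp (ell (y 0 ord_max)) = y 0 ord_max ->
  abs_summable (psi_term K y).
Proof.
move=> dom y0 yE; have [rho rho0 hrho] := psi_joint_summable dom y0 yE ler01.
have := hrho K (fun=> 0); rewrite cnorm0 => h.
have {}h : abs_summable (psi_joint s K y (fun=> 0)).
  by apply: h => u; case: ifP => // _; exact: ltW.
apply: abs_summable_le (abs_summable_slice (mi0 _) h) => q.
rewrite /psi_joint /= xdeg0 addn0 vmon0 mifact0 ffunE gscale0.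
by rewrite invr1 !mulr1.
Qed.

Lemma has_sum_psi s K y : dominated a g s ->
  y 0 ord_max != 0 -> cexp (ell (y 0 ord_max)) = y 0 ord_max ->
  has_sum (psi_term K y) (psi K y).
Proof. by move=> dom y0 yE; apply/abs_summable_has_famsum/(psi_term_summable _ dom). Qed.

Lemma mifact_join n (k : {ffun 'I_n -> nat}) i : mifact (mjoin k i) = (mifact k * i`!)%N.
Proof.
rewrite /mifact (bigD1_ord ord_max)//= mjoin_max mulnC; congr (_ * _)%N.
by apply: eq_bigr => v _; rewrite mjoin_lift.
Qed.

Lemma xdeg_join k i : xdeg a (mjoin k i) = (ydeg a k + a ord_max * i)%N.
Proof. by rewrite xdeg_lift mbody_join mjoin_max. Qed.

Lemma adegB (be k : {ffun 'I_d.+1 -> nat}) : (forall v, k v <= be v)%N ->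
  (adeg a (miB be k) + adeg a k = adeg a be)%N.
Proof.
move=> kb; rewrite /adeg -big_split; apply: eq_bigr => v _ /=.
by rewrite ffunE -mulnDr subnK.
Qed.

End Psi.

(** * Taylor expansion and Euler equation of the Gamma-series *)

Section PsiTaylor.
Variables (R : realType) (d : nat) (a : 'I_d.+3 -> nat).
Hypothesis a1 : a ord0 = 1%N.
Hypothesis a_incr : forall i j : 'I_d.+3, (i < j)%N -> (a i < a j)%N.
Local Notation C := (cplx R).
Local Notation N := (a (penult d)).
Variables (j : nat) (g : C) (ell : C -> C).
Implicit Types (y : 'rV[C]_d.+2) (K : nat).
Hypothesis jN : (j < N)%N.
Local Notation psi_term := (psi_term a j g ell).
Local Notation psi := (psi a j g ell).

Let shifted_power_sum (u h : C) (m : nat) :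
  has_sum (fun k => if (k <= m)%N then u ^+ (m - k) / ((m - k)`!)%:R * (h ^+ k / (k`!)%:R) else 0)
    ((u + h) ^+ m / (m`!)%:R).
Proof.
have := @has_sum_nat_lt R (fun k => if (k <= m)%N then u ^+ (m - k) / ((m - k)`!)%:R *
  (h ^+ k / (k`!)%:R) else 0) m.+1.
rewrite exprDn mulr_suml (_ : \sum_(k < _) _ =
  \sum_(i < m.+1) u ^+ (m - i) * h ^+ i *+ 'C(m, i) / (m`!)%:R); last first.
  apply: eq_bigr => i _; rewrite -ltnS ltn_ord.
  have im : (i <= m)%N by rewrite -ltnS.
  rewrite -(bin_fact im) !natrM -[_ *+ 'C(m, i)]mulr_natr.
  have b0 : ('C(m, i))%:R != 0 :> C by rewrite pnatr_eq0 -lt0n bin_gt0.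
  have f1 : (i`!)%:R != 0 :> C by rewrite pnatr_eq0 -lt0n fact_gt0.
  have f2 : ((m - i)`!)%:R != 0 :> C by rewrite pnatr_eq0 -lt0n fact_gt0.
  move: (('C(m, i))%:R : C) ((i`!)%:R : C) (((m - i)`!)%:R : C) b0 f1 f2 => b f1 f2 b0 f10 f20.
  by field; rewrite b0 f10 f20.
by apply=> k; rewrite ltnNge => /negbTE ->.
Qed.

Let taylor_term K y (h : 'I_d.+2 -> C)
    (x : {ffun 'I_d.+2 -> nat} * ({ffun 'I_d.+1 -> nat} * nat)) : C :=
  psi_term (K + ydeg a x.1) y x.2 * (vmon h x.1 / (mifact x.1)%:R).

(** [taylor_term] indexed by its contribution at the new point: [(be, l)] is the term of
    [psi_term K y'] to which it belongs, and [k] the Taylor index, so that the term at [y] has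
    exponents [be - k] and [m_(n-1) = l + k_(n-1)]. *)
Let regrouped_term K y h
    (x : ({ffun 'I_d.+1 -> nat} * nat) * {ffun 'I_d.+2 -> nat}) : C :=
  if [forall v, mbody x.2 v <= x.1.1 v]%N
  then taylor_term K y h (x.2, (miB x.1.1 (mbody x.2), (x.1.2 + x.2 ord_max)%N))
  else 0.

Let shifted_constraint K (be : {ffun 'I_d.+1 -> nat}) l (k : {ffun 'I_d.+2 -> nat}) :
  (forall v, mbody k v <= be v)%N ->
  (adeg a (miB be (mbody k)) + (K + ydeg a k) == j + N * (l + k ord_max))%N =
  (adeg a be + K == j + N * l)%N.
Proof.
move=> kb; rewrite -(adegB a kb) ydeg_lift mulnDr.
rewrite -[in RHS](eqn_add2r (N * k ord_max)); congr (_ == _); ring.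
Qed.

(** For fixed [(be, l)] the sum over [k] factors into one sum per variable: a finite binomial
    expansion for each of [x_1, .., x_(n-2)] and the binomial series of the branch for [x_(n-1)]. *)
Let regrouped_sum K y y' (r0 : R) : 0 < r0 ->
  (forall z, cnorm (z - y 0 ord_max) < r0 -> {for z, continuous ell} /\ cexp (ell z) = z) ->
  cnorm (y' 0 ord_max - y 0 ord_max) < Num.min r0 (cnorm (y 0 ord_max) / 2) ->
  forall q, has_sum (fun k => regrouped_term K y (fun v => y' 0 v - y 0 v) (q, k))
    (psi_term K y' q).
Proof.
move=> r00 hell hlt [be l]; rewrite /psi_term /=.
set t := y 0 ord_max in hell hlt *; pose h (v : 'I_d.+2) := y' 0 v - y 0 v.
have [hS|hS] := eqVneq (adeg a be + K)%N (j + N * l)%N; last first.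
  apply: (@has_sum_ext R _ (fun=> 0)) => [k|]; last exact: has_sum0.
  rewrite /regrouped_term /=; case: ifP => // /forallP kb.
  by rewrite /taylor_term /psi_term /= (shifted_constraint _ _ kb) (negbTE hS) mul0r.
pose A (v : 'I_d.+1) k : C := if (k <= be v)%N then
  y 0 (lift ord_max v) ^+ (be v - k) / ((be v - k)`!)%:R * (h (lift ord_max v) ^+ k / (k`!)%:R)
    else 0.
pose Bs k : C := ffact_C g l * (ffact_C (g - l%:R) k / (k`!)%:R *
  cexp ((g - l%:R - k%:R) * ell t) * h ord_max ^+ k).
pose T (v : 'I_d.+2) k : C := if unlift ord_max v is Some v' then A v' k else Bs k.
pose S (v : 'I_d.+2) : C := if unlift ord_max v is Some v'
  then y' 0 (lift ord_max v') ^+ be v' / ((be v')`!)%:R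
  else ffact_C g l * cexp ((g - l%:R) * ell (y' 0 ord_max)).
have TS v : has_sum (T v) (S v).
  rewrite /T /S; case: (unliftP ord_max v) => [v'|] _.
    have := shifted_power_sum (y 0 (lift ord_max v')) (h (lift ord_max v')) (be v').
    have -> : y 0 (lift ord_max v') + h (lift ord_max v') = y' 0 (lift ord_max v').
      by rewrite /h addrC subrK.
    by [].
  apply: has_sumZ; have := branch_binomial_series r00 hell (g - l%:R) hlt.
  have -> : t + (y' 0 ord_max - t) = y' 0 ord_max by rewrite addrC subrK.
  by [].
have := has_sum_prod TS.
have -> : \prod_(v < d.+2) S v = ffact_C g l * cexp ((g - l%:R) * ell (y' 0 ord_max)) *
    (vmon (fun v => y' 0 (lift ord_max v)) be / (mifact be)%:R).
  rewrite (bigD1_ord ord_max)//= {1}/S unlift_none; congr (_ * _).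
  rewrite /vmon /mifact natr_prod -prodf_div; apply: eq_bigr => v _.
  by rewrite /S liftK.
apply: has_sum_ext => k; rewrite /regrouped_term /=.
rewrite (bigD1_ord ord_max)//= {1}/T unlift_none.
have -> : \prod_(v < d.+1) T (lift ord_max v) (k (lift ord_max v)) = \prod_(v < d.+1) A v
  (mbody k v).
  by apply: eq_bigr => v _; rewrite /T liftK ffunE.
case: forallP => [kb|nkb]; last first.
  have [v vk] : exists v, ~~ (mbody k v <= be v)%N.
    by apply/existsP; rewrite -negb_forall; apply/negP => /forallP.
  by rewrite (bigD1 v)//= {1}/A (negbTE vk) mul0r mulr0.
rewrite /taylor_term /psi_term /= (shifted_constraint _ _ kb) hS eqxx.
have -> : \prod_(v < d.+1) A v (mbody k v) =
    vmon (fun v => y 0 (lift ord_max v)) (miB be (mbody k)) / (mifact (miB be (mbody k)))%:R *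
    (vmon (fun v => h (lift ord_max v)) (mbody k) / (mifact (mbody k))%:R).
  rewrite /vmon /mifact !natr_prod -!prodf_div -big_split; apply: eq_bigr => v _.
  by rewrite /A kb [miB _ _ v]ffunE.
have vE : vmon h k = vmon (fun v => h (lift ord_max v)) (mbody k) * h ord_max ^+ k ord_max.
  by rewrite -{1}(mjoin_body k) vmon_join.
have fE : mifact k = (mifact (mbody k) * (k ord_max)`!)%N.
  by rewrite -{1}(mjoin_body k) mifact_join.
rewrite -/h vE fE natrM /Bs ffact_CD.
rewrite (_ : g - l%:R - (k ord_max)%:R = g - (l + k ord_max)%:R); last first.
  by rewrite natrD opprD addrA.
rewrite invfM; ring.
Qed.

(* Only the increment of [x_(n-1)] must be small. *)
Lemma psi_taylor s y : dominated a g s -> y 0 ord_max != 0 -> log_branch (y 0 ord_max) ell ->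
  forall X : R, 0 <= X -> exists2 rho : R, 0 < rho & forall K y',
    (forall v, v != ord_max -> cnorm (y' 0 v - y 0 v) <= X) ->
    cnorm (y' 0 ord_max - y 0 ord_max) < rho ->
    has_sum (fun k => psi (K + ydeg a k) y *
      (vmon (fun v => y' 0 v - y 0 v) k / (mifact k)%:R)) (psi K y').
Proof.
move=> dom y0 /nbhs_cplxP[r0 r00 hell] X X0.
have [_ yE] : {for y 0 ord_max, continuous ell} /\ cexp (ell (y 0 ord_max)) = y 0 ord_max.
  by apply: hell; rewrite subrr cnorm0.
have [rho rho0 hrho] := psi_joint_summable a1 a_incr jN dom y0 yE X0.
exists (Num.min rho (Num.min r0 (cnorm (y 0 ord_max) / 2))).
  by rewrite !lt_min rho0 r00 divr_gt0// cnorm_gt0.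
move=> K y' hX; rewrite lt_min => /andP[hlast hmin].
pose h (v : 'I_d.+2) := y' 0 v - y 0 v.
pose hx (u : 'I_d.+3) : C := if unlift ord_max u is Some v then h v else 0.
have tsum : abs_summable (taylor_term K y h).
  (* The increment is extended by 0 in the direction of [x_n], and the family is the part of
     [psi_joint] with exponent 0 there. *)
  have hs : abs_summable (psi_joint a j g ell s K y hx).
    apply: hrho => u; rewrite /hx; case: (unliftP ord_max u) => [v|] ->; last first.
      by rewrite cnorm0 eqxx orTb ltW.
    rewrite eq_sym (negbTE (neq_lift _ _)) /= (inj_eq lift_inj).
    by have [->|/hX//] := eqVneq v ord_max; exact: ltW.
  have inj : injective (fun x : {ffun 'I_d.+2 -> nat} * ({ffun 'I_d.+1 -> nat} * nat) =>
    (mjoin x.1 0, x.2)).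
    by move=> [k q] [k' q'] /= [/(congr1 (@mbody _)) + ->]; rewrite !mbody_join => ->.
  apply: abs_summable_le (abs_summable_comp inj hs) => -[k q] /=.
  rewrite /psi_joint /taylor_term /= xdeg_join muln0 addn0 mjoin_max gscale0 mulr1.
  rewrite vmon_join mifact_join muln1 expr0 mulr1.
  rewrite (_ : (fun v => hx (lift ord_max v)) = h)//.
  by apply/funext => v; rewrite /hx liftK.
have [S hS] := abs_summable_has_sum tsum.
have inner k : has_sum (fun q => taylor_term K y h (k, q))
    (psi (K + ydeg a k) y * (vmon h k / (mifact k)%:R)).
  rewrite mulrC; have := has_sumZ (vmon h k / (mifact k)%:R) (has_sum_psi a1 a_incr jN
    (K + ydeg a k) dom y0 yE).
  by apply: has_sum_ext => q; rewrite mulrC.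
have outer : has_sum (regrouped_term K y h) S.
  apply: (has_sum_transfer
    (f := fun x => ((miD x.2.1 (mbody x.1), (x.2.2 - x.1 ord_max)%N), x.1))
    (g := fun x => (x.2, (miB x.1.1 (mbody x.2), (x.1.2 + x.2 ord_max)%N))) _ _ hS).
    move=> [[be l] k]; rewrite /regrouped_term /=; case: forallP => [kb|]; last by rewrite eqxx.
    by move=> _; rewrite miBK// addnK.
  move=> [k [al l]] u0 /=.
  (* Otherwise the constraint would force [j >= N]; this is where [j < N] makes the truncated
     difference harmless. *)
  have kl : (k ord_max <= l)%N.
    move: u0; rewrite /taylor_term /psi_term /=.
    case: (_ =P (j + N * l)%N) => [hc _|_]; last by rewrite mul0r eqxx.
    rewrite leqNgt; apply/negP => lk.
    have : (N * l.+1 <= j + N * l)%N.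
      rewrite -hc ydeg_lift; apply: leq_trans (leq_addl _ _).
      by do 2! apply: leq_trans (leq_addl _ _); rewrite leq_mul2l lk orbT.
    by rewrite mulnS leq_add2r leqNgt jN.
  rewrite /regrouped_term /= miDK subnK//; split=> //.
  by case: forallP => // -[] v; rewrite !ffunE leq_addl.
have outer' := has_sum_fubini outer (regrouped_sum K r00 hell hmin).
have [_ y'E] : {for y' 0 ord_max, continuous ell} /\ cexp (ell (y' 0 ord_max)) = y' 0 ord_max.
  by apply: hell; apply: lt_le_trans hmin _; rewrite ge_min lexx.
have y'0 : y' 0 ord_max != 0 by rewrite -y'E cexp_neq0.
rewrite (has_sum_unique (has_sum_psi a1 a_incr jN K dom y'0 y'E) outer').
exact: has_sum_fubini hS inner.
Qed.

(** Each term is an eigenvector of [a_1 x_1 d_1 + .. + a_(n-1) x_(n-1) d_(n-1)], with eigenvalue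
    [adeg al + N (g - l)]. By the degree constraint this equals [j + N g - K] for all terms. *)
Lemma psi_euler s y K : dominated a g s -> y 0 ord_max != 0 ->
  cexp (ell (y 0 ord_max)) = y 0 ord_max ->
  \sum_v (ywt a v)%:R * y 0 v * psi (K + ywt a v) y +
    (K%:R - (j%:R + N%:R * g)) * psi K y = 0.
Proof.
move=> dom y0 yE; set t := y 0 ord_max in y0 yE.
have hp (K' : nat) := has_sum_psi a1 a_incr jN K' dom y0 yE.
have termD v al l : y 0 (lift ord_max v) * psi_term (K + awt a v) y (al, l) =
    ((miD al (miU v)) v)%:R * psi_term K y (miD al (miU v), l).
  have -> : (miD al (miU v)) v = (al v).+1 by rewrite !ffunE eqxx addn1.
  rewrite /psi_term /= (_ : adeg a (miD al (miU v)) = adeg a al + awt a v)%N; last first.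
    rewrite /adeg (bigD1 v)//= [in RHS](bigD1 v)//= !ffunE eqxx mulnDr muln1 addnAC.
    congr (_ + _ + _)%N; apply: eq_bigr => i /negbTE iv.
    by rewrite !ffunE iv addn0.
  rewrite [(K + awt a v)%N]addnC addnA; case: ifP => _; last by rewrite !mulr0.
  rewrite vmonD vmonU mifactDU natrM.
  have k0 : (al v).+1%:R != 0 :> C by rewrite pnatr_eq0.
  have m0 : (mifact al)%:R != 0 :> C by rewrite pnatr_eq0 -lt0n mifact_gt0.
  move: ((al v).+1%:R : C) ((mifact al)%:R : C) k0 m0 => k m k0 m0.
  by field; rewrite k0 m0.
have hv (v : 'I_d.+1) : has_sum (fun q : {ffun 'I_d.+1 -> nat} * nat => (q.1 v)%:R * psi_term K y q)
    (y 0 (lift ord_max v) * psi (K + awt a v) y).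
  apply: (has_sum_transfer (f := fun q : {ffun 'I_d.+1 -> nat} * nat => (miD q.1 (miU v), q.2))
    (g := fun q : {ffun 'I_d.+1 -> nat} * nat => (miB q.1 (miU v), q.2)) _ _
    (has_sumZ (y 0 (lift ord_max v)) (hp (K + awt a v)%N))) => -[al l] /= w0.
    have al0 : miD (miB al (miU v)) (miU v) = al.
      rewrite miBK// => i; rewrite ffunE; case: eqP => // ->.
      by rewrite lt0n; apply: contra w0 => /eqP ->; rewrite mul0r.
    by rewrite termD al0.
  by rewrite miDK -termD.
have termS al l : t * psi_term (K + N) y (al, l.+1) = (g - l%:R) * psi_term K y (al, l).
  rewrite /psi_term /= mulnS [(N + _)%N]addnC !addnA eqn_add2r.
  case: ifP => _; last by rewrite !mulr0.
  rewrite ffact_CS -/t (_ : (g - l%:R) * ell t = (g - l.+1%:R) * ell t + ell t); last first.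
    by rewrite -natr1; ring.
  by rewrite cexpD yE; ring.
have hl : has_sum (fun q : {ffun 'I_d.+1 -> nat} * nat => (g - q.2%:R) * psi_term K y q)
  (t * psi (K + N) y).
  apply: (has_sum_transfer (f := fun q : {ffun 'I_d.+1 -> nat} * nat => (q.1, q.2.-1))
    (g := fun q : {ffun 'I_d.+1 -> nat} * nat => (q.1, q.2.+1)) _ _
    (has_sumZ t (hp (K + N)%N))) => -[al [|l]] //=; rewrite ?termS//.
  (* At order [K + N] there is no term with [l = 0], since [j < N]; shifting [l] therefore loses
     nothing. *)
  rewrite /psi_term /=; case: (_ =P (j + N * 0)%N) => [|_]; last by rewrite mulr0 eqxx.
  by rewrite muln0 addn0 addnA => h; move: jN; rewrite -h ltnNge leq_addl.
have := has_sumD (has_sumZ N%:R hl)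
  (has_sum_sum (index_enum 'I_d.+1) (P := xpredT) (fun v _ => has_sumZ (awt a v)%:R (hv v))).
have hK := has_sumZ (j%:R + N%:R * g - K%:R) (hp K) => hsum.
have E : N%:R * (t * psi (K + N) y) +
   \sum_v (awt a v)%:R * (y 0 (lift ord_max v) * psi (K + awt a v) y) =
   (j%:R + N%:R * g - K%:R) * psi K y.
  apply: (has_sum_unique hsum); apply: has_sum_ext hK => -[al l] /=.
  have -> : \sum_v (awt a v)%:R * ((al v)%:R * psi_term K y (al, l)) =
      (adeg a al)%:R * psi_term K y (al, l).
    rewrite /adeg natr_sum mulr_suml; apply: eq_bigr => v _.
    by rewrite natrM mulrA.
  rewrite mulrA -mulrDl /psi_term /=; case: eqP => [hc|_]; last by rewrite !mulr0.
  congr (_ * _); have := congr1 (fun n => n%:R : C) hc; rewrite !natrD natrM.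
  move=> /(canRL (addrK _)) ->; ring.
rewrite (bigD1_ord ord_max)//= -/t.
have -> : \sum_(v < d.+1) (ywt a (lift ord_max v))%:R * y 0 (lift ord_max v) * psi
  (K + ywt a (lift ord_max v)) y =
  \sum_v (awt a v)%:R * (y 0 (lift ord_max v) * psi (K + awt a v) y).
  by apply: eq_bigr => v _; rewrite mulrA.
by rewrite -mulrA ywt_penult E; ring.
Qed.

End PsiTaylor.

Section SolutionEq.
Variables (R : realType) (n : nat) (a : 'I_n.+1 -> nat) (beta : cplx R).
Variable U : set 'rV[cplx R]_n.
Hypothesis U_nbhs : forall y, U y -> nbhs y U.

Lemma is_solution_eq (f g : fseries R n) : is_solution a beta U f -> eq_on U f g ->
  is_solution a beta U g.
Proof.
move=> [fA fD fE] fg; split.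
- exact: analytic_on_eq fA fg.
- move=> v; apply: eq_on_trans (eq_on_sym (eq_on_deriv U_nbhs v fA fg)) _.
  by apply: eq_on_trans (fD v) _; exact: eq_on_iter.
- by apply: eq_on_trans (eq_on_sym _) fE; exact: eq_on_act.
Qed.

End SolutionEq.

Section GammaSolution.
Variables (R : realType) (d : nat) (a : 'I_d.+3 -> nat).
Hypothesis a1 : a ord0 = 1%N.
Hypothesis a_incr : forall i j : 'I_d.+3, (i < j)%N -> (a i < a j)%N.
Local Notation C := (cplx R).
Local Notation N := (a (penult d)).
Variables (beta : C) (j : nat) (ell : C -> C).
Implicit Types (y : 'rV[C]_d.+2) (K : nat).
Hypothesis jN : (j < N)%N.
Local Notation g := (gamma_exp a beta j).
Local Notation psi := (psi a j g ell).

(** The critical order is available for every [beta] and suffices wherever only summability of the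
    [psi] families is at stake. *)
Lemma dominated_default : dominated a g ((a ord_max)%:R / N%:R : R).
Proof.
apply: dominated_critical => //; rewrite mulrCA mulfV ?mulr1//.
by rewrite pnatr_eq0 -lt0n a_gt0.
Qed.

Lemma adeg_ffcons e (m : {ffun 'I_d -> nat}) :
  adeg a (ffcons e m) = (e + \sum_(r < d) a (lift ord_max (mid r)) * m r)%N.
Proof.
rewrite /adeg big_ord_recl -/(ffhead _) ffcons_head; congr (_ + _)%N.
  rewrite /awt (_ : lift ord_max ord0 = ord0) ?ywt0 ?mul1n//; exact: val_inj.
by apply: eq_bigr => r _; rewrite ffunE liftK.
Qed.

(** The constraint determines the exponent [e_j] of [x_1] from [m] and [l]; adjoining it to [m]
    gives the index [al] of [psi_term], and [d_1^(a_n i)] accounts for the degree of [x_n^i]. *)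
Lemma has_sum_gamma_term i y : y 0 ord_max != 0 ->
  cexp (ell (y 0 ord_max)) = y 0 ord_max ->
  has_sum (gamma_term a beta ell j i y) ((j`!)%:R / (i`!)%:R * psi (a ord_max * i) y).
Proof.
move=> y0 yE.
have hp := has_sum_psi a1 a_incr jN (a ord_max * i) dominated_default y0 yE.
pose neg (m : {ffun 'I_d -> nat}) := (\sum_(r < d) a (lift ord_max (mid r)) * m r + a ord_max *
  i)%N.
have E m l : (neg m <= j + N * l)%N ->
    (j`!)%:R / (i`!)%:R * psi_term a j g ell (a ord_max * i) y (ffcons (j + N * l - neg m) m, l) =
    gamma_term a beta ell j i y (m, l).
  move=> nl; rewrite /psi_term /gamma_term /= -/(neg m) nl adeg_ffcons -addnA -/(neg m) subnK//
    eqxx.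
  set e := (_ - _)%N.
  rewrite /vmon big_ord_recl -/(ffhead _) ffcons_head (_ : lift ord_max ord0 = ord0);
    last exact: val_inj.
  rewrite (_ : \prod_(r < d) y 0 (lift ord_max (lift ord0 r)) ^+ ffcons e m (lift ord0 r) =
    \prod_(r < d) y 0 (mid r) ^+ m r); last first.
    by apply: eq_bigr => r _; rewrite [ffcons _ _ _]ffunE liftK.
  rewrite (_ : mifact (ffcons e m) = (e`! * \prod_(r < d) (m r)`!)%N); last first.
    rewrite /mifact big_ord_recl -/(ffhead _) ffcons_head; congr (_ * _)%N.
    by apply: eq_bigr => r _; rewrite ffunE liftK.
  by rewrite !natrM !invfM; ring.
apply: (has_sum_transfer (f := fun q : {ffun 'I_d.+1 -> nat} * nat => (fftail q.1, q.2))
  (g := fun q : {ffun 'I_d -> nat} * nat => (ffcons (j + N * q.2 - neg q.1) q.1, q.2)) _ _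
  (has_sumZ ((j`!)%:R / (i`!)%:R) hp)).
  move=> [m l] w0; suff nl : (neg m <= j + N * l)%N by rewrite /= ffcons_tail E.
  by apply: contraNT w0 => /negbTE nl; rewrite /gamma_term -/(neg m) nl.
move=> [al l]; rewrite {1}/psi_term /=.
case: (_ =P (j + N * l)%N) => [hc _|_]; last by rewrite mulr0 eqxx.
have hneg : (ffhead al + neg (fftail al) = j + N * l)%N.
  have := adeg_ffcons (ffhead al) (fftail al); rewrite ffconsK => hal.
  by rewrite -hc /= hal /neg addnA.
have hle : (neg (fftail al) <= j + N * l)%N by rewrite -hneg leq_addl.
have hsub : (j + N * l - neg (fftail al))%N = ffhead al by rewrite -hneg addnK.
split; first by rewrite /= hsub ffconsK.
by apply: etrans (esym (E _ _ hle)) _; rewrite hsub ffconsK.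
Qed.

Lemma gamma_seriesE i y : y 0 ord_max != 0 -> cexp (ell (y 0 ord_max)) = y 0 ord_max ->
  gamma_series a beta ell j i y = (j`!)%:R / (i`!)%:R * psi (a ord_max * i) y.
Proof. by move=> y0 yE; apply/famsumE/has_sum_gamma_term. Qed.

(** The full series [d_1^K phi_(v^j)], with its powers of [x_n]; in this form every derivative [d_v]
    is the shift of [K] by [a_v]. *)
Definition psi_series K : fseries R d.+2 :=
  fun i y => (j`!)%:R / (i`!)%:R * psi (K + a ord_max * i) y.

Variable U : set 'rV[C]_d.+2.
Hypothesis U_nbhs : forall y, U y -> nbhs y U.
Hypothesis U_branch : forall y, U y -> log_branch (y 0 ord_max) ell /\ y 0 ord_max != 0.

Let U_cexp y : U y -> cexp (ell (y 0 ord_max)) = y 0 ord_max.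
Proof. by move=> /U_branch[/nbhs_singleton[]]. Qed.

Lemma psi_series_pseries K i y : U y -> exists2 r, 0 < r &
  pseries (fun k => (j`!)%:R / (i`!)%:R * psi (K + a ord_max * i + ydeg a k) y / (mifact k)%:R)
    y (psi_series K i) r.
Proof.
move=> Uy; have [hb y0] := U_branch Uy.
have [rho rho0 hrho] := psi_taylor a1 a_incr jN dominated_default y0 hb ler01.
exists (Num.min 1 rho) => [|z zy]; first by rewrite lt_min ltr01.
have h := hrho (K + a ord_max * i)%N z.
apply: has_sum_ext (has_sumZ ((j`!)%:R / (i`!)%:R) (h _ _)) => [k|v _|].
- by rewrite -!mulrA; congr (_ * (_ * (_ * _))); rewrite mulrC.
- by apply/ltW/(lt_le_trans (zy v)); rewrite ge_min lexx.
- by apply: lt_le_trans (zy ord_max) _; rewrite ge_min lexx orbT.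
Qed.

Lemma analytic_on_psi_series K : analytic_on U (psi_series K).
Proof.
move=> y Uy i; have [r r0 h] := psi_series_pseries K i Uy.
by apply/analytic_atP; move: h; set c := (X in pseries X) => h; exists c, r.
Qed.

Lemma mifactU n (v : 'I_n) : mifact (miU v) = 1%N.
Proof.
have := mifactDU (mi0 n) v; rewrite mifact0 ffunE muln1 => <-.
by congr mifact; apply/ffunP => i; rewrite !ffunE.
Qed.

Lemma fderiv_psi_series K v : eq_on U (fderiv v (psi_series K)) (psi_series (K + a v)).
Proof.
move=> y Uy i; case: (unliftP ord_max v) => [v'|] ->.
  rewrite fderiv_lift; have [r r0 h] := psi_series_pseries K i Uy.
  apply: (etrans (pseries_derive_center v' r0 h).2).
  by rewrite mifactU divr1 ydegU /psi_series /ywt addnAC.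
rewrite /fderiv unlift_none /psi_series mulrA; congr (_ * psi _ _).
  rewrite factS natrM.
  have i0 : i.+1%:R != 0 :> C by rewrite pnatr_eq0.
  have f0 : (i`!)%:R != 0 :> C by rewrite pnatr_eq0 -lt0n fact_gt0.
  move: (i.+1%:R : C) i0 => I I0; move: ((i`!)%:R : C) f0 => F F0.
  by field; rewrite I0 F0.
by rewrite mulnS addnA.
Qed.

Lemma iter_fderiv_psi_series k :
  eq_on U (iter k (fderiv ord0) (psi_series 0)) (psi_series k).
Proof.
elim: k => [|k IH] /=; first by [].
apply: eq_on_trans (eq_on_deriv U_nbhs ord0 _ IH) _.
  exact/analytic_on_iter/analytic_on_psi_series.
by have := @fderiv_psi_series k ord0; rewrite a1 addn1.
Qed.

Lemma psi_series_solution : is_solution a beta U (psi_series 0).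
Proof.
split; first exact: analytic_on_psi_series.
  move=> v; apply: eq_on_trans (eq_on_sym _); last exact: iter_fderiv_psi_series.
  exact: fderiv_psi_series.
move=> y Uy i; rewrite weyl_act_euler (bigD1_ord ord_max)//=.
have [hb y0] := U_branch Uy.
have hE := psi_euler a1 a_incr jN (a ord_max * i) dominated_default y0 (U_cexp Uy).
have -> : \sum_(v < d.+2) (a (lift ord_max v))%:R * fmulX (lift ord_max v)
  (fderiv (lift ord_max v) (psi_series 0)) i y
  = (j`!)%:R / (i`!)%:R * \sum_v (ywt a v)%:R * y 0 v * psi (a ord_max * i + ywt a v) y.
  rewrite mulr_sumr; apply: eq_bigr => v _; rewrite /fmulX liftK.
  have := fderiv_psi_series 0 (lift ord_max v) Uy i => ->.
  by rewrite /psi_series add0n addnC; ring.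
have -> : (a ord_max)%:R * fmulX ord_max (fderiv ord_max (psi_series 0)) i y =
    (j`!)%:R / (i`!)%:R * ((a ord_max * i)%N%:R * psi (a ord_max * i) y).
  rewrite /fmulX unlift_none; case: i => [|i] in hE *; first by rewrite muln0 mul0r !mulr0.
  rewrite (fderiv_psi_series 0 ord_max Uy i) /psi_series add0n -mulnS factS !natrM invfM.
  have i0 : i.+1%:R != 0 :> C by rewrite pnatr_eq0.
  have f0 : (i`!)%:R != 0 :> C by rewrite pnatr_eq0 -lt0n fact_gt0.
  move: (i.+1%:R : C) i0 => I I0; move: ((i`!)%:R : C) f0 => F F0.
  by field; rewrite I0 F0.
have N0 : N%:R != 0 :> C by rewrite pnatr_eq0 -lt0n a_gt0.
have bE : j%:R + N%:R * g = beta by rewrite /gamma_exp mulrCA mulfV// mulr1 addrC subrK.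
rewrite bE in hE; move/eqP: hE; rewrite addr_eq0 => /eqP ->.
by rewrite /psi_series add0n; ring.
Qed.

Lemma gamma_eq_psi_series : eq_on U (psi_series 0) (gamma_series a beta ell j).
Proof.
move=> y Uy i; have [_ y0] := U_branch Uy.
by rewrite (gamma_seriesE i y0 (U_cexp Uy)) /psi_series add0n.
Qed.

Lemma gamma_solution : is_solution a beta U (gamma_series a beta ell j).
Proof. exact: is_solution_eq psi_series_solution gamma_eq_psi_series. Qed.

Lemma gamma_taylor w k : U w ->
  taylor_fun (gamma_series a beta ell j) w k = (j`!)%:R * psi k w.
Proof.
move=> Uw; have [sA _ _] := psi_series_solution.
rewrite /taylor_fun -(eq_on_iter U_nbhs ord0 k sA gamma_eq_psi_series Uw 0%N).
by rewrite (iter_fderiv_psi_series k Uw 0%N) /psi_series muln0 addn0 divr1.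
Qed.

End GammaSolution.

(** * Gevrey order of the Gamma-series *)

Section GammaGevrey.
Variables (R : realType) (d : nat) (a : 'I_d.+3 -> nat).
Hypothesis a1 : a ord0 = 1%N.
Hypothesis a_incr : forall i j : 'I_d.+3, (i < j)%N -> (a i < a j)%N.
Local Notation C := (cplx R).
Local Notation N := (a (penult d)).
Variables (beta : C) (j : nat) (ell : C -> C).
Hypothesis jN : (j < N)%N.
Local Notation g := (gamma_exp a beta j).
Local Notation psi := (psi a j g ell).
Variable U : set 'rV[C]_d.+2.
Hypothesis U_nbhs : forall y, U y -> nbhs y U.
Hypothesis U_branch : forall y, U y -> log_branch (y 0 ord_max) ell /\ y 0 ord_max != 0.

Let U_cexp y : U y -> cexp (ell (y 0 ord_max)) = y 0 ord_max.
Proof. by move=> /U_branch[/nbhs_singleton[]]. Qed.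

Lemma gamma_formal_germ (p : 'rV[C]_d.+3) : U (col' ord_max p) ->
  formal_germ p (gamma_series a beta ell j).
Proof.
move=> Uw; apply: filterS (U_nbhs Uw) => y Uy.
by have [sA _ _] := gamma_solution a1 a_incr beta jN U_nbhs U_branch; exact: sA.
Qed.

Lemma gscaleE (s : R) i : gscale s i = (of_real ((i`!)%:R `^ (s - 1)))^-1.
Proof.
have f0 : (i`!)%:R != 0 :> R by rewrite pnatr_eq0 -lt0n fact_gt0.
rewrite /gscale -(opprB s 1) powRN.
set x := _ `^ _; have x0 : x != 0 by rewrite gt_eqF// powR_gt0// lt0r f0 ler0n.
apply: (mulIf (x := of_real x)).
  by apply: contra x0 => /eqP x0; apply/eqP/of_real_inj; rewrite x0.
rewrite -of_realM !mulVf//.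
by apply: contra x0 => /eqP x0; apply/eqP/of_real_inj; rewrite x0.
Qed.

(** [F] is the joint Taylor series at [p] of the rescaled series, summable by domination. Grouped by
    powers of [x_n], it has as coefficients the Taylor expansions of the rescaled [gamma_series]
    given by [psi_taylor]. *)
Lemma gamma_convergent (s : R) (p : 'rV[C]_d.+3) : dominated a g s ->
  p 0 ord_max = 0 -> U (col' ord_max p) ->
  convergent_at p (fun i y => gamma_series a beta ell j i y / of_real ((i`!)%:R `^ (s - 1))).
Proof.
move=> dom p0 Uw; set w := col' ord_max p in Uw.
have [hb w0] := U_branch Uw; have wE := U_cexp Uw.
have [rho rho0 hrho] := psi_joint_summable a1 a_incr jN dom w0 wE ler01.
have [rho' rho'0 hrho'] := psi_taylor a1 a_incr jN dom w0 hb ler01.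
have /nbhs_polydiscP[rU rU0 hU] := U_nbhs Uw.
pose c (m : {ffun 'I_d.+3 -> nat}) : C :=
  (j`!)%:R * (psi (xdeg a m) w / (mifact m)%:R * gscale s (m ord_max)).
pose F (x : 'rV[C]_d.+3) := famsum (fun m => c m * vmon (fun u => x 0 u - p 0 u) m).
pose r := Num.min (Num.min 1 rho) (Num.min rho' rU).
have r0 : 0 < r by rewrite !lt_min ltr01 rho0 rho'0 rU0.
have r1 : r <= 1 by rewrite !ge_min lexx.
have rrho : r <= rho by rewrite !ge_min lexx orbT.
have rrho' : r <= rho' by rewrite !ge_min lexx !orbT.
have rrU : r <= rU by rewrite !ge_min lexx !orbT.
have hF : pseries c p F r.
  move=> x xp; suff [T hT] : exists T, has_sum (fun m => c m * vmon (fun u => x 0 u - p 0 u) m) T.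
    by rewrite /F (famsumE hT).
  pose h (u : 'I_d.+3) := x 0 u - p 0 u.
  have hh u : cnorm (h u) <= if (u == ord_max) || (u == penult d) then rho else 1.
    by case: ifP => _; apply: le_trans (ltW (xp u)) _.
  have [T hT] := abs_summable_has_sum (hrho 0%N h hh).
  exists ((j`!)%:R * T).
  have hm m : has_sum (fun q => psi_joint a j g ell s 0 w h (m, q))
      (psi (xdeg a m) w * (vmon h m / (mifact m)%:R * gscale s (m ord_max))).
    rewrite mulrC; apply: has_sum_ext (has_sumZ _ (has_sum_psi a1 a_incr jN (xdeg a m) dom w0 wE))
      => q.
    by rewrite mulrC.
  apply: has_sum_ext (has_sumZ _ (has_sum_fubini hT hm)) => m.
  by rewrite /c; ring.
exists F; have hA : analytic_at F p by apply/analytic_atP; exists c, r.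
have hnear := analytic_near hA.
apply: filterS2 hnear (nbhs_polydisc (polydisc_center p r0)) => x Fx xp; split=> //.
have xw : polydisc w r (col' ord_max x) by move=> v; rewrite !mxE.
have Ux : U (col' ord_max x) by apply: hU; exact: polydisc_le xw.
have hj := has_sum_mjoin (hF x xp).
have hi i : has_sum (fun k => c (mjoin k i) * vmon (fun u => x 0 u - p 0 u) (mjoin k i))
    (gamma_series a beta ell j i (col' ord_max x) / of_real ((i`!)%:R `^ (s - 1)) * x 0 ord_max ^+
      i).
  have [_ x0] := U_branch Ux; have xE := U_cexp Ux.
  have ht : has_sum (fun k => psi (a ord_max * i + ydeg a k) w *
      (vmon (fun v => col' ord_max x 0 v - w 0 v) k / (mifact k)%:R))
      (psi (a ord_max * i) (col' ord_max x)).
    apply: hrho' => [v _|]; last exact: lt_le_trans (xw _) rrho'.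
    by apply/ltW/(lt_le_trans (xw v)).
  rewrite (gamma_seriesE a1 a_incr beta jN i x0 xE) -gscaleE.
  have -> (A B D E : C) : A * B * D * E = A * D * E * B by ring.
  apply: has_sum_ext (has_sumZ _ ht) => k.
  rewrite /c vmon_join mjoin_max p0 subr0 mifact_join xdeg_join natrM invfM [(ydeg a k + _)%N]addnC.
  rewrite (_ : vmon (fun v => x 0 (lift ord_max v) - p 0 (lift ord_max v)) k =
    vmon (fun v => col' ord_max x 0 v - w 0 v) k); last by apply: eq_bigr => v _; rewrite !mxE.
  by ring.
exact: has_sum_cvg (has_sum_fubini hj hi).
Qed.

End GammaGevrey.

Lemma vmon_null (K : comPzRingType) n (h : 'I_n -> K) (m : {ffun 'I_n -> nat}) :
  (forall v, h v = 0) -> m != mi0 n -> vmon h m = 0.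
Proof.
move=> h0 m0; have [/existsP[v mv]|] := boolP [exists v, m v != 0%N].
  by rewrite /vmon (bigD1 v)//= h0 expr0n (negbTE mv) mul0r.
rewrite negb_exists => /forallP mv; case/negP: m0; apply/eqP/ffunP => v.
by rewrite ffunE; apply/eqP/negPn.
Qed.

Lemma has_sum_fintype (R : realType) (I : finType) (u : I -> cplx R) :
  has_sum u (\sum_i u i).
Proof.
have := @has_sum_finite R I [fset i in enum I]%fset u; rewrite [X in has_sum u X](_ : _ =
  \sum_i u i).
  by apply=> i; rewrite !inE mem_enum inE.
rewrite -[RHS]big_enum; apply: perm_big; apply: uniq_perm => [||i].
- exact: fset_uniq.
- exact: enum_uniq.
- by rewrite !inE.
Qed.

(** * Linear independence of the Gamma-series *)

Section GammaIndependence.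
Variables (R : realType) (d : nat) (a : 'I_d.+3 -> nat).
Hypothesis a1 : a ord0 = 1%N.
Hypothesis a_incr : forall i j : 'I_d.+3, (i < j)%N -> (a i < a j)%N.
Local Notation C := (cplx R).
Local Notation N := (a (penult d)).
Variable beta : C.

(* On the axis [x_1 = .. = x_(n-2) = 0] only the term [al = 0, l = 0] survives. *)
Lemma psi_axis j g ell K (y : 'rV[C]_d.+2) : (j < N)%N -> (K < N)%N ->
  (forall v, y 0 (lift ord_max v) = 0) ->
  psi a j g ell K y = if K == j then cexp (g * ell (y 0 ord_max)) else 0.
Proof.
move=> jN KN y0; apply: famsumE.
have [->|Kj] := eqVneq K j.
  have -> : cexp (g * ell (y 0 ord_max)) = psi_term a j g ell j y (mi0 _, 0%N).
    rewrite /psi_term /= muln0 addn0 /adeg big1 => [|v _]; last by rewrite ffunE muln0.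
    rewrite eqxx /ffact_C big_ord0 subr0 vmon0 mifact0 mul1r.
    by rewrite divr1 mulr1.
  apply: has_sum_single => -[al l] h; rewrite /psi_term /=.
  case: (_ =P (j + N * l)%N) => // hS; rewrite vmon_null ?mul0r ?mulr0//.
  apply: contra h => /eqP al0; move: hS; rewrite al0 /adeg big1 => [|v _]; last first.
    by rewrite ffunE muln0.
  rewrite add0n -{1}[j]addn0 => /addnI/esym/eqP; rewrite muln_eq0.
  by rewrite -leqn0 leqNgt (leq_ltn_trans _ jN)//= => /eqP ->.
apply: has_sum_ext (@has_sum0 R _) => -[al l]; rewrite /psi_term /=.
case: (_ =P (j + N * l)%N) => // hS.
have [al0|al0] := eqVneq al (mi0 _); last by rewrite vmon_null ?mul0r ?mulr0.
move: hS; rewrite al0 /adeg big1 => [|v _]; last by rewrite ffunE muln0.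
rewrite add0n; case: l => [|l]; first by rewrite muln0 addn0 => E; rewrite E eqxx in Kj.
by move=> E; move: KN; rewrite E mulnS addnCA ltnNge leq_addr.
Qed.

Lemma gamma_independent (ell : 'I_N -> C -> C) (w : 'rV[C]_d.+2) (c : 'I_N -> C) :
  w 0 ord_max != 0 -> (forall j, log_branch (w 0 ord_max) (ell j)) ->
  (forall k, \sum_(j < N) c j * ((j`!)%:R * psi a j (gamma_exp a beta j) (ell j) k w) = 0) ->
  forall j, c j = 0.
Proof.
move=> w0 hb h j.
(* The point of the axis with the same [x_(n-1)] as [w]: the increment of [x_(n-1)] is zero and the
   others are bounded by [X], so the Taylor expansions at [w] reach [y] and carry the relation
   there. *)
pose y : 'rV[C]_d.+2 := \row_v (if v == ord_max then w 0 v else 0).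
pose X := \sum_v cnorm (w 0 v).
have X0 : 0 <= X by apply: sumr_ge0 => v _; exact: cnorm_ge0.
have ymax : y 0 ord_max = w 0 ord_max by rewrite mxE eqxx.
have y0 v : y 0 (lift ord_max v) = 0 by rewrite mxE eq_sym (negbTE (neq_lift _ _)).
have ht (i : 'I_N) : has_sum (fun k => c i * (i`!)%:R *
    (psi a i (gamma_exp a beta i) (ell i) (j + ydeg a k) w *
      (vmon (fun v => y 0 v - w 0 v) k / (mifact k)%:R)))
    (c i * (i`!)%:R * psi a i (gamma_exp a beta i) (ell i) j y).
  have dom := dominated_default a1 a_incr beta i.
  have [rho rho0 hrho] := psi_taylor a1 a_incr (ltn_ord i) dom w0 (hb i) X0.
  apply/has_sumZ/hrho => [v vm|]; last by rewrite ymax subrr cnorm0.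
  rewrite mxE (negbTE vm) sub0r cnormN /X (bigD1 v)//= lerDl.
  by apply: sumr_ge0 => u _; exact: cnorm_ge0.
have hs := has_sum_sum (index_enum 'I_N) (P := xpredT) (fun i _ => ht i).
have {hs} : \sum_(i < N) c i * (i`!)%:R * psi a i (gamma_exp a beta i) (ell i) j y = 0.
  apply: (has_sum_unique hs); apply: has_sum_ext (@has_sum0 R _) => k.
  transitivity (0 * (vmon (fun v => y 0 v - w 0 v) k / (mifact k)%:R)); first by rewrite mul0r.
  apply: etrans (congr1 (fun z => z * _) (esym (h (j + ydeg a k)%N))) _.
  by rewrite mulr_suml; apply: eq_bigr => i _; rewrite !mulrA.
rewrite (bigD1 j)//= big1 => [|i ij]; last first.
  rewrite psi_axis// (_ : (j == i :> nat) = false) ?mulr0// eq_sym; exact: negbTE.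
rewrite psi_axis// eqxx addr0 => /eqP; rewrite !mulf_eq0 (negbTE (cexp_neq0 _)) orbF.
by rewrite pnatr_eq0 -leqn0 leqNgt fact_gt0 orbF => /eqP.
Qed.

End GammaIndependence.

(** * The polynomial Gamma-series *)

Definition mnm_of n (k : {ffun 'I_n -> nat}) : multinom n := Multinom [tuple k i | i < n].

Lemma mnm_ofE n (k : {ffun 'I_n -> nat}) i : mnm_of k i = k i.
Proof. by rewrite /mnm_of mnmE. Qed.

Section MpolySeries.
Variables (R : realType) (n : nat).
Local Notation C := (cplx R).

Lemma fseries_of_mpolyE (P : mpoly n.+1 C) i y : fseries_of_mpoly P i y =
  lsum (fun m => (if m ord_max == i then \prod_(v < n) y 0 v ^+ m (lift ord_max v) else 0) : C^o) P.
Proof.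
rewrite /fseries_of_mpoly /lsum big_mkcond; apply: eq_bigr => m _.
by case: eqP => // _; rewrite scaler0.
Qed.

Lemma fseries_of_mpoly_monomial (k : {ffun 'I_n -> nat}) i' i (y : 'rV[C]_n) :
  fseries_of_mpoly (mpolyX C (mnm_of (mjoin k i'))) i y =
  if i' == i then vmon (fun v => y 0 v) k else 0.
Proof.
rewrite fseries_of_mpolyE lsumX mnm_ofE mjoin_max; case: eqP => // _.
by apply: eq_bigr => v _; rewrite mnm_ofE mjoin_lift.
Qed.

Lemma fseries_of_mpoly_comb (I : Type) (r : seq I) (c : I -> C) (F : I -> mpoly n.+1 C) i y :
  fseries_of_mpoly (\sum_(t <- r) c t *: F t) i y = \sum_(t <- r) c t * fseries_of_mpoly (F t) i y.
Proof.
rewrite fseries_of_mpolyE lsum_sum; apply: eq_bigr => t _.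
by rewrite lsumZ fseries_of_mpolyE.
Qed.

End MpolySeries.

Section GammaPolynomial.
Variables (R : realType) (d : nat) (a : 'I_d.+3 -> nat).
Hypothesis a1 : a ord0 = 1%N.
Hypothesis a_incr : forall i j : 'I_d.+3, (i < j)%N -> (a i < a j)%N.
Local Notation C := (cplx R).
Local Notation N := (a (penult d)).
Variables (beta : C) (j l0 : nat) (ell : C -> C).
Hypothesis jN : (j < N)%N.
Hypothesis gE : gamma_exp a beta j = l0%:R.
Local Notation S := (j + N * l0)%N.
Local Notation index := ({ffun 'I_d.+1 -> 'I_S.+1} * 'I_l0.+1)%type.

Let mi_of (k : {ffun 'I_d.+1 -> 'I_S.+1}) : {ffun 'I_d.+1 -> nat} := [ffun v => k v : nat].

(** The falling factorial vanishes for [l > l0], and positivity of the weights then bounds every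
    exponent by [S]; a finite index type contains the support. *)
Lemma psi_finite K (y : 'rV[C]_d.+2) :
  psi a j l0%:R ell K y =
  \sum_(x : index) psi_term a j l0%:R ell K y (mi_of x.1, x.2 : nat).
Proof.
apply: famsumE.
apply: (has_sum_transfer
  (f := fun x : index => (mi_of x.1, x.2 : nat))
  (g := fun q : {ffun 'I_d.+1 -> nat} * nat => ([ffun v => inord (q.1 v)], inord q.2))
  _ _ (has_sum_fintype (fun x : index => psi_term a j l0%:R ell K y (mi_of x.1, x.2 : nat)))) =>
    [[al l] h|[k l] _]; last first.
  split=> //; congr (_, _); last exact: inord_val.
  by apply/ffunP => v; rewrite !ffunE inord_val.
suff E : (mi_of [ffun v => inord (al v)], (inord l : 'I_l0.+1) : nat) = (al, l) by rewrite /= E.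
move: h; rewrite /psi_term /=; case: (_ =P (j + N * l)%N) => [hS|]; last by rewrite eqxx.
have [ll|ll _] := ltnP l0 l.
  by rewrite /ffact_C (bigD1 (Ordinal ll))//= subrr !mul0r eqxx.
congr (_, _); last by rewrite inordK.
apply/ffunP => v; rewrite !ffunE inordK// ltnS.
apply: leq_trans (_ : adeg a al <= _)%N.
  by rewrite /adeg (bigD1 v)//=
    (leq_trans (leq_pmull (al v) (a_gt0 a1 a_incr (lift ord_max (lift ord_max v)))))// leq_addr.
by apply: leq_trans (leq_addr K _) _; rewrite hS leq_add2l leq_mul2l ll orbT.
Qed.

Lemma psi_term_nat K (y : 'rV[C]_d.+2) al l : (l <= l0)%N ->
  cexp (ell (y 0 ord_max)) = y 0 ord_max ->
  psi_term a j l0%:R ell K y (al, l) =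
  (if (adeg a al + K == j + N * l)%N then ffact_C (l0%:R : C) l / (mifact al)%:R else 0) *
  vmon (fun v => y 0 v) (mjoin al (l0 - l)).
Proof.
move=> ll yE; rewrite /psi_term /=; case: eqP => _; last by rewrite mul0r.
rewrite -natrB// -mulrA cexpMn yE vmon_join; ring.
Qed.

(** [x.1] is the exponent of [x_n], again at most [S] on the support, and [l0 - x.2.2] is that of
    [x_(n-1)]. *)
Definition gamma_mpoly : mpoly d.+3 C :=
  \sum_(x : 'I_S.+1 * index)
    ((j`!)%:R / (x.1`!)%:R *
      (if (adeg a (mi_of x.2.1) + a ord_max * x.1 == j + N * x.2.2)%N
       then ffact_C (l0%:R : C) x.2.2 / (mifact (mi_of x.2.1))%:R else 0)) *:
    mpolyX C (mnm_of (mjoin (mjoin (mi_of x.2.1) (l0 - x.2.2)) x.1)).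

Lemma gamma_mpolyE i (y : 'rV[C]_d.+2) : y 0 ord_max != 0 ->
  cexp (ell (y 0 ord_max)) = y 0 ord_max ->
  gamma_series a beta ell j i y = fseries_of_mpoly gamma_mpoly i y.
Proof.
move=> y0 yE; rewrite (gamma_seriesE a1 a_incr beta jN i y0 yE) gE psi_finite mulr_sumr.
rewrite fseries_of_mpoly_comb.
have -> : \sum_(x : index) (j`!)%:R / (i`!)%:R * psi_term a j l0%:R ell (a ord_max * i) y
  (mi_of x.1, x.2 : nat)
   = \sum_(i' < S.+1) \sum_(x : index) if i' == i :> nat then (j`!)%:R / (i'`!)%:R * psi_term a j
     l0%:R ell (a ord_max * i') y (mi_of x.1, x.2 : nat) else 0.
  have [iS|iS] := ltnP i S.+1.
    rewrite (bigD1 (Ordinal iS))//= [X in _ + X]big1 ?addr0 => [|i' ii'].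
      by apply: eq_bigr => x _; rewrite eqxx.
    rewrite big1// => x _; case: eqP => // E; case/eqP: ii'; exact: val_inj.
  rewrite [RHS]big1 => [|i' _]; last first.
    rewrite big1// => x _; case: eqP => // E.
    by move: iS; rewrite -E leqNgt ltn_ord.
  rewrite big1// => -[k l] _; rewrite /psi_term /=.
  case: (_ =P (j + N * l)%N) => [hS|]; last by rewrite mulr0.
  move: iS; rewrite ltnNge; case/negP.
  apply: leq_trans (leq_pmull i (a_gt0 a1 a_incr ord_max)) _.
  by apply: leq_trans (leq_addl (adeg a (mi_of k)) _) _; rewrite hS leq_add2l leq_mul2l -ltnS
    ltn_ord orbT.
rewrite pair_bigA; apply: eq_bigr => -[i' [k l]] _ /=.
rewrite fseries_of_mpoly_monomial; case: eqP => // _; last by rewrite mulr0.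
by rewrite psi_term_nat -1?ltnS// mulrA.
Qed.

End GammaPolynomial.

(** * The stalks *)

Section CplxLimits.
Variable R : realType.
Implicit Types (u v : nat -> cplx R).

Lemma cvg_cplxD u v (l l' : cplx R) : u @ \oo --> l -> v @ \oo --> l' ->
  (fun M => u M + v M) @ \oo --> l + l'.
Proof.
move=> /cvg_cplxP hu /cvg_cplxP hv; apply/cvg_cplxP => e e0.
have e20 : 0 < e / 2 by rewrite divr_gt0.
have [M1 h1] := hu _ e20; have [M2 h2] := hv _ e20.
exists (maxn M1 M2) => M; rewrite geq_max => /andP[/h1 u1 /h2 v2].
rewrite opprD addrACA (le_lt_trans (cnormD _ _))// [e]splitr; exact: ltrD.
Qed.

Lemma cvg_cplx_ext u v (l : cplx R) : u =1 v -> u @ \oo --> l -> v @ \oo --> l.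
Proof. by move=> /funext ->. Qed.

Lemma cvg_cplxZ c u (l : cplx R) : u @ \oo --> l -> (fun M => c * u M) @ \oo --> c * l.
Proof.
move=> /cvg_cplxP hu; apply/cvg_cplxP => e e0.
have c1 : 0 < 1 + cnorm c by rewrite ltr_pwDl// cnorm_ge0.
have [M1 h1] := hu (e / (1 + cnorm c)) (divr_gt0 e0 c1).
exists M1 => M /h1; rewrite ltr_pdivlMr// -mulrBr cnormM => h; apply: le_lt_trans h.
by rewrite mulrC ler_wpM2l ?cnorm_ge0// lerDr.
Qed.

End CplxLimits.

Section GevreyClosure.
Variables (R : realType) (n : nat).
Local Notation C := (cplx R).
Implicit Types (p : 'rV[C]_n.+1) (f g : fseries R n).

Lemma germ_eqP p f g : germ_eq p f g <->
  exists2 r, 0 < r & eq_on (polydisc (col' ord_max p) r) f g.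
Proof.
split; first by move=> /nbhs_polydiscP[r r0 h]; exists r.
by move=> [r r0 h]; apply/nbhs_polydiscP; exists r.
Qed.

Lemma germ_eq_sym p f g : germ_eq p f g -> germ_eq p g f.
Proof. by move/germ_eqP => [r r0 h]; apply/germ_eqP; exists r => //; exact: eq_on_sym. Qed.

Lemma convergent_at_congr p f g : convergent_at p f -> germ_eq p f g -> convergent_at p g.
Proof.
move=> [F hF] /germ_eqP[r r0 fg]; exists F.
apply: filterS2 hF (nbhs_polydisc (polydisc_center p r0)) => x [FA hx] xp; split=> //.
apply: cvg_cplx_ext hx => M; apply: eq_bigr => i _; congr (_ * _); apply: fg.
by move=> v; rewrite !mxE.
Qed.

Lemma gevrey_congr (s : \bar R) p f g : gevrey s p f -> germ_eq p f g -> gevrey s p g.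
Proof.
move=> [fA fs] fg; split.
  have /germ_eqP[r r0 h] := fg.
  apply: filterS2 fA (nbhs_polydisc (polydisc_center (col' ord_max p) r0)) => y fy yp i.
  apply: analytic_congr (fy i) _.
  by apply: filterS (nbhs_polydisc yp) => z zp; exact: h.
case: s fs => // s /convergent_at_congr; apply.
by apply: filterS fg => y fgy i; rewrite fgy.
Qed.

Lemma convergent_atD p f g : convergent_at p f -> convergent_at p g ->
  convergent_at p (fun i y => f i y + g i y).
Proof.
move=> [F hF] [G hG]; exists (fun x => F x + G x).
apply: filterS2 hF hG => x [FA hf] [GA hg]; split; first exact: analyticD.
apply: cvg_cplx_ext (cvg_cplxD hf hg); elim=> [|M IH]; first by rewrite !big_ord0 addr0.
by rewrite !big_ord_recr /= -IH mulrDl addrACA.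
Qed.

Lemma convergent_atZ p (c : C) f : convergent_at p f ->
  convergent_at p (fun i y => c * f i y).
Proof.
move=> [F hF]; exists (fun x => c * F x).
apply: filterS hF => x [FA hf]; split; first exact: analyticZ.
have h := cvg_cplxZ (c := c) hf.
apply: cvg_cplx_ext h; elim=> [|M IH]; first by rewrite !big_ord0 mulr0.
by rewrite !big_ord_recr /= -IH mulrDr mulrA.
Qed.

Lemma convergent_at0 p : convergent_at p (fun _ _ => 0 : C).
Proof.
exists (fun=> 0); apply: filterS (@filterT _ _ (nbhs_filter p)) => x _; split;
  first exact: analytic0.
have h : (fun _ : nat => 0 : C) @ \oo --> (0 : C) by exact: cvg_cst.
apply: cvg_cplx_ext h => M.
by rewrite big1// => i _; rewrite mul0r.
Qed.

Lemma convergent_at_lincomb p r (c : 'I_r -> C) (phi : 'I_r -> fseries R n) :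
  (forall j, convergent_at p (phi j)) -> convergent_at p (lincomb c phi).
Proof.
move=> h; rewrite /lincomb; elim: (index_enum 'I_r) => [|j s IH].
  apply: convergent_at_congr (convergent_at0 p) _.
  by apply/germ_eqP; exists 1 => // y _ i; rewrite big_nil.
apply: convergent_at_congr (convergent_atD (convergent_atZ (c j) (h j)) IH) _.
by apply/germ_eqP; exists 1 => // y _ i; rewrite big_cons.
Qed.

Lemma gevrey_lincomb (s : \bar R) p r (c : 'I_r -> C) (phi : 'I_r -> fseries R n) :
  s != -oo%E -> (forall j, gevrey s p (phi j)) -> gevrey s p (lincomb c phi).
Proof.
move=> sN h; split.
  have hA : \forall y \near (col' ord_max p : 'rV[C]_n), forall j i, analytic_at (phi j i) y.
    exact: (@filter_forall _ 'I_r (fun j y => forall i, analytic_at (phi j i) y) _ (nbhs_filter _)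
      (fun j => (h j).1)).
  apply: filterS hA => y hy i.
  rewrite /lincomb; elim: (index_enum 'I_r) => [|j e IH].
    apply: (@analytic_congr R n (fun=> 0)); first exact: analytic0.
    by apply: filterE => z; rewrite big_nil.
  apply: analytic_congr (analyticD (analyticZ (c j) (hy j i)) IH) _.
  by apply: filterE => z; rewrite big_cons.
case: s sN h => // s _ h.
apply: convergent_at_congr (convergent_at_lincomb c (fun j => (h j).2)) _.
apply/germ_eqP; exists 1 => // y _ i; rewrite /lincomb mulr_suml.
by apply: eq_bigr => j _; rewrite mulrA.
Qed.

End GevreyClosure.

Section SolutionClosure.
Variables (R : realType) (n : nat) (a : 'I_n.+1 -> nat) (beta : cplx R).
Local Notation C := (cplx R).
Implicit Types (f g : fseries R n).

Lemma is_solution_sub (U V : set 'rV[C]_n) f : V `<=` U ->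
  is_solution a beta U f -> is_solution a beta V f.
Proof.
move=> VU [fA fD fE]; split; first by move=> y /VU; exact: fA.
  by move=> v y /VU; exact: fD.
by move=> y /VU; exact: fE.
Qed.

Variable U : set 'rV[C]_n.
Hypothesis U_nbhs : forall y, U y -> nbhs y U.
Variables (r : nat) (c : 'I_r -> C) (phi : 'I_r -> fseries R n).

Lemma iter_fderiv_lincomb (j : 'I_n.+1) k : (forall t, analytic_on U (phi t)) ->
  eq_on U (iter k (fderiv j) (lincomb c phi)) (lincomb c (fun t => iter k (fderiv j) (phi t))).
Proof.
move=> hA y Uy i.
have := act_comb U_nbhs c hA (weyl_prod (nseq k (WD R j))) (index_enum 'I_r) Uy i.
rewrite weyl_act_WDn => ->; apply: eq_bigr => t _.
by rewrite weyl_act_WDn.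
Qed.

Lemma is_solution_lincomb : (forall t, is_solution a beta U (phi t)) ->
  is_solution a beta U (lincomb c phi).
Proof.
move=> h; have hA t : analytic_on U (phi t) by case: (h t).
split; first exact: analytic_on_comb.
  move=> v; apply: eq_on_trans (eq_on_sym (iter_fderiv_lincomb ord0 (a v) hA)).
  apply: eq_on_trans (iter_fderiv_lincomb v 1 hA) _ => y Uy i.
  by apply: eq_bigr => t _; have [_ hD _] := h t; rewrite /= hD.
move=> y Uy i.
rewrite [LHS](act_comb U_nbhs c hA (euler_op a beta) (index_enum 'I_r) Uy i).
by rewrite big1// => t _; have [_ _ ->] := h t; rewrite ?mulr0.
Qed.

End SolutionClosure.

Section StalkSolutions.
Variables (R : realType) (d : nat) (a : 'I_d.+3 -> nat).
Hypothesis a1 : a ord0 = 1%N.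
Hypothesis a_incr : forall i j : 'I_d.+3, (i < j)%N -> (a i < a j)%N.
Local Notation C := (cplx R).
Local Notation N := (a (penult d)).
Implicit Types (p : 'rV[C]_d.+3) (f : fseries R d.+2) (w : 'rV[C]_d.+2) (s : \bar R).

Lemma branch_near w ell : w 0 ord_max != 0 -> log_branch (w 0 ord_max) ell ->
  nbhs w (fun y : 'rV[C]_d.+2 => log_branch (y 0 ord_max) ell /\ y 0 ord_max != 0).
Proof.
move=> w0 /nbhs_cplxP[e e0 he].
apply/nbhs_polydiscP; exists (Num.min e (cnorm (w 0 ord_max))).
  by rewrite lt_min e0 cnorm_gt0.
move=> y yw; have := yw ord_max; rewrite lt_min => /andP[ye yn]; split; last first.
  by apply: contraTN yn => /eqP ->; rewrite sub0r cnormN ltxx.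
apply/nbhs_cplxP; exists (e - cnorm (y 0 ord_max - w 0 ord_max)); first by rewrite subr_gt0.
move=> z zy; apply: he; rewrite -[z](subrK (y 0 ord_max)) -addrA.
by apply: le_lt_trans (cnormD _ _) _; rewrite -ltrBrDr.
Qed.

Lemma branch_radius w (r : nat) (ell : 'I_r -> C -> C) : w 0 ord_max != 0 ->
  (forall j, log_branch (w 0 ord_max) (ell j)) ->
  exists2 e : R, 0 < e & forall j y, polydisc w e y ->
    log_branch (y 0 ord_max) (ell j) /\ y 0 ord_max != 0.
Proof.
move=> w0 hb.
have /nbhs_polydiscP[e e0 he] := @filter_forall _ 'I_r
  (fun j (y : 'rV[C]_d.+2) => log_branch (y 0 ord_max) (ell j) /\ y 0 ord_max != 0) _
    (nbhs_filter w)
  (fun j => branch_near w0 (hb j)).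
by exists e => // j y /he.
Qed.

Lemma recurrenceB n (b : 'I_n -> nat) (x : 'I_n -> C) beta D E :
  recurrence b x beta D -> recurrence b x beta E ->
  recurrence b x beta (fun k => D k - E k).
Proof.
move=> hD hE k; apply: etrans (etrans (congr2 (fun z z' => z - z') (hD k) (hE k)) (subr0 0)).
rewrite opprD addrACA -mulrBr -sumrB.
by congr (_ + _); apply: eq_bigr => v _; rewrite mulrBr.
Qed.

Variable beta : C.

Lemma taylor_lincomb (U : set 'rV[C]_d.+2) r (c : 'I_r -> C) (phi : 'I_r -> fseries R d.+2) w k :
  (forall y, U y -> nbhs y U) -> (forall t, analytic_on U (phi t)) -> U w ->
  taylor_fun (lincomb c phi) w k = \sum_(t < r) c t * taylor_fun (phi t) w k.
Proof. by move=> hU hA Uw; have := iter_fderiv_lincomb hU c ord0 k hA Uw 0%N. Qed.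

Lemma ext0_congr s p f f' : ext0 a beta s p f -> germ_eq p f f' -> ext0 a beta s p f'.
Proof.
move=> hf ff'; have [r r0 sf] := ext0_solution a1 hf.
have [r' r'0 hr'] := (germ_eqP p f f').1 ff'.
have m0 : 0 < Num.min r r' by rewrite lt_min r0.
apply: (@solution_ext0 R d a beta s p f' (Num.min r r')) => //; last first.
  by apply: gevrey_congr ff'; case: hf.
apply: (@is_solution_eq R d.+2 a beta _ _ f).
- by move=> y; exact: nbhs_polydisc.
- by apply: is_solution_sub sf; apply: polydisc_le; rewrite ge_min lexx.
- by move=> y yp; apply: hr'; apply: polydisc_le yp; rewrite ge_min lexx orbT.
Qed.

Lemma ext0_lincomb s p r (c : 'I_r -> C) (phi : 'I_r -> fseries R d.+2) :
  s != -oo%E -> (forall t, ext0 a beta s p (phi t)) -> ext0 a beta s p (lincomb c phi).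
Proof.
move=> sN h; pose w : 'rV[C]_d.+2 := col' ord_max p.
have [e e0 he] : exists2 e : R, 0 < e & forall t, is_solution a beta (polydisc w e) (phi t).
  suff : forall L : seq 'I_r, exists2 e : R, 0 < e & forall t, t \in L -> is_solution a beta
    (polydisc w e) (phi t).
    by move=> /(_ (enum 'I_r))[e e0 he]; exists e => // t; apply: he; rewrite mem_enum.
  elim=> [|t L [e e0 he]]; first by exists 1.
  have [e' e'0 he'] := ext0_solution a1 (h t).
  exists (Num.min e e') => [|u]; first by rewrite lt_min e0.
  rewrite inE => /orP[/eqP ->|uL]; [apply: is_solution_sub he'|apply: is_solution_sub (he u uL)];
    by apply: polydisc_le; rewrite ge_min lexx ?orbT.
apply: (solution_ext0 e0); last by apply: gevrey_lincomb => // t; case: (h t).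
by apply: is_solution_lincomb => // y; exact: nbhs_polydisc.
Qed.

Lemma ext0_zero s p : s != -oo%E -> ext0 a beta s p (fun _ _ => 0).
Proof.
move=> sN; rewrite (_ : (fun _ _ => 0) = lincomb (fun _ : 'I_0 => 0) (fun=> fun _ _ => 0) :>
  fseries R d.+2).
  by apply: ext0_lincomb => // -[].
by apply/funext => i; apply/funext => y; rewrite /lincomb big_ord0.
Qed.

Lemma ext0_scale s p (c : C) f : s != -oo%E -> ext0 a beta s p f ->
  ext0 a beta s p (fun i y => c * f i y).
Proof.
move=> sN hf; rewrite (_ : (fun i y => c * f i y) = lincomb (fun _ : 'I_1 => c) (fun=> f)).
  exact: ext0_lincomb.
by apply/funext => i; apply/funext => y; rewrite /lincomb big_ord1.
Qed.

(** Domination is requested for finite [s] only, the order [+oo] involving no convergence in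
    [x_n]. *)
Lemma ext0_gamma s p j ell : (j < N)%N -> p 0 ord_max = 0 -> p 0 (penult d) != 0 ->
  log_branch (p 0 (penult d)) ell -> s != -oo%E ->
  (forall r, s = r%:E -> dominated a (gamma_exp a beta j) r) ->
  ext0 a beta s p (gamma_series a beta ell j).
Proof.
move=> jN p0 pn hb sN hs; pose w : 'rV[C]_d.+2 := col' ord_max p.
have wE : w 0 ord_max = p 0 (penult d) by rewrite mxE.
rewrite -wE in hb pn; have /nbhs_polydiscP[e e0 he] := branch_near pn hb.
have wU := polydisc_center w e0.
have Un y : polydisc w e y -> nbhs y (polydisc w e) by exact: nbhs_polydisc.
apply: (solution_ext0 e0); first exact: gamma_solution.
split; first exact: (gamma_formal_germ a1 a_incr beta jN Un he).
case: s sN hs => // r _ /(_ r erefl) dom.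
exact: (gamma_convergent a1 a_incr jN Un he dom).
Qed.

Lemma ext0_taylor_eq s p f f' : ext0 a beta s p f -> ext0 a beta s p f' ->
  (forall k, taylor_fun f (col' ord_max p) k = taylor_fun f' (col' ord_max p) k) ->
  germ_eq p f f'.
Proof.
move=> hf hf' E; have [r r0 sf] := ext0_solution a1 hf.
have [r' r'0 sf'] := ext0_solution a1 hf'.
have m0 : 0 < Num.min r r' by rewrite lt_min r0.
have mr : Num.min r r' <= r by rewrite ge_min lexx.
have mr' : Num.min r r' <= r' by rewrite ge_min lexx orbT.
have [e e0 he] := solution_germ_unique m0
  (is_solution_sub (polydisc_le mr) sf) (is_solution_sub (polydisc_le mr') sf') E.
by apply/germ_eqP; exists e.
Qed.

Lemma ext0_recurrence s p f : ext0 a beta s p f ->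
  recurrence (ywt a) (fun v => col' ord_max p 0 v) beta (taylor_fun f (col' ord_max p)).
Proof.
by move=> hf; have [r r0 sf] := ext0_solution a1 hf; exact: solution_taylor_recurrence r0 sf.
Qed.

End StalkSolutions.

(** * Orders at least [a_n / a_(n-1)] *)

Section DirectSum.
Variables (R : realType) (d : nat) (a : 'I_d.+3 -> nat).
Hypothesis a1 : a ord0 = 1%N.
Hypothesis a_incr : forall i j : 'I_d.+3, (i < j)%N -> (a i < a j)%N.
Local Notation C := (cplx R).
Local Notation N := (a (penult d)).
Variables (beta : C) (p : 'rV[C]_d.+3) (s : \bar R) (ell : 'I_N -> C -> C).
Hypothesis p0 : p 0 ord_max = 0.
Hypothesis pn : p 0 (penult d) != 0.
Hypothesis hb : forall j, log_branch (p 0 (penult d)) (ell j).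
Hypothesis hs : (((a ord_max)%:R / N%:R : R)%:E <= s)%E.
Let w : 'rV[C]_d.+2 := col' ord_max p.
Let phi (j : 'I_N) : fseries R d.+2 := gamma_series a beta (ell j) j.

Let wn : w 0 ord_max != 0. Proof. by rewrite mxE. Qed.

Let wb j : log_branch (w 0 ord_max) (ell j). Proof. by rewrite mxE. Qed.

Let sN : s != -oo%E. Proof. by case: s hs. Qed.

Let phi_ext0 j : ext0 a beta s p (phi j).
Proof.
apply: ext0_gamma => // r sr; move: hs; rewrite sr lee_fin => hr.
apply: dominated_critical => //.
by rewrite mulrC -ler_pdivrMr// ltr0n a_gt0.
Qed.

Let phi_independent (c : 'I_N -> C) :
  (forall k, \sum_(j < N) c j * taylor_fun (phi j) w k = 0) -> forall j, c j = 0.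
Proof.
move=> h; apply: (@gamma_independent R d a a1 a_incr beta ell w) => // k.
have [e e0 he] := branch_radius wn wb.
rewrite -[RHS](h k); apply: eq_bigr => j _; congr (_ * _).
by rewrite (gamma_taylor a1 a_incr beta (ltn_ord j) _ (he j) k (polydisc_center w e0))// => y;
  exact: nbhs_polydisc.
Qed.

Let recurrence_zero D : recurrence (ywt a) (fun v => w 0 v) beta D ->
  (forall k : 'I_N, D k = 0) -> forall k, D k = 0.
Proof.
move=> hD h; apply: (recurrence_unique (v0 := ord_max) hD) => //.
- by rewrite ywt_penult a_gt0.
- by move=> v vm; rewrite ywt_penult ywt_lt.
- by rewrite ywt_penult => k kN; exact: h (Ordinal kN).
Qed.

Let taylor_matrix : 'M[C]_N := \matrix_(j, k) taylor_fun (phi j) w k.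

Let comb_recurrence (c : 'I_N -> C) :
  recurrence (ywt a) (fun v => w 0 v) beta (fun k => \sum_(j < N) c j * taylor_fun (phi j) w k).
Proof. by apply: recurrence_comb => j; exact: ext0_recurrence (phi_ext0 j). Qed.

(** A vector in the left kernel gives a combination whose first [N] Taylor numbers vanish. By the
    recurrence all of them vanish, and independence makes the vector zero. *)
Let taylor_matrix_unit : taylor_matrix \in unitmx.
Proof.
rewrite -row_free_unit -kermx_eq0; apply/eqP/row_matrixP => i; rewrite row0.
set u := row i _; have uM : u *m taylor_matrix = 0 by apply/sub_kermxP; exact: row_sub.
apply/rowP => j; rewrite [RHS]mxE; apply: (phi_independent (c := fun t => u 0 t)).
apply: recurrence_zero (comb_recurrence _) _ => k.
have := congr1 (fun v : 'rV[C]_N => v 0 k) uM; rewrite !mxE => E; rewrite -[RHS]E.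
by apply: eq_bigr => t _; rewrite [taylor_matrix _ _]mxE.
Qed.

Let taylor_lincomb_phi (c : 'I_N -> C) k :
  taylor_fun (lincomb c phi) w k = \sum_(j < N) c j * taylor_fun (phi j) w k.
Proof.
have [e e0 he] := branch_radius wn wb.
have Un y : polydisc w e y -> nbhs y (polydisc w e) by exact: nbhs_polydisc.
apply: (taylor_lincomb c k Un _ (polydisc_center w e0)) => t.
by have [] := gamma_solution a1 a_incr beta (ltn_ord t) Un (he t).
Qed.

Lemma ext0_direct_sum : is_direct_sum p (ext0 a beta s p) phi.
Proof.
split=> [f|c].
  split=> [hf|[c fc]]; last first.
    by apply: (@ext0_congr _ _ _ a1 beta _ _ (lincomb c phi));
      [exact: ext0_lincomb|exact: germ_eq_sym].
  (* The coefficients that match the first [N] Taylor numbers of [f]; the recurrence then matches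
     all the others. *)
  pose u : 'rV[C]_N := (\row_k taylor_fun f w k) *m invmx taylor_matrix.
  exists (fun j => u 0 j).
  apply: (ext0_taylor_eq a1 hf (ext0_lincomb a1 _ sN phi_ext0)) => k.
  apply/eqP; rewrite -subr_eq0 -/w taylor_lincomb_phi; apply/eqP; move: k.
  apply: (@recurrence_zero (fun k => taylor_fun f w k - \sum_(j < N) u 0 j * taylor_fun (phi j) w
    k)).
    exact: recurrenceB (ext0_recurrence a1 hf) (comb_recurrence _).
  move=> k; apply/eqP; rewrite subr_eq0; apply/eqP.
  have := congr1 (fun v : 'rV[C]_N => v 0 k) (mulmxKV taylor_matrix_unit (\row_k taylor_fun f w k)).
  rewrite -/u [in RHS]mxE => <-; rewrite mxE; apply: eq_bigr => j _.
  by rewrite [taylor_matrix _ _]mxE.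
move=> /germ_eqP[r r0 hc]; apply: phi_independent => k.
rewrite -taylor_lincomb_phi.
have Un y : polydisc w r y -> nbhs y (polydisc w r) by exact: nbhs_polydisc.
have A0 : analytic_on (polydisc w r) (fun _ _ => 0 : C) by move=> y _ i; exact: analytic0.
have Al : analytic_on (polydisc w r) (lincomb c phi) by exact: analytic_on_eq A0 (eq_on_sym hc).
have E0 : eq_on (polydisc w r) (lincomb c phi) (fun i y => 0 * lincomb c phi i y).
  by move=> y yr i; rewrite (hc y yr) mul0r.
have yw := polydisc_center w r0.
apply: etrans (eq_on_iter Un ord0 k Al E0 yw 0%N) _.
have := act_scale Un (weyl_prod (nseq k (WD R ord0))) 0 Al yw 0%N.
by rewrite !weyl_act_WDn mul0r.
Qed.

End DirectSum.

(** * Orders below [a_n / a_(n-1)] *)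

Section SmallOrder.
Variables (R : realType) (d : nat) (a : 'I_d.+3 -> nat).
Hypothesis a1 : a ord0 = 1%N.
Hypothesis a_incr : forall i j : 'I_d.+3, (i < j)%N -> (a i < a j)%N.
Local Notation C := (cplx R).
Local Notation N := (a (penult d)).
Variables (beta : C) (p : 'rV[C]_d.+3) (s : R) (ell : C -> C).
Hypothesis p0 : p 0 ord_max = 0.
Hypothesis pn : p 0 (penult d) != 0.
Hypothesis hb : log_branch (p 0 (penult d)) ell.
Hypothesis s1 : 1 <= s.
Hypothesis hs : s < (a ord_max)%:R / N%:R.
Let w : 'rV[C]_d.+2 := col' ord_max p.

Let wn : w 0 ord_max != 0. Proof. by rewrite mxE. Qed.

Let wb : log_branch (w 0 ord_max) ell. Proof. by rewrite mxE. Qed.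

(** Both Taylor sequences vanish from some index on, hence so does their difference, and descent
    applies. Taking [f'] to be zero or a multiple of [phi_(v^q)] covers both cases of (ii). *)
Lemma ext0_small_order_vanish f f' : ext0 a beta s%:E p f -> ext0 a beta s%:E p f' ->
  (forall k : nat, beta = k%:R -> taylor_fun f w k = taylor_fun f' w k) -> germ_eq p f f'.
Proof.
move=> hf hf' hb'; apply: (ext0_taylor_eq a1 hf hf') => k; apply/eqP; rewrite -subr_eq0.
have van f0 : ext0 a beta s%:E p f0 -> exists k0, forall k, (k0 <= k)%N -> taylor_fun f0 w k = 0.
  move=> h0; have [r r0 sf] := ext0_solution a1 h0.
  by apply: solution_gevrey_vanish p0 r0 s1 hs sf _ => //; case: h0.
have [k1 h1] := van f hf; have [k2 h2] := van f' hf'.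
have rec := recurrenceB (ext0_recurrence a1 hf) (ext0_recurrence a1 hf').
have b0 v : (0 < ywt a v)%N by exact: a_gt0.
apply/eqP; move: k; apply: (recurrence_backward b0 (k0 := maxn k1 k2) rec).
- by move=> m; rewrite geq_max => /andP[/h1 -> /h2 ->]; rewrite subr0.
- by move=> m /hb'; rewrite -/w => ->; rewrite subrr.
Qed.

(** At order [j + N l0], which is [beta] in the application, the constraint leaves only the constant
    term [al = 0], [l = l0]. It shows that [D_beta] of the polynomial is nonzero. *)
Lemma psi_top (j l0 : nat) (y : 'rV[C]_d.+2) : psi a j (l0%:R : C) ell (j + N * l0) y = (l0`!)%:R.
Proof.
apply: famsumE.
have E : psi_term a j (l0%:R : C) ell (j + N * l0) y (mi0 _, l0) = (l0`!)%:R.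
  rewrite /psi_term /= /adeg big1 => [|v _]; last by rewrite ffunE muln0.
  rewrite add0n eqxx subrr mul0r cexp0 vmon0 mifact0 divr1 !mulr1.
  elim: (l0) => [|l IH]; first by rewrite /ffact_C big_ord0.
  rewrite factS natrM -IH /ffact_C big_ord_recl subr0; congr (_ * _).
  by apply: eq_bigr => i _; rewrite /bump /= natrD -[l.+1%:R]natr1 [1%:R + _]addrC opprD addrACA
    subrr addr0.
rewrite -[X in has_sum _ X]E; apply: has_sum_single => -[al l] h; rewrite /psi_term /=.
case: (_ =P (j + N * l)%N) => // hS.
have [ll|ll] := ltnP l0 l; first by rewrite /ffact_C (bigD1 (Ordinal ll))//= subrr !mul0r.
have N0 : (0 < N)%N by exact: a_gt0.
have : (adeg a al + N * l0 <= 0 + N * l0)%N.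
  rewrite add0n; move/eqP: hS; rewrite addnCA eqn_add2l => /eqP ->.
  by rewrite leq_mul2l ll orbT.
rewrite leq_add2r leqn0 => /eqP al0; case/eqP: h; congr (_, _).
  apply/ffunP => v; rewrite ffunE; apply/eqP; move/eqP: al0.
  rewrite /adeg sum_nat_eq0 => /forall_inP/(_ v isT); rewrite muln_eq0 => /orP[|//].
  by rewrite -leqn0 leqNgt a_gt0.
by move/eqP: hS; rewrite al0 add0n eqn_add2l eqn_pmul2l// => /eqP.
Qed.

Lemma gamma_polynomial_germ (q l0 : nat) : (q < N)%N -> gamma_exp a beta q = l0%:R ->
  is_polynomial p (gamma_series a beta ell q).
Proof.
move=> qN gE; exists (gamma_mpoly R a q l0).
apply: filterS (branch_near wn wb) => y [/nbhs_singleton[_ yE] y0] i.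
exact: gamma_mpolyE.
Qed.

Lemma ext0_small_order (q l0 : nat) f : (q < N)%N -> gamma_exp a beta q = l0%:R ->
  ext0 a beta s%:E p f <-> exists c, germ_eq p f (fun i y => c * gamma_series a beta ell q i y).
Proof.
move=> qN gE; have sE : s%:E != -oo%E by [].
have hg : ext0 a beta s%:E p (gamma_series a beta ell q).
  by apply: ext0_gamma => // r [<-]; rewrite gE; exact: dominated_polynomial.
split=> [hf|[c fc]]; last exact: ext0_congr (ext0_scale a1 c sE hg) (germ_eq_sym fc).
have N0 : N%:R != 0 :> C by rewrite pnatr_eq0 -lt0n a_gt0.
have bE : beta = (q + N * l0)%:R.
  by rewrite natrD natrM -gE /gamma_exp mulrCA mulfV// mulr1 addrC subrK.
have /nbhs_polydiscP[e e0 he] := branch_near wn wb.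
have Un y : polydisc w e y -> nbhs y (polydisc w e) by exact: nbhs_polydisc.
have we := polydisc_center w e0.
have TE : taylor_fun (gamma_series a beta ell q) w (q + N * l0) = (q`!)%:R * (l0`!)%:R.
  by rewrite (gamma_taylor a1 a_incr beta qN Un he _ we) gE psi_top.
set T := taylor_fun (gamma_series _ _ _ _) _ _ in TE.
have T0 : T != 0 by rewrite TE mulf_neq0// pnatr_eq0 -lt0n fact_gt0.
(* The multiple of [phi_(v^q)] with the same [D_beta] as [f]. *)
exists (taylor_fun f w (q + N * l0) / T).
apply: ext0_small_order_vanish hf (ext0_scale a1 _ sE hg) _ => k.
rewrite [in X in X -> _]bE => /eqP; rewrite eqr_nat => /eqP <-; symmetry.
have [gA _ _] := gamma_solution a1 a_incr beta qN Un he.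
have := act_scale Un (weyl_prod (nseq (q + N * l0) (WD R ord0))) (taylor_fun f w (q + N * l0) / T)
  gA we 0%N.
rewrite !weyl_act_WDn => E; apply: etrans E _.
by rewrite -/(taylor_fun _ _ _) -/T divfK.
Qed.

Lemma gamma_exp_unique (b : nat) : beta = b%:R ->
  exists! q : 'I_N, exists l : nat, gamma_exp a beta q = l%:R.
Proof.
move=> bE; have N0 : (0 < N)%N by exact: a_gt0.
have NC : N%:R != 0 :> C by rewrite pnatr_eq0 -lt0n.
(* The remainder of [b] modulo [N]; the quotient is then the value of [gamma_exp]. *)
exists (Ordinal (ltn_pmod b N0)); split.
  exists (b %/ N)%N; rewrite /gamma_exp bE /= {1}(divn_eq b N) natrD addrK natrM.
  by rewrite mulfK.
move=> q [l ql]; apply: val_inj => /=.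
have : (b%:R : C) = (l * N + q)%:R by rewrite natrD natrM -ql /gamma_exp divfK// subrK bE.
by move/eqP; rewrite eqr_nat => /eqP ->; rewrite modnMDl modn_small.
Qed.

End SmallOrder.

Theorem theorem4p21 (R : realType) (d : nat) (a : 'I_d.+3 -> nat)
    (a1 : a ord0 = 1%N)
    (a_incr : forall i j : 'I_d.+3, (i < j)%N -> (a i < a j)%N) :
  (forall (beta : cplx R) (p : 'rV[cplx R]_d.+3) (s : \bar R)
      (ell : 'I_(a (penult d)) -> cplx R -> cplx R),
    p 0 ord_max = 0 -> p 0 (penult d) != 0 ->
    (forall j, log_branch (p 0 (penult d)) (ell j)) ->
    (((a ord_max)%:R / (a (penult d))%:R : R)%:E <= s)%E ->
    is_direct_sum p (ext0 a beta s p)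
      (fun j : 'I_(a (penult d)) => gamma_series a beta (ell j) j))
  /\
  (forall (beta : cplx R) (p : 'rV[cplx R]_d.+3) (s : \bar R)
      (ell : cplx R -> cplx R),
    p 0 ord_max = 0 -> p 0 (penult d) != 0 ->
    log_branch (p 0 (penult d)) ell ->
    (1%:E <= s)%E -> (s < ((a ord_max)%:R / (a (penult d))%:R : R)%:E)%E ->
    ((~ exists b : nat, beta = b%:R) ->
      forall f, ext0 a beta s p f <-> germ_eq p f (fun _ _ => 0))
    /\
    ((exists b : nat, beta = b%:R) ->
      (exists! q : 'I_(a (penult d)), exists l : nat, gamma_exp a beta q = l%:R)
      /\
      (forall q : 'I_(a (penult d)), (exists l : nat, gamma_exp a beta q = l%:R) ->
        is_polynomial p (gamma_series a beta ell q) /\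
        (forall f, ext0 a beta s p f <->
           exists c, germ_eq p f (fun i y => c * gamma_series a beta ell q i y))))).
Proof.
(* In the second part the bounds exclude both infinite orders, so that [s] is real. *)
split=> [beta p s ell p0 pn hb hs|beta p [s| |] ell p0 pn hb //].
  exact: ext0_direct_sum.
rewrite lee_fin lte_fin => s1 hs; split.
  move=> hbeta f; split=> [hf|f0]; last exact: ext0_congr (ext0_zero a1 beta p _) (germ_eq_sym f0).
  apply: (ext0_small_order_vanish a1 a_incr p0 s1 hs hf (ext0_zero a1 beta p _)) => //.
  by move=> k bk; case: hbeta; exists k.
move=> [b bE]; split; first exact: gamma_exp_unique bE.
move=> q [l ql]; split; first exact: gamma_polynomial_germ ql.
by move=> f; exact: ext0_small_order ql.
Qed.
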